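(* Let $X$ and $Y$ be Banach spaces such that either $X$ has the dual quantitative Dunford-Pettis property or $Y$ has the direct quantitative Dunford-Pettis property. If $X$ is subspace of a WCG space and $Y$ is WCG, then the projective tensor product $X\widehat{\otimes}_\pi Y$ is subspace of a WCG space.
   Context: All Banach spaces are real. A Banach space $X$ is weakly compactly generated (WCG) if there is a weakly compact set $G\subseteq X$ such that $X=\overline{\mathrm{span}}(G)$ (norm closed linear span). ''Subspace of a WCG space'' means isomorphic to a norm closed linear subspace of some WCG Banach space. For a bounded subset $M$ of a Banach space $Z$, put ${\rm wk}_Z(M):=\sup\{d(z^{**},Z): z^{**}\in\overline{M}^{w^*}\}$, where $Z$ is regarded as a subspace of $Z^{**}$, $d(z^{**},Z)=\inf\{\|z^{**}-z\|:z\in Z\}$ and $\overline{M}^{w^*}$ is the $w^*$-closure of $M$ in $Z^{**}$. $B_Z$ denotes the closed unit ball of $Z$. A Banach space $X$ has the direct quantitative Dunford-Pettis property if there is a constant $C>0$ such that for every weakly null sequence $(x_n)_{n\in\mathbb{N}}$ in $B_X$ and every bounded sequence $(x_n^* )_{n\in\mathbb{N}}$ in $X^*$ we have $\limsup_{n\to\infty}|x_n^*(x_n)|\le C\,{\rm wk}_{X^*}(\{x_n^*:n\in\mathbb{N}\})$. A Banach space $X$ has the dual quantitative Dunford-Pettis property if there is a constant $C>0$ such that for every bounded sequence $(x_n)_{n\in\mathbb{N}}$ in $X$ and every weakly null sequence $(x_n^* )_{n\in\mathbb{N}}$ in $B_{X^*}$ we have $\limsup_{n\to\infty}|x_n^*(x_n)|\le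 C\,{\rm wk}_{X}(\{x_n:n\in\mathbb{N}\})$. *)

(* Defs.v *)
From HB Require Import structures.
From mathcomp Require Import all_boot all_order all_algebra.
From mathcomp Require Import generic_quotient.
From mathcomp Require Import all_classical all_reals all_analysis.
From mathcomp Require Import ring.

Set Implicit Arguments.
Unset Strict Implicit.
Unset Printing Implicit Defensive.

Import Order.TTheory GRing.Theory Num.Theory.
Import numFieldNormedType.Exports.

Local Open Scope classical_set_scope.
Local Open Scope ring_scope.

Section Dual.
Context {R : realType} (X : normedModType R).

(* [R^o] is [R] as a module over itself. *)
Definition dual_pred : {pred X -> R^o} :=
  [pred f | `[< linear f /\ continuous f >]].

Lemma dual_submod : submod_closed dual_pred.
Proof.
split=> [|a f g].
  rewrite inE; split; last by move=> x; exact: cvg_cst.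
  by move=> a x y; rewrite /= scaler0 addr0.
rewrite !inE => -[fl fc] [gl gc]; split.
  move=> b x y; rewrite /= !fctE fl gl !scalerDr !scalerA mulrC.
  by rewrite addrACA.
move=> x; rewrite /= !fctE; apply: cvgD; last exact: gc.
by apply: cvgZl_tmp; exact: fc.
Qed.

HB.instance Definition _ := GRing.isSubmodClosed.Build R _ dual_pred dual_submod.

Record dual := Dual { dual_fun :> X -> R^o; dual_funP : dual_fun \in dual_pred }.

HB.instance Definition _ := [isSub for dual_fun].
HB.instance Definition _ := [Choice of dual by <:].
HB.instance Definition _ := [SubChoice_isSubLmodule of dual by <:].

Lemma dual_linear (f : dual) : linear f.
Proof. by have := dual_funP f; rewrite inE => -[]. Qed.

HB.instance Definition _ (f : dual) :=
  GRing.isLinear.Build R X R^o *:%R f (@dual_linear f).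

Lemma dual_continuous (f : dual) : continuous f.
Proof. by have := dual_funP f; rewrite inE => -[]. Qed.

Definition dual_norm (f : dual) : R :=
  sup [set `|f x| | x in [set x : X | `|x| <= 1]].

Lemma dual_has_sup (f : dual) :
  has_sup [set `|f x| | x in [set x : X | `|x| <= 1]].
Proof.
split; first by exists `|f 0|, 0 => //=; rewrite normr0.
have /linear_bounded_continuous/bounded_funP/(_ 1)[M Mf] := @dual_continuous f.
by exists M => _ [x /= x1 <-]; exact: Mf.
Qed.

Lemma dual_norm_ge (f : dual) x : `|x| <= 1 -> `|f x| <= dual_norm f.
Proof. by move=> x1; apply: sup_ubound; [exact: (dual_has_sup f).2|exists x]. Qed.

Lemma dual_norm_le (f : dual) M :
  (forall x, `|x| <= 1 -> `|f x| <= M) -> dual_norm f <= M.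
Proof.
move=> fM; apply: ge_sup; first exact: (dual_has_sup f).1.
by move=> _ [x x1 <-]; exact: fM.
Qed.

Lemma dual_norm_ge0 (f : dual) : 0 <= dual_norm f.
Proof. by rewrite (le_trans (normr_ge0 (f 0)))// dual_norm_ge// normr0. Qed.

Lemma dual_op_norm (f : dual) x : `|f x| <= dual_norm f * `|x|.
Proof.
have [->|x0] := eqVneq x 0; first by rewrite linear0 !normr0 mulr0.
have nx : 0 < `|x| by rewrite normr_gt0.
rewrite -ler_pdivrMr//.
have /dual_norm_ge : `| `|x|^-1 *: x | <= 1.
  by rewrite normrZ normfV normr_id mulVf// gt_eqF.
move=> /(_ f); rewrite linearZ/= normrZ normfV normr_id mulrC; exact.
Qed.

Lemma dual_normD f g : dual_norm (f + g) <= dual_norm f + dual_norm g.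
Proof.
apply: dual_norm_le => x x1; rewrite /= (le_trans (ler_normD _ _))//.
by rewrite lerD// dual_norm_ge.
Qed.

Lemma dual_normZ a f : dual_norm (a *: f) = `|a| * dual_norm f.
Proof.
have le b g : dual_norm (b *: g) <= `|b| * dual_norm g.
  apply: dual_norm_le => x x1.
  by rewrite /= normrZ ler_wpM2l// dual_norm_ge.
apply/eqP; rewrite eq_le le/=.
have [->|a0] := eqVneq a 0; first by rewrite normr0 mul0r dual_norm_ge0.
rewrite -ler_pdivlMl ?normr_gt0// -normfV (le_trans _ (le _ _))//.
by rewrite scalerA mulVf// scale1r.
Qed.

Lemma dual_norm0_eq0 f : dual_norm f = 0 -> f = 0.
Proof.
move=> f0; apply/val_inj/funext => x /=; apply/eqP.
by rewrite -normr_le0 (le_trans (dual_op_norm f x))// f0 mul0r.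
Qed.

HB.instance Definition _ :=
  Lmodule_isNormed.Build R dual dual_normD dual_normZ dual_norm0_eq0.

End Dual.

Arguments dual {R} X.

Section Evaluation.
Context {R : realType} (X : normedModType R).

Lemma ev_subproof (x : X) : (fun f : dual X => f x) \in dual_pred (X := dual X).
Proof.
rewrite inE; have lin : linear (fun f : dual X => f x : R^o) by [].
split => //.
pose h : {linear dual X -> R^o} := HB.pack (fun f : dual X => f x : R^o)
  (GRing.isLinear.Build R (dual X) R^o *:%R _ lin).
apply: (@bounded_linear_continuous _ _ _ h); apply/bounded_funP => r.
exists (r * `|x|) => f fr; rewrite (le_trans (dual_op_norm f x))//.
by rewrite ler_wpM2r.
Qed.

(* The canonical embedding of [X] into its bidual. *)
Definition ev (x : X) : dual (dual X) := Dual (ev_subproof x).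

End Evaluation.

(* Completion of a seminormed space: Cauchy sequences modulo null sequences.
   When the seminorm is a norm, [to_completion] is a linear isometry with dense
   range into a Banach space, i.e. this is the usual completion. *)
Section Completion.
Context {R : realType} (V : lmodType R).

Record seminorm := Seminorm {
  seminorm_fun :> V -> R;
  seminormD : forall x y, seminorm_fun (x + y) <= seminorm_fun x + seminorm_fun y;
  seminormZ : forall (a : R) x, seminorm_fun (a *: x) = `|a| * seminorm_fun x }.

Variable p : seminorm.

Lemma seminorm0 : p 0 = 0.
Proof. by rewrite -(scale0r 0) seminormZ normr0 mul0r. Qed.

Lemma seminormN x : p (- x) = p x.
Proof. by rewrite -scaleN1r seminormZ normrN1 mul1r. Qed.

Lemma seminorm_ge0 x : 0 <= p x.
Proof.
have := seminormD p x (- x); rewrite subrr seminorm0 seminormN -mulr2n.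
by rewrite pmulrn_lge0.
Qed.

Lemma seminormB_dist x y : `|p x - p y| <= p (x - y).
Proof.
have le u v : p u - p v <= p (u - v).
  by rewrite lerBlDr -{1}(subrK v u) seminormD.
by rewrite ler_norml le andbT lerNl opprB -(seminormN (x - y)) opprB le.
Qed.

Definition cauchy_seq : {pred nat -> V} := [pred s : nat -> V |
  `[< forall e : R, 0 < e ->
      exists N, forall m n, (N <= m)%N -> (N <= n)%N -> p (s m - s n) < e >]].

Lemma cauchy_seq_submod : submod_closed cauchy_seq.
Proof.
split=> [|a s t].
  by rewrite inE => e e0; exists 0%N => m n _ _; rewrite subrr seminorm0.
rewrite !inE => sc tc e e0.
have a1 : 0 < `|a| + 1 by rewrite ltr_wpDl.
have [N hN] := sc (e / 2 / (`|a| + 1)) (divr_gt0 (divr_gt0 e0 (ltr0n _ 2)) a1).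
have [M hM] := tc (e / 2) (divr_gt0 e0 (ltr0n _ 2)).
exists (maxn N M) => m n; rewrite !geq_max => /andP[Nm Mm] /andP[Nn Mn].
rewrite !fctE opprD addrACA -scalerBr (le_lt_trans (seminormD _ _ _))//.
rewrite [ltRHS]splitr ler_ltD ?hM// seminormZ.
rewrite (@le_trans _ _ ((`|a| + 1) * p (s m - s n)))//.
  by rewrite ler_wpM2r ?seminorm_ge0// lerDl.
by rewrite mulrC -ler_pdivlMr// ltW// hN.
Qed.

HB.instance Definition _ :=
  GRing.isSubmodClosed.Build R _ cauchy_seq cauchy_seq_submod.

Record cauchy_space := CauchySeq {
  cauchy_fun :> nat -> V; cauchy_funP : cauchy_fun \in cauchy_seq }.

HB.instance Definition _ := [isSub for cauchy_fun].
HB.instance Definition _ := [Choice of cauchy_space by <:].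
HB.instance Definition _ := [SubChoice_isSubLmodule of cauchy_space by <:].

Implicit Types s t u : cauchy_space.

Lemma cauchy_cvgn s : cvgn (fun n => p (s n)).
Proof.
apply: R_complete; apply: cauchy_exP => e e0.
have := cauchy_funP s; rewrite inE => /(_ e e0)[N hN].
exists (p (s N)); exists N => // n /= Nn; rewrite /ball/=.
by rewrite (le_lt_trans (seminormB_dist _ _))// hN.
Qed.

Definition cauchy_norm s : R := limn (fun n => p (s n)).

Lemma cauchy_normP s : p (s n) @[n --> \oo] --> cauchy_norm s.
Proof. exact: cauchy_cvgn. Qed.

Lemma cauchy_normD s t :
  cauchy_norm (s + t) <= cauchy_norm s + cauchy_norm t.
Proof.
have st : p (s n) + p (t n) @[n --> \oo] --> cauchy_norm s + cauchy_norm t.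
  by apply: cvgD; exact: cauchy_normP.
apply: (ler_cvg_to (@cauchy_normP (s + t)) st).
by apply: nearW => n; exact: seminormD.
Qed.

Lemma cauchy_normZ a s : cauchy_norm (a *: s) = `|a| * cauchy_norm s.
Proof.
apply: cvg_lim => //; under eq_cvg do rewrite /= seminormZ.
by apply: cvgMl_tmp; exact: cauchy_normP.
Qed.

Lemma cauchy_norm0 : cauchy_norm 0 = 0.
Proof. by rewrite -(scale0r 0) cauchy_normZ normr0 mul0r. Qed.

Lemma cauchy_normN s : cauchy_norm (- s) = cauchy_norm s.
Proof. by rewrite -scaleN1r cauchy_normZ normrN1 mul1r. Qed.

Lemma cauchy_norm_ge0 s : 0 <= cauchy_norm s.
Proof.
have := cauchy_normD s (- s); rewrite subrr cauchy_norm0 cauchy_normN.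
by rewrite -mulr2n pmulrn_lge0.
Qed.

Definition cauchy_equiv s t := cauchy_norm (s - t) == 0.

Lemma cauchy_equiv_refl : reflexive cauchy_equiv.
Proof. by move=> s; rewrite /cauchy_equiv subrr cauchy_norm0. Qed.

Lemma cauchy_equiv_sym : symmetric cauchy_equiv.
Proof. by move=> s t; rewrite /cauchy_equiv -cauchy_normN opprB. Qed.

Lemma cauchy_equiv_trans : transitive cauchy_equiv.
Proof.
move=> t s u /eqP st /eqP tu; rewrite /cauchy_equiv eq_le cauchy_norm_ge0 andbT.
have -> : s - u = (s - t) + (t - u) by rewrite addrA subrK.
by rewrite (le_trans (cauchy_normD _ _))// st tu addr0.
Qed.

Canonical cauchy_equiv_rel :=
  EquivRel cauchy_equiv cauchy_equiv_refl cauchy_equiv_sym cauchy_equiv_trans.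

Definition completion := {eq_quot cauchy_equiv}%qT.

HB.instance Definition _ := Choice.on completion.
HB.instance Definition _ := EqQuotient.on completion.

Implicit Types x y z : completion.

Let cls s : completion := (\pi_completion s)%qT.

Lemma clsP s t : reflect (cauchy_norm (s - t) = 0) (cls s == cls t).
Proof. by rewrite /cls piE; exact: eqP. Qed.

Lemma cls_repr x : cls (repr x) = x.
Proof. exact: reprK. Qed.

Lemma repr_cls s : cauchy_norm (repr (cls s) - s) = 0.
Proof. by apply/clsP; rewrite cls_repr. Qed.

Definition comp_zero : completion := cls 0.
Definition comp_opp x : completion := cls (- repr x).
Definition comp_add x y : completion := cls (repr x + repr y).
Definition comp_scale (a : R) x : completion := cls (a *: repr x).

Lemma comp_addE s t : comp_add (cls s) (cls t) = cls (s + t).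
Proof.
apply/eqP/clsP/eqP; rewrite eq_le cauchy_norm_ge0 andbT.
by rewrite opprD addrACA (le_trans (cauchy_normD _ _))// !repr_cls addr0.
Qed.

Lemma comp_scaleE a s : comp_scale a (cls s) = cls (a *: s).
Proof.
by apply/eqP/clsP; rewrite -scalerBr cauchy_normZ repr_cls mulr0.
Qed.

Lemma comp_oppE s : comp_opp (cls s) = cls (- s).
Proof.
by apply/eqP/clsP; rewrite -opprD cauchy_normN repr_cls.
Qed.

Lemma comp_addA : associative comp_add.
Proof.
move=> x y z; rewrite -(cls_repr x) -(cls_repr y) -(cls_repr z).
by rewrite !comp_addE addrA.
Qed.

Lemma comp_addC : commutative comp_add.
Proof.
by move=> x y; rewrite -(cls_repr x) -(cls_repr y) !comp_addE addrC.
Qed.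

Lemma comp_add0 : left_id comp_zero comp_add.
Proof. by move=> x; rewrite -(cls_repr x) comp_addE add0r. Qed.

Lemma comp_addN : left_inverse comp_zero comp_opp comp_add.
Proof. by move=> x; rewrite -(cls_repr x) comp_oppE comp_addE addNr. Qed.

HB.instance Definition _ :=
  GRing.isZmodule.Build completion comp_addA comp_addC comp_add0 comp_addN.

Lemma comp_scaleA a b x : comp_scale a (comp_scale b x) = comp_scale (a * b) x.
Proof. by rewrite -(cls_repr x) !comp_scaleE scalerA. Qed.

Lemma comp_scale1 : left_id 1 comp_scale.
Proof. by move=> x; rewrite -(cls_repr x) comp_scaleE scale1r. Qed.

Lemma comp_scaleDr : right_distributive comp_scale +%R.
Proof.
move=> a x y; rewrite -(cls_repr x) -(cls_repr y) [in LHS]/GRing.add/=.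
by rewrite comp_addE !comp_scaleE scalerDr -comp_addE.
Qed.

Lemma comp_scaleDl x : {morph comp_scale^~ x : a b / a + b}.
Proof.
move=> a b; rewrite -(cls_repr x) !comp_scaleE scalerDl.
by rewrite -comp_addE.
Qed.

HB.instance Definition _ := GRing.Zmodule_isLmodule.Build R completion
  comp_scaleA comp_scale1 comp_scaleDr comp_scaleDl.

Definition comp_norm x : R := cauchy_norm (repr x).

Lemma comp_normE s : comp_norm (cls s) = cauchy_norm s.
Proof.
apply/eqP; rewrite eq_le; apply/andP; split.
- rewrite /comp_norm -(subrK s (repr (cls s))).
  by rewrite (le_trans (cauchy_normD _ _))// repr_cls add0r.
- rewrite -{1}(subrK (repr (cls s)) s) (le_trans (cauchy_normD _ _))//.
  by rewrite -cauchy_normN opprB repr_cls add0r.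
Qed.

Lemma comp_normD x y : comp_norm (x + y) <= comp_norm x + comp_norm y.
Proof. by rewrite [in leLHS]/GRing.add/= comp_normE cauchy_normD. Qed.

Lemma comp_normZ a x : comp_norm (a *: x) = `|a| * comp_norm x.
Proof. by rewrite [in LHS]/GRing.scale/= comp_normE cauchy_normZ. Qed.

Lemma comp_norm0_eq0 x : comp_norm x = 0 -> x = 0.
Proof.
move=> x0; rewrite -(cls_repr x); apply/eqP/clsP.
by rewrite subr0.
Qed.

HB.instance Definition _ :=
  Lmodule_isNormed.Build R completion comp_normD comp_normZ comp_norm0_eq0.

Lemma cst_cauchy (v : V) : (fun=> v) \in cauchy_seq.
Proof. by rewrite inE => e e0; exists 0%N => *; rewrite subrr seminorm0. Qed.

Definition to_completion (v : V) : completion := cls (CauchySeq (cst_cauchy v)).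

Lemma norm_to_completion v : `|to_completion v| = p v.
Proof. by rewrite [LHS]comp_normE; apply: cvg_lim => //=; apply: cvg_cst. Qed.

Lemma to_completion_linear : linear to_completion.
Proof.
move=> a u v; rewrite [in RHS]/GRing.scale/= comp_scaleE.
rewrite [in RHS]/GRing.add/= comp_addE; congr cls; exact/val_inj.
Qed.

HB.instance Definition _ :=
  GRing.isLinear.Build R V completion *:%R to_completion to_completion_linear.

Lemma to_completion_approx s (e : R) N :
  (forall m, (N <= m)%N -> p (s N - s m) <= e) ->
  `|to_completion (s N) - cls s| <= e.
Proof.
move=> h; have -> : to_completion (s N) - cls s =
    cls (CauchySeq (cst_cauchy (s N)) - s).
  by rewrite [in LHS]/GRing.add/= [in LHS]/GRing.opp/= comp_oppE comp_addE.
rewrite [leLHS]comp_normE; apply: limr_le; first exact: cauchy_cvgn.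
by exists N => // m /= Nm; exact: h.
Qed.

Lemma to_completion_dense : closure (range to_completion) = setT.
Proof.
apply/seteqP; split => // x _ B /nbhs_ballP[e /= e0 eB].
have := cauchy_funP (repr x); rewrite inE => /(_ (e / 2) (divr_gt0 e0 _))[//|N hN].
exists (to_completion (repr x N)); split; first by exists (repr x N).
apply: eB; rewrite -ball_normE/= distrC -{2}(cls_repr x).
rewrite (@le_lt_trans _ _ (e / 2)) ?ltr_pdivrMr ?ltr_pMr ?ltr1n//.
by apply: to_completion_approx => m Nm; apply/ltW/hN.
Qed.

Lemma completion_complete (F : set_system completion) :
  ProperFilter F -> cauchy F -> cvg F.
Proof.
move=> FF /cauchyP Fc.
pose r n : R := (n.+1%:R)^-1.
have r0 n : 0 < r n by rewrite invr_gt0 ltr0n.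
have rle m n : (m <= n)%N -> r n <= r m.
  by move=> mn; rewrite lef_pV2 ?posrE ?ltr0n// ler_nat.
have rsmall e : 0 < e -> exists N, r N < e.
  move=> e0; exists (Num.truncn e^-1).
  rewrite invf_plt ?posrE ?ltr0n//.
  by have := truncnS_gt e^-1.
have /choice[v Fv] : forall n, exists v, F (ball (to_completion v) (r n)).
  move=> n; have [y Fy] := Fc (r n / 2) (divr_gt0 (r0 n) (ltr0n _ 2)).
  have : closure (range to_completion) y by rewrite to_completion_dense.
  move=> /(_ _ (nbhsx_ballx y _ (divr_gt0 (r0 n) (ltr0n _ 2))))[_ [[v _ <-] yv]].
  exists v; apply: filterS Fy => z yz.
  by rewrite [r n]splitr; apply: ball_triangle yz; exact: ball_sym.
have vd m n : p (v m - v n) < r m + r n.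
  rewrite -norm_to_completion linearB/=.
  have [z []] := filter_ex (filterI (Fv m) (Fv n)).
  rewrite -!ball_normE/= => mz nz.
  rewrite -(subrKA z) (le_lt_trans (ler_normD _ _))// ltrD//.
  by rewrite distrC.
have vc : v \in cauchy_seq.
  rewrite inE => e e0; have [N rN] := rsmall (e / 2) (divr_gt0 e0 (ltr0n _ 2)).
  exists N => m n Nm Nn; rewrite (lt_le_trans (vd m n))// [leRHS]splitr lerD//.
    by rewrite (le_trans (rle _ _ Nm))// ltW.
  by rewrite (le_trans (rle _ _ Nn))// ltW.
apply/cvg_ex; exists (cls (CauchySeq vc)).
move=> B /nbhs_ballP[e /= e0 eB].
have [N rN] := rsmall (e / 3) (divr_gt0 e0 (ltr0n _ 3)).
apply: filterS (Fv N) => z Nz; apply: eB; apply: ball_sym.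
move: Nz => /ball_sym; rewrite -!ball_normE/= => zN.
rewrite -(subrKA (to_completion (v N))) (le_lt_trans (ler_normD _ _))//.
have : `|to_completion (v N) - cls (CauchySeq vc)| <= r N + r N.
  apply: (@to_completion_approx (CauchySeq vc)) => m Nm /=.
  by rewrite (le_trans (ltW (vd N m)))// lerD2l rle.
move=> h; rewrite (lt_le_trans (ltr_leD zN h))//.
have -> : e = e / 3 + (e / 3 + e / 3) by field.
by rewrite !lerD// ltW.
Qed.

HB.instance Definition _ :=
  Uniform_isComplete.Build completion completion_complete.

End Completion.

(* The algebraic tensor product of X and Y, realized (as in Ryan, Introduction
   to Tensor Products of Banach Spaces, 1.1) as the span of the evaluations
   B |-> B x y in the space of all functionals on the (not necessarily bounded)
   bilinear forms B; no topology is involved at this stage.  Coefficients in a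
   linear combination of elementary tensors are absorbed in the left factors. *)
Section AlgebraicTensor.
Context {R : realType} (X Y : lmodType R).

Definition elem_tensor_fun (x : X) (y : Y) :
  {bilinear X -> Y -> R^o} -> R^o := fun B => B x y.

Definition tensor_pred : {pred {bilinear X -> Y -> R^o} -> R^o} := [pred u |
  `[< exists s : seq (X * Y), u = \sum_(z <- s) elem_tensor_fun z.1 z.2 >]].

Lemma elem_tensor_funZ a x y :
  elem_tensor_fun (a *: x) y = a *: elem_tensor_fun x y.
Proof. by apply/funext => B; rewrite /elem_tensor_fun/= linearZl_LR. Qed.

Lemma elem_tensor_sumZ a (s : seq (X * Y)) :
  a *: (\sum_(z <- s) elem_tensor_fun z.1 z.2) =
  \sum_(z <- [seq (a *: z.1, z.2) | z <- s]) elem_tensor_fun z.1 z.2.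
Proof.
rewrite scaler_sumr big_map; apply: eq_bigr => z _.
by rewrite elem_tensor_funZ.
Qed.

Lemma tensor_submod : submod_closed tensor_pred.
Proof.
split=> [|a u v]; first by rewrite inE; exists [::]; rewrite big_nil.
rewrite !inE => -[s ->] [t ->].
exists ([seq (a *: z.1, z.2) | z <- s] ++ t).
by rewrite big_cat/= elem_tensor_sumZ.
Qed.

HB.instance Definition _ :=
  GRing.isSubmodClosed.Build R _ tensor_pred tensor_submod.

Record tensor := Tensor {
  tensor_fun :> {bilinear X -> Y -> R^o} -> R^o;
  tensor_funP : tensor_fun \in tensor_pred }.

HB.instance Definition _ := [isSub for tensor_fun].
HB.instance Definition _ := [Choice of tensor by <:].
HB.instance Definition _ := [SubChoice_isSubLmodule of tensor by <:].

Lemma elem_tensor_subproof x y : elem_tensor_fun x y \in tensor_pred.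
Proof. by rewrite inE; exists [:: (x, y)]; rewrite big_seq1. Qed.

Definition elem_tensor x y : tensor := Tensor (elem_tensor_subproof x y).

Lemma elem_tensorZ a x y : elem_tensor (a *: x) y = a *: elem_tensor x y.
Proof. by apply: val_inj => /=; rewrite elem_tensor_funZ. Qed.

Lemma tensor_rep (u : tensor) :
  exists s : seq (X * Y), u = \sum_(z <- s) elem_tensor z.1 z.2.
Proof.
have := tensor_funP u; rewrite inE => -[s us]; exists s.
by apply: val_inj; rewrite raddf_sum/= us.
Qed.

End AlgebraicTensor.

Section ProjectiveTensor.
Context {R : realType} (X Y : normedModType R).
Implicit Types u v : tensor X Y.

(* The projective norm of u is the infimum of \sum_i `|x_i| * `|y_i| over the
   representations u = \sum_i x_i (x) y_i.  Only the seminorm axioms are needed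
   to complete; positive definiteness is a consequence of Hahn-Banach. *)
Definition proj_costs u : set R :=
  [set \sum_(z <- s) `|z.1| * `|z.2| | s in
    [set s : seq (X * Y) | u = \sum_(z <- s) elem_tensor z.1 z.2]].

Definition proj_norm u : R := inf (proj_costs u).

Lemma proj_costs_neq0 u : proj_costs u !=set0.
Proof.
by have [s us] := tensor_rep u; exists (\sum_(z <- s) `|z.1| * `|z.2|), s.
Qed.

Lemma proj_costs_ge0 u : lbound (proj_costs u) 0.
Proof. by move=> _ [s _ <-]; apply: sumr_ge0 => z _; rewrite mulr_ge0. Qed.

Lemma proj_norm_le u (s : seq (X * Y)) :
  u = \sum_(z <- s) elem_tensor z.1 z.2 ->
  proj_norm u <= \sum_(z <- s) `|z.1| * `|z.2|.
Proof.
by move=> us; apply: ge_inf; [exists 0; exact: proj_costs_ge0|exists s].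
Qed.

Lemma proj_norm_ge u m :
  (forall s : seq (X * Y), u = \sum_(z <- s) elem_tensor z.1 z.2 ->
    m <= \sum_(z <- s) `|z.1| * `|z.2|) -> m <= proj_norm u.
Proof.
move=> h; apply: lb_le_inf; first exact: proj_costs_neq0.
by move=> _ [s us <-]; exact: h.
Qed.

Lemma proj_normD u v : proj_norm (u + v) <= proj_norm u + proj_norm v.
Proof.
rewrite -lerBlDr; apply: proj_norm_ge => s us.
rewrite lerBlDr -lerBlDl; apply: proj_norm_ge => t vt.
by rewrite lerBlDl -big_cat; apply: proj_norm_le; rewrite big_cat/= -us -vt.
Qed.

Lemma proj_normZ (a : R) u : proj_norm (a *: u) = `|a| * proj_norm u.
Proof.
have le b v : b != 0 -> proj_norm (b *: v) <= `|b| * proj_norm v.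
  move=> b0; rewrite -ler_pdivrMl ?normr_gt0//; apply: proj_norm_ge => s vs.
  rewrite ler_pdivrMl ?normr_gt0//.
  rewrite (le_trans (@proj_norm_le _ [seq (b *: z.1, z.2) | z <- s] _))//.
    rewrite big_map vs scaler_sumr; apply: eq_bigr => z _ /=.
    by rewrite elem_tensorZ.
  rewrite big_map mulr_sumr; apply: ler_sum => z _ /=.
  by rewrite normrZ mulrA.
have [->|a0] := eqVneq a 0.
  rewrite scale0r normr0 mul0r; apply/eqP; rewrite eq_le; apply/andP; split.
    by rewrite (le_trans (@proj_norm_le _ [::] _))// big_nil.
  by apply: lb_le_inf; [exact: proj_costs_neq0|exact: proj_costs_ge0].
apply/eqP; rewrite eq_le le//= -ler_pdivlMl ?normr_gt0// -normfV.
by rewrite (le_trans _ (le _ _ _)) ?invr_eq0// scalerA mulVf// scale1r.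
Qed.

Definition proj_seminorm : seminorm (tensor X Y) :=
  Seminorm proj_normD proj_normZ.

Definition proj_tensor : completeNormedModType R := completion proj_seminorm.

End ProjectiveTensor.

Notation "X \ptensor Y" := (proj_tensor X Y)
  (at level 40, left associativity) : type_scope.

Section WeakTopologies.
Context {R : realType} (X : normedModType R).

(* The weak topology of X and the weak* topology of its dual, as initial
   topologies for the evaluations into a product of copies of R. *)
Definition weak := initial_topology
  (fun x : X => (fun f : dual X => f x) : {ptws dual X -> R}).

Definition weak_star := initial_topology
  (fun f : dual X => (fun x : X => f x) : {ptws X -> R}).

Definition weakly_compact (G : set X) := @compact weak G.

Definition weakly_null (x : nat -> X) := x @ \oo --> (0 : weak).

(* The (algebraic) linear span. *)
Definition lspan (G : set X) : set X :=
  [set \sum_(z <- s) z.1 *: z.2 | s in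
    [set s : seq (R * X) | forall z, z \in s -> G z.2]].

End WeakTopologies.

Section Notions.
Context {R : realType}.

Definition WCG (X : completeNormedModType R) :=
  exists2 G : set X, weakly_compact G & closure (lspan G) = setT.

Definition subspace_of_WCG (X : completeNormedModType R) :=
  exists W : completeNormedModType R, WCG W /\
  (* T is an isomorphism onto its range, a closed subspace of W *)
  exists T : {linear X -> W}, closed (range T) /\
  exists a b : R, [/\ 0 < a, 0 < b &
    forall x, a * `|x| <= `|T x| /\ `|T x| <= b * `|x|].

Local Open Scope ereal_scope.

(* Valued in the extended reals so that sup, inf and limsup need no side
   condition; it is finite and nonnegative for M bounded and nonempty. *)
Definition wk (Z : normedModType R) (M : set Z) : \bar R :=
  ereal_sup
    [set ereal_inf (range (fun z : Z => (`|z2 - ev z|)%:E))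
    | z2 in @closure (weak_star (dual Z)) (@ev R Z @` M)].

Definition direct_quantitative_DP (X : normedModType R) :=
  exists2 C : R, (0 < C)%R &
  forall (x : nat -> X) (f : nat -> dual X),
    (forall n, `|x n| <= 1)%R -> weakly_null x -> bounded_set (range f) ->
    limn_esup (fun n => (`|f n (x n)|)%:E) <= C%:E * wk (range f).

Definition dual_quantitative_DP (X : normedModType R) :=
  exists2 C : R, (0 < C)%R &
  forall (x : nat -> X) (f : nat -> dual X),
    bounded_set (range x) -> (forall n, `|f n| <= 1)%R -> weakly_null f ->
    limn_esup (fun n => (`|f n (x n)|)%:E) <= C%:E * wk (range x).

End Notions.

(* Main.v *)
(** Let [X] embed in a WCG space [W] generated by the weakly compact set [K].  By the
    Amir-Lindenstrauss theorem [Y] is spanned by a bounded set [S] on which every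
    functional is small off a finite set, so sequences of distinct points of [S]
    are weakly null.  Either Dunford-Pettis hypothesis then gives a constant [C] such
    that, for a bilinear form [b] of norm at most 1 and functionals [lam y] on [W]
    extending [b (-, y)], one has [|lam y w| > C e] only for finitely many [y] in [S]
    when [w] runs through the points of a weakly compact set lying within [e] of [X].
    Soft thresholding at level [C e] turns these [lam y w] into functions of
    [(b, lam)] that form, together with 0, a pointwise compact family.  The pairs
    [(b, lam)] form a compact space, so by Grothendieck's theorem such families are
    weakly compact; they generate a WCG space of functions on the pairs, and this
    space contains the functions [b |-> b z], an isometric copy of the projective
    tensor product. *)

(* The set K need not meet X outside 0, so X alone supplies no atoms; combinations of K lying within
   e of X are used instead, and [lam y] gives b (-, y) a value at them. Hahn-Banach offers no
   continuous choice of [lam] in b, so the pair itself is the variable: the norm bounds and the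
   relation [lam y (T x)] = b (x, y) survive pointwise limits. Weak nullity of y_n alone does not
   make b (x_n, y_n) small; Dunford-Pettis does so up to the weak noncompactness of the x_n, or of
   the functionals b (x_n, -), and this is at most 3 r / a when T x_n is within r of a weakly
   compact set and T is bounded below by a. Hence a threshold proportional to e instead of 0. For x
   in X some combination w lies within e of T x, so replacing b (x, y) by the thresholded [lam y w]
   costs at most (1/a + C) e; letting e run through 1 / (k + 1) recovers every elementary tensor. *)
From HB Require Import structures.
From mathcomp Require Import all_boot all_order all_algebra.
From mathcomp Require Import all_classical all_reals all_analysis.
From mathcomp Require Import ring lra.
Require Import Defs.

Set Implicit Arguments.
Unset Strict Implicit.
Unset Printing Implicit Defensive.

Import Order.TTheory GRing.Theory Num.Theory.
Import numFieldNormedType.Exports.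

Local Open Scope classical_set_scope.
Local Open Scope ring_scope.

(** * The Hahn-Banach theorem *)

Section LinearFunctions.
Context {R : nzRingType} {U V : lmodType R} (f : U -> V).
Hypothesis f_linear : linear f.

Lemma linear_fun0 : f 0 = 0.
Proof.
by have := f_linear (-1) 0 0; rewrite !scaleN1r !oppr0 addr0 addNr.
Qed.

Lemma linear_funZ a x : f (a *: x) = a *: f x.
Proof. by have := f_linear a x 0; rewrite linear_fun0 !addr0. Qed.

Lemma linear_funN x : f (- x) = - f x.
Proof. by rewrite -scaleN1r linear_funZ scaleN1r. Qed.

Lemma linear_funD x y : f (x + y) = f x + f y.
Proof. by have := f_linear 1 x y; rewrite !scale1r. Qed.

End LinearFunctions.

Section HahnBanach.
Context {R : realType} {U : lmodType R}.

Definition sublinear (p : U -> R) :=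
  (forall x y, p (x + y) <= p x + p y) /\
  (forall (a : R) x, 0 <= a -> p (a *: x) = a * p x).

Lemma sublinear0 p : sublinear p -> p 0 = 0.
Proof. by move=> [_ pZ]; rewrite -(scale0r 0) pZ// mul0r. Qed.

Lemma sublinear_geN p x : sublinear p -> - p (- x) <= p x.
Proof.
move=> sp; rewrite -subr_ge0 opprK -(sublinear0 sp) -(subrr x).
exact: sp.1.
Qed.

(** [S c r] encodes the demand r <= H c on the functional H that is sought. Cones of demands cover
    extension from a subspace (demands at c and - c) as well as separation from one. *)
Definition cone_below (p : U -> R) (S : U -> R -> Prop) :=
  [/\ S 0 0, (forall c d r s, S c r -> S d s -> S (c + d) (r + s)),
     (forall (a : R) c r, 0 <= a -> S c r -> S (a *: c) (a * r)) &
     forall c r, S c r -> r <= p c].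

(** q x is the infimum of p (x + c) - r over the demands, finite because r <= p c bounds it below by
    - p (- x). A linear H below q meets every demand, since H (- c) <= q (- c) <= - r. *)
Lemma cone_inf (p : U -> R) (S : U -> R -> Prop) :
  sublinear p -> cone_below p S ->
  exists q, [/\ sublinear q, (forall x, q x <= p x) &
                forall c r, S c r -> q (- c) <= - r].
Proof.
move=> sp [S0 SD SZ Sp].
pose E x := [set t | exists c r, S c r /\ t = p (x + c) - r].
have Elb x : lbound (E x) (- p (- x)).
  move=> _ [c [r [Scr ->]]]; rewrite lerBrDr addrC.
  apply: (le_trans (lerB (Sp _ _ Scr) (lexx _))).
  rewrite lerBlDr; have := sp.1 (x + c) (- x).
  by rewrite [x + c]addrC addrK [p (c + x) + _]addrC addrC.
have Ehas x : has_inf (E x).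
  split; last by exists (- p (- x)); exact: Elb.
  by exists (p (x + 0) - 0); exists 0, 0.
have Ele x c r : S c r -> inf (E x) <= p (x + c) - r.
  by move=> Scr; apply: ge_inf; [exact: (Ehas x).2|exists c, r].
exists (fun x => inf (E x)); split.
- split=> [x y|a x].
    rewrite -lerBlDr; apply: lb_le_inf; first exact: (Ehas x).1.
    move=> _ [c [r [Scr ->]]]; rewrite lerBlDr -lerBlDl.
    apply: lb_le_inf; first exact: (Ehas y).1.
    move=> _ [d [s [Sds ->]]]; rewrite lerBlDl.
    apply: (le_trans (Ele _ _ _ (SD _ _ _ _ Scr Sds))).
    rewrite (addrACA x) opprD -[in leRHS](addrACA (p (x + c))) -opprD.
    by rewrite lerD2r sp.1.
  rewrite le_eqVlt => /predU1P[<-|a0].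
    rewrite scale0r mul0r; apply/eqP; rewrite eq_le; apply/andP; split.
      by rewrite (le_trans (Ele 0 _ _ S0))// addr0 subr0 sublinear0.
    apply: lb_le_inf; first exact: (Ehas 0).1.
    move=> _ [c [r [Scr ->]]].
    by rewrite add0r subr_ge0 Sp.
  have key (b : R) z : 0 < b -> inf (E (b *: z)) <= b * inf (E z).
    move=> b0; rewrite -ler_pdivrMl//; apply: lb_le_inf; first exact: (Ehas z).1.
    move=> _ [c [r [Scr ->]]]; rewrite ler_pdivrMl//.
    apply: (le_trans (Ele _ _ _ (SZ _ _ _ (ltW b0) Scr))).
    by rewrite -scalerDr sp.2 ?(ltW b0)// -mulrBr.
  apply/eqP; rewrite eq_le key//= -ler_pdivlMl//.
  have := key a^-1 (a *: x); rewrite scalerA mulVf ?gt_eqF// scale1r; apply.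
  by rewrite invr_gt0.
- by move=> x; rewrite (le_trans (Ele x _ _ S0))// addr0 subr0.
- by move=> c r Scr; rewrite (le_trans (Ele _ _ _ Scr))// addNr sublinear0// sub0r.
Qed.

Lemma minimal_sublinear (p : U -> R) : sublinear p ->
  exists q, [/\ sublinear q, (forall x, q x <= p x) &
     forall q', sublinear q' -> (forall x, q' x <= q x) -> q' = q].
Proof.
move=> sp.
pose Q (q : U -> R) := sublinear q /\ forall x, q x <= p x.
pose T := {q : U -> R | Q q}.
(* The order is reversed, so Zorn's maximal element is a minimal sublinear function; a nonempty
   chain is bounded by its pointwise infimum. *)
pose le (q1 q2 : T) := `[< forall x, sval q2 x <= sval q1 x >].
have [||| |q qmin] := @Zorn T le.
- by move=> t; apply/asboolP.
- move=> r s t /asboolP rs /asboolP st; apply/asboolP => x.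
  exact: le_trans (st x) (rs x).
- move=> [s Ps] [t Pt] /asboolP/= st /asboolP/= ts; apply/eq_exist/funext => x.
  by apply/eqP; rewrite eq_le st ts.
- move=> A Atot; have [[q0 Aq0]|A0] := pselect (A !=set0); last first.
    have P : sublinear p /\ forall x, p x <= p x by [].
    by exists (exist Q p P) => s As; exfalso; apply: A0; exists s.
  pose E x := [set sval q x | q in A].
  have Ehas x : has_inf (E x).
    split; first by exists (sval q0 x), q0.
    exists (- p (- x)) => _ [[q [sq qp]] _ <-] /=.
    by rewrite (le_trans _ (sublinear_geN _ sq))// lerN2.
  have Ele q x : A q -> inf (E x) <= sval q x.
    by move=> Aq; apply: ge_inf; [exact: (Ehas x).2|exists q].
  have P : sublinear (fun x => inf (E x)) /\ forall x, inf (E x) <= p x.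
    split; last by move=> x; apply: (le_trans (Ele _ _ Aq0)); exact: (svalP q0).2.
    split=> [x y|a x a0].
      rewrite -lerBlDr; apply: lb_le_inf; first exact: (Ehas x).1.
      move=> _ [q Aq <-]; rewrite lerBlDr -lerBlDl.
      apply: lb_le_inf; first exact: (Ehas y).1.
      move=> _ [q' Aq' <-]; rewrite lerBlDl.
      have [/asboolP qq'|/asboolP qq'] := Atot _ _ Aq Aq'.
        rewrite (le_trans (Ele _ _ Aq'))// (le_trans ((svalP q').1.1 _ _))//.
        by rewrite lerD2r.
      rewrite (le_trans (Ele _ _ Aq))// (le_trans ((svalP q).1.1 _ _))//.
      by rewrite lerD2l.
    move: a0; rewrite le_eqVlt => /predU1P[<-|a0].
      rewrite scale0r mul0r; apply/eqP; rewrite eq_le; apply/andP; split.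
        by rewrite (le_trans (Ele _ _ Aq0))// sublinear0//; exact: (svalP q0).1.
      apply: lb_le_inf; first exact: (Ehas 0).1.
      by move=> _ [q _ <-]; rewrite sublinear0//; exact: (svalP q).1.
    apply/eqP; rewrite eq_le; apply/andP; split.
      rewrite -ler_pdivrMl//; apply: lb_le_inf; first exact: (Ehas x).1.
      move=> _ [q Aq <-]; rewrite ler_pdivrMl// -(svalP q).1.2 ?(ltW a0)//.
      exact: Ele.
    apply: lb_le_inf; first exact: (Ehas _).1.
    move=> _ [q Aq <-]; rewrite (svalP q).1.2 ?(ltW a0)// ler_pM2l//.
    exact: Ele.
  by exists (exist Q _ P) => s As; apply/asboolP => x; exact: Ele.
exists (sval q); split; [exact: (svalP q).1|exact: (svalP q).2|].
move=> q' sq' q'q.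
have P : sublinear q' /\ forall x, q' x <= p x.
  by split=> // x; rewrite (le_trans (q'q x))//; exact: (svalP q).2.
have := qmin (exist Q q' P); move=> <- //.
by apply/asboolP => x; exact: q'q.
Qed.

(** The demands t * q y at t *: y, t >= 0, yield a sublinear function below q, hence q itself by
    minimality. So q (- y) <= - q y, and subadditivity becomes additivity. *)
Lemma sublinear_minimal_linear (q : U -> R) : sublinear q ->
  (forall q', sublinear q' -> (forall x, q' x <= q x) -> q' = q) ->
  linear (q : U -> R^o).
Proof.
move=> sq qmin.
have qD x y : q (x + y) = q x + q y.
  apply/eqP; rewrite eq_le sq.1/=.
  pose S (c : U) r := exists2 t, 0 <= t & c = t *: y /\ r = t * q y.
  have Sc : cone_below q S.
    split.
    - by exists 0; rewrite ?scale0r ?mul0r.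
    - move=> c d r s [t t0 [-> ->]] [u u0 [-> ->]]; exists (t + u).
        by rewrite addr_ge0.
      by rewrite scalerDl mulrDl.
    - move=> a c r a0 [t t0 [-> ->]]; exists (a * t); first by rewrite mulr_ge0.
      by rewrite scalerA mulrA.
    - by move=> c r [t t0 [-> ->]]; rewrite sq.2.
  have [q' [sq' q'q q'S]] := cone_inf sq Sc.
  have q'E := qmin _ sq' q'q; rewrite -lerBrDr -{1}(addrK y x).
  rewrite (le_trans (sq.1 _ _))// lerD2l -[X in X (- y)]q'E.
  by apply: q'S; exists 1 => //; rewrite scale1r mul1r.
have qN x : q (- x) = - q x.
  by apply/eqP; rewrite -subr_eq0 opprK -qD addNr sublinear0.
have qZ a x : q (a *: x) = a * q x.
  have [a0|a0] := leP 0 a; first exact: sq.2.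
  have -> : a *: x = - ((- a) *: x) by rewrite scaleNr opprK.
  by rewrite qN sq.2 ?oppr_ge0 ?ltW// mulNr opprK.
by move=> a x y; rewrite qD qZ.
Qed.

Lemma hahn_banach_cone (p : U -> R) (S : U -> R -> Prop) :
  sublinear p -> cone_below p S ->
  exists H : U -> R^o, [/\ linear H, (forall x, H x <= p x) &
                       forall c r, S c r -> r <= H c].
Proof.
move=> sp Sp; have [q [sq qp qS]] := cone_inf sp Sp.
have [H [sH Hq Hmin]] := minimal_sublinear sq.
have linH := sublinear_minimal_linear sH Hmin.
exists H; split => // [x|c r Scr]; first exact: le_trans (Hq x) (qp x).
rewrite -lerN2; apply: le_trans (qS _ _ Scr).
by rewrite -(linear_funN linH); exact: Hq.
Qed.

Lemma hahn_banach (V : lmodType R) (p : U -> R) (j : V -> U) (h : V -> R^o) :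
  sublinear p -> linear j -> linear h -> (forall v, h v <= p (j v)) ->
  exists H : U -> R^o, [/\ linear H, (forall x, H x <= p x) &
                       forall v, H (j v) = h v].
Proof.
move=> sp lj lh hp.
have [|H [lH Hp HS]] := @hahn_banach_cone p
    (fun c r => exists v, c = j v /\ r = h v) sp.
  split.
  - by exists 0; rewrite (linear_fun0 lj) (linear_fun0 lh).
  - move=> c d r s [v [-> ->]] [w [-> ->]]; exists (v + w).
    by rewrite (linear_funD lj) (linear_funD lh).
  - move=> a c r a0 [v [-> ->]]; exists (a *: v).
    by rewrite (linear_funZ lj) (linear_funZ lh).
  - by move=> c r [v [-> ->]].
exists H; split=> // v; apply/eqP; rewrite eq_le; apply/andP; split; last first.
  by apply: HS; exists v.
have : h (- v) <= H (j (- v)) by apply: HS; exists (- v).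
by rewrite (linear_funN lj) (linear_funN lh) (linear_funN lH) lerN2.
Qed.

End HahnBanach.

(** * Ultrafilter limits and weak topologies *)

Lemma small_invn (R : realType) (e : R) : 0 < e ->
  exists k, forall m, (k <= m)%N -> m.+1%:R^-1 < e.
Proof.
move=> e0; exists (Num.truncn e^-1) => m km.
rewrite invf_plt ?posrE ?ltr0n// (lt_le_trans (truncnS_gt e^-1))//.
by rewrite ler_nat ltnS.
Qed.

Section Ultra.
Context {R : realType}.

Lemma fmap_ultra (I T : Type) (g : I -> T) (U : set_system I) :
  UltraFilter U -> UltraFilter (g @ U).
Proof.
move=> UU; split=> [|G GG UG]; first exact: fmap_proper_filter.
apply/seteqP; split=> // A GA.
have [//|nA] := in_ultra_setVsetC (g @^-1` A) UU.
have /(filterI GA)/filter_ex[x []//] : G (~` A) by exact: UG.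
Qed.

Lemma ultra_bounded_cvg (I : Type) (U : set_system I) (g : I -> R) (M : R) :
  UltraFilter U -> (\forall i \near U, `|g i| <= M) ->
  exists l : R, g @ U --> l.
Proof.
move=> UU gM; have := @segment_compact R (- M) M; rewrite compact_ultra.
move=> /(_ (g @ U) (fmap_ultra g UU)) [|l [_ gl]]; last by exists l.
by apply: filterS gM => i /=; rewrite in_itv/= ler_norml.
Qed.

Lemma ultra_or (I : Type) (U : set_system I) (A B : set I) :
  UltraFilter U -> U (A `|` B) -> U A \/ U B.
Proof.
move=> UU UAB; have [|nA] := in_ultra_setVsetC A UU; first by left.
by right; apply: filterS (filterI UAB nA) => x [[//|]].
Qed.

(** The sets [S] meet t^-1 B, with B in [F], generate a proper filter; the image of an ultrafilter
    refining it contains [F], hence equals it by maximality. *)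
Lemma ultra_lift (P T : Type) (F : set_system T) (S : set P) (t : P -> T) :
  UltraFilter F -> F (t @` S) ->
  exists V : set_system P, [/\ UltraFilter V, V S & t @ V = F].
Proof.
move=> UF FS; pose V0 := filter_from F (fun B => S `&` t @^-1` B).
have FV0 : ProperFilter V0.
  apply: filter_from_proper.
    apply: filter_from_filter; first by exists setT; exact: filterT.
    move=> A B FA FB; exists (A `&` B); first exact: filterI.
    by move=> p [Sp [Ap Bp]].
  move=> B FB; have : F (t @` S `&` B) by exact: filterI.
  by move=> /filter_ex[_ [[p Sp <-] Bp]]; exists p.
have [V [UV V0V]] := ultraFilterLemma FV0; exists V; split => //.
  by apply: V0V; exists setT; [exact: filterT|move=> p []].
apply: max_filter => B FB.
by apply: V0V; exists B => // p [].
Qed.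

Lemma cvg_norm_le (I : Type) (U : set_system I) (g : I -> R) (l M : R) :
  ProperFilter U -> g @ U --> l -> (\forall i \near U, `|g i| <= M) -> `|l| <= M.
Proof.
move=> UU gl gM; have gl' : `|g i| @[i --> U] --> `|l| by exact: cvg_norm.
by apply: (closed_cvg (fun x => x <= M)) gl' => //; exact: closed_le.
Qed.

End Ultra.

Section DualFacts.
Context {R : realType}.
Implicit Types X Y W : normedModType R.

Lemma dual_le X (f : dual X) x : `|f x| <= `|f| * `|x|.
Proof. exact: dual_op_norm. Qed.

Lemma dual_norm_bound X (f : dual X) (C : R) : 0 <= C ->
  (forall x, `|f x| <= C * `|x|) -> `|f| <= C.
Proof.
move=> C0 fC; apply: dual_norm_le => x x1; rewrite (le_trans (fC x))//.
by rewrite -[leRHS]mulr1 ler_wpM2l.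
Qed.

Lemma dual_mk X (f : X -> R^o) (C : R) :
  linear f -> (forall x, `|f x| <= C * `|x|) ->
  exists g : dual X, forall x, g x = f x.
Proof.
move=> lf fC.
pose h : {linear X -> R^o} := HB.pack f (GRing.isLinear.Build R X R^o *:%R f lf).
have fP : f \in @dual_pred R X.
  rewrite inE; split => //; apply: (@bounded_linear_continuous _ _ _ h).
  apply/bounded_funP => r; exists (`|C| * `|r|) => x xr.
  rewrite (le_trans (fC x))// (@le_trans _ _ (`|C| * `|x|))//.
    by rewrite ler_wpM2r// ler_norm.
  by rewrite ler_wpM2l// (le_trans xr)// ler_norm.
by exists (Dual fP).
Qed.

Lemma sublinear_norm X (C : R) : 0 <= C -> sublinear (fun x : X => C * `|x|).
Proof.
move=> C0; split=> [x y|a x a0]; first by rewrite -mulrDr ler_wpM2l// ler_normD.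
by rewrite normrZ ger0_norm// mulrCA.
Qed.

Lemma linear_le_norm X (f : X -> R^o) (C : R) : linear f ->
  (forall x, f x <= C * `|x|) -> forall x, `|f x| <= C * `|x|.
Proof.
move=> lf fC x; rewrite ler_norml fC andbT lerNl.
by rewrite -(linear_funN lf) -(normrN x).
Qed.

Lemma dual_extend X W (T : X -> W) (a : R) (h : dual X) :
  linear T -> 0 < a -> (forall x, a * `|x| <= `|T x|) ->
  exists f : dual W, `|f| <= `|h| / a /\ forall x, f (T x) = h x.
Proof.
move=> lT a0 Ta; have C0 : 0 <= `|h| / a by rewrite divr_ge0// ltW.
have [|H [lH HC HT]] := hahn_banach (sublinear_norm W C0) lT (@dual_linear _ _ h).
  move=> x; rewrite (le_trans (ler_norm _))// (le_trans (dual_le _ _))//.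
  by rewrite -mulrA ler_wpM2l// ler_pdivlMl.
have [f fE] := dual_mk lH (linear_le_norm lH HC).
exists f; split; last by move=> x; rewrite fE.
by apply: dual_norm_bound => // x; rewrite fE; exact: linear_le_norm.
Qed.

Lemma dual_dist W (S : set W) (w : W) (e : R) :
  S 0 -> (forall x y, S x -> S y -> S (x + y)) ->
  (forall a x, S x -> S (a *: x)) -> 0 <= e ->
  (forall f : dual W, (forall s, S s -> f s = 0) -> `|f w| <= e * `|f|) ->
  forall d, e < d -> exists2 s, S s & `|w - s| <= d.
Proof.
move=> S0 SD SZ e0 Sf d ed; apply: contrapT => nS.
have {}nS s : S s -> d <= `|w - s|.
  by move=> Ss; rewrite leNgt; apply/negP => ws; apply: nS; exists s => //; exact: ltW.
have d0 : 0 < d by exact: le_lt_trans ed.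
(* The demands t * d at t *: w + s force H w >= d and, S being symmetric, H = 0 on S. They lie below
   the norm because w is at distance at least d from S. *)
have [|H [lH H1 HS]] := @hahn_banach_cone _ _ _ (fun c r =>
    exists t s, [/\ 0 <= t, S s, c = t *: w + s & r = t * d])
    (sublinear_norm W (ler01 : 0 <= 1 :> R)).
  split.
  - by exists 0, 0; rewrite scale0r addr0 mul0r.
  - move=> c c' r r' [t [s [t0 Ss -> ->]]] [t' [s' [t'0 Ss' -> ->]]].
    exists (t + t'), (s + s'); split; [exact: addr_ge0|exact: SD| |].
      by rewrite addrACA scalerDl.
    by rewrite mulrDl.
  - move=> a c r a0 [t [s [t0 Ss -> ->]]]; exists (a * t), (a *: s).
    by split; [exact: mulr_ge0|exact: SZ|rewrite scalerDr scalerA|rewrite mulrA].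
  - move=> c r [t [s [t0 Ss -> ->]]]; rewrite mul1r.
    move: t0; rewrite le_eqVlt => /predU1P[<-|t0]; first by rewrite mul0r.
    have -> : t *: w + s = t *: (w - (- t^-1) *: s).
      by rewrite scaleNr opprK scalerDr scalerA mulfV ?gt_eqF// scale1r.
    by rewrite normrZ gtr0_norm// ler_wpM2l ?(ltW t0)// nS//; exact: SZ.
have [f fE] := dual_mk lH (linear_le_norm lH H1).
have f1 : `|f| <= 1.
  by apply: dual_norm_bound => // x; rewrite fE; exact: linear_le_norm.
have fw : d <= f w.
  by rewrite fE; apply: HS; exists 1, 0; rewrite scale1r addr0 mul1r.
have f_ge0 s : S s -> 0 <= f s.
  by move=> Ss; rewrite fE; apply: HS; exists 0, s; rewrite scale0r add0r mul0r.
have fS s : S s -> f s = 0.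
  move=> Ss; apply/eqP; rewrite eq_le f_ge0// andbT -oppr_ge0 -linearN/=.
  by apply: f_ge0; rewrite -scaleN1r; exact: SZ.
have := Sf f fS; rewrite leNgt => /negP; apply.
rewrite (le_lt_trans (_ : _ <= e * 1))// ?ler_wpM2l// mulr1.
by rewrite (lt_le_trans ed)// (le_trans fw)// ler_norm.
Qed.

Lemma dual_norming X (x : X) : exists f : dual X, `|f| <= 1 /\ f x = `|x|.
Proof.
have [|H [lH H1 HS]] := @hahn_banach_cone _ _ _ (fun c r =>
    exists2 t, 0 <= t & c = t *: x /\ r = t * `|x|)
    (sublinear_norm X (ler01 : 0 <= 1 :> R)).
  split.
  - by exists 0; rewrite ?scale0r ?mul0r.
  - move=> c c' r r' [t t0 [-> ->]] [t' t'0 [-> ->]].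
    by exists (t + t'); [exact: addr_ge0|rewrite scalerDl mulrDl].
  - move=> a c r a0 [t t0 [-> ->]].
    by exists (a * t); [exact: mulr_ge0|rewrite scalerA mulrA].
  - by move=> c r [t t0 [-> ->]]; rewrite mul1r normrZ ger0_norm.
have [f fE] := dual_mk lH (linear_le_norm lH H1).
have f1 : `|f| <= 1.
  by apply: dual_norm_bound => // y; rewrite fE; exact: linear_le_norm.
exists f; split => //; apply/eqP; rewrite eq_le; apply/andP; split.
  by rewrite (le_trans (ler_norm _))// (le_trans (dual_le _ _))// ler_piMl.
by rewrite fE; apply: HS; exists 1; rewrite ?scale1r ?mul1r.
Qed.

Lemma norm_le_dual X (x : X) (C : R) :
  (forall f : dual X, `|f| <= 1 -> `|f x| <= C) -> `|x| <= C.
Proof.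
move=> xC; have [f [f1 fx]] := dual_norming x.
by have := xC f f1; rewrite fx normr_id.
Qed.

(** Hahn-Banach on U * U, starting from h on the diagonal; the summands are the restrictions to the
    two factors. *)
Lemma sublinear_split (U : lmodType R) (p q : U -> R) (h : U -> R^o) :
  sublinear p -> sublinear q -> linear h -> (forall x, h x <= p x + q x) ->
  exists h1 h2 : U -> R^o, [/\ linear h1, linear h2, (forall x, h1 x <= p x),
    (forall x, h2 x <= q x) & forall x, h x = h1 x + h2 x].
Proof.
move=> sp sq lh hpq.
have spq : sublinear (fun z : U * U => p z.1 + q z.2).
  split=> [x y|a x a0]; first by rewrite addrACA lerD ?sp.1 ?sq.1.
  by rewrite /= sp.2// sq.2// -mulrDr.
have lj : linear (fun u : U => (u, u)) by [].
have [H [lH Hpq HE]] := hahn_banach spq lj lh hpq.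
exists (fun u => H (u, 0)), (fun u => H (0, u)); split.
- by move=> a x y; rewrite -lH; congr H; apply: injective_projections; rewrite //= scaler0 addr0.
- by move=> a x y; rewrite -lH; congr H; apply: injective_projections; rewrite //= scaler0 addr0.
- by move=> x; have := Hpq (x, 0); rewrite /= (sublinear0 sq) addr0.
- by move=> x; have := Hpq (0, x); rewrite /= (sublinear0 sp) add0r.
- move=> x; rewrite -HE; have := lH 1 (x, 0) (0, x); rewrite !scale1r => <-.
  by congr H; apply: injective_projections; rewrite /= ?addr0 ?add0r.
Qed.

Lemma alaoglu (I : Type) (U : set_system I) X (f : I -> dual X) (C : R) :
  UltraFilter U -> 0 <= C -> (\forall i \near U, `|f i| <= C) ->
  exists f0 : dual X, `|f0| <= C /\ forall x, (f i x : R) @[i --> U] --> (f0 x : R).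
Proof.
move=> UU C0 fC.
have bnd x : \forall i \near U, `|f i x| <= C * `|x|.
  apply: filterS fC => i fiC; rewrite (le_trans (dual_le _ _))//.
  by rewrite ler_wpM2r.
have /choice[g gP] x := ultra_bounded_cvg UU (bnd x).
have lg : linear (g : X -> R^o).
  move=> a x y; have := gP (a *: x + y); under eq_fun do rewrite linearP.
  move=> /cvg_unique; apply; first exact: norm_hausdorff.
  by apply: cvgD; [apply: cvgMl_tmp|]; exact: gP.
have gC x : `|g x| <= C * `|x| by apply: cvg_norm_le (gP x) (bnd x).
have [f0 f0E] := dual_mk lg gC.
exists f0; split; first by apply: dual_norm_bound => // x; rewrite f0E.
by move=> x; rewrite f0E; exact: gP.
Qed.

End DualFacts.

Section WeakFacts.
Context {R : realType}.
Implicit Types X Y W : normedModType R.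

Lemma initial_ptws_cvgP (S : choiceType) (T : topologicalType)
    (g : S -> {ptws T -> R}) (F : set_system S) (s : S) : Filter F ->
  (F --> (s : initial_topology g)) <->
  (forall t, (g x t) @[x --> F] --> (g s t)).
Proof.
move=> FF; split=> [Fs t|gs].
  have : g @ F --> g s.
    by apply: cvg_trans (cvg_app g Fs) _; exact: initial_continuous.
  by move=> /(pointwise_cvgP _ _).1; exact.
have : g @ F --> g s by apply/pointwise_cvgP => t; exact: gs.
move=> gFs A [_ [[B Bop <-] Bs BA]]; apply: filterS BA _.
by apply: gFs; exact: open_nbhs_nbhs.
Qed.

Lemma weak_cvgP X (F : set_system X) (x : X) : Filter F ->
  (F --> (x : weak X)) <-> (forall f : dual X, (f y : R) @[y --> F] --> (f x : R)).
Proof. by move=> FF; exact: initial_ptws_cvgP. Qed.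

Lemma weakly_compactP X (G : set X) : weakly_compact G <->
  forall F : set_system X, UltraFilter F -> F G ->
    exists2 g, G g & forall f : dual X, (f y : R) @[y --> F] --> (f g : R).
Proof.
rewrite /weakly_compact compact_ultra; split=> h F UF FG.
  by have [g [Gg /weak_cvgP Fg]] := h F UF FG; exists g.
by have [g Gg Fg] := h F UF FG; exists g; split=> //; apply/weak_cvgP.
Qed.

Lemma weakly_nullP X (x : nat -> X) : weakly_null x <->
  forall f : dual X, (f (x n) : R) @[n --> \oo] --> (0 : R).
Proof.
rewrite /weakly_null weak_cvgP; split=> h f; have := h f; rewrite linear0; exact.
Qed.

(** Each point of the weak-star closure is the limit of an ultrafilter containing M, so compactness
    arguments along ultrafilters can bound [wk]. *)
Lemma wk_le (Z : normedModType R) (M : set Z) (c : R) :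
  (forall F : set_system Z, UltraFilter F -> F M -> forall z2 : dual (dual Z),
     (forall f : dual Z, (f z : R) @[z --> F] --> (z2 f : R)) ->
     exists z, `|z2 - ev z| <= c) ->
  (wk M <= c%:E)%E.
Proof.
move=> h; apply: ge_ereal_sup => _ [z2 z2M <-].
pose F0 := filter_from (@nbhs _ (weak_star (dual Z)) z2)
  (fun B => [set z | M z /\ B (ev z)]).
have FF0 : ProperFilter F0.
  apply: filter_from_proper.
    apply: filter_from_filter; first by exists setT; exact: filterT.
    move=> A B nA nB; exists (A `&` B); first exact: filterI.
    by move=> z [Mz [Az Bz]].
  move=> B nB; have [_ [[z Mz <-] Bz]] := z2M B nB; by exists z.
have [F [UF F0F]] := ultraFilterLemma FF0.
have FM : F M by apply: F0F; exists setT; [exact: filterT|move=> z []].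
have Fz2 (f : dual Z) : (f z : R) @[z --> F] --> (z2 f : R).
  have : @ev _ Z @ F --> (z2 : weak_star (dual Z)).
    move=> B nB; apply: F0F; exists B => //; by move=> z [].
  by move/initial_ptws_cvgP => /(_ f).
have [z zc] := h F UF FM z2 Fz2.
apply: ereal_inf_le; exists (`|z2 - ev z|%:E); first by exists z.
by rewrite lee_fin.
Qed.

End WeakFacts.

(** * Bounded functionals on bounded functions *)

Section AbsFunctional.
Context {R : realType} {T : Type}.

Definition bdd (f : T -> R) := exists M : R, forall t, `|f t| <= M.

Variables (mu : (T -> R) -> R) (C : R).
Hypothesis C0 : 0 <= C.
Hypothesis muP : forall (a : R) f g, bdd f -> bdd g ->
  mu (fun t => a * f t + g t) = a * mu f + mu g.
Hypothesis muC : forall f (M : R), (forall t, `|f t| <= M) -> mu f <= C * M.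

Let below (f : T -> R) := [set mu g | g in [set g | forall t, `|g t| <= f t]].

(* the total variation of mu, on nonnegative functions *)
Definition abs_functional (f : T -> R) : R := sup (below f).

Local Notation I := abs_functional.

Definition nnbdd (f : T -> R) := (forall t, 0 <= f t) /\ bdd f.

Lemma bdd_le (f g : T -> R) : (forall t, `|g t| <= f t) -> bdd f -> bdd g.
Proof.
move=> gf [M fM]; exists M => t; rewrite (le_trans (gf t))//.
by rewrite (le_trans (ler_norm _)).
Qed.

Lemma below_has_sup f : nnbdd f -> has_sup (below f).
Proof.
move=> [f0 [M fM]]; split; first by exists (mu (fun=> 0)), (fun=> 0) => // t /=; rewrite normr0.
exists (C * M) => _ [g gf <-]; apply: muC => t.
by rewrite (le_trans (gf t))// (le_trans (ler_norm _)).
Qed.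

Lemma abs_functional_ge f g : nnbdd f -> (forall t, `|g t| <= f t) -> mu g <= I f.
Proof. by move=> bf gf; apply: sup_ubound; [exact: (below_has_sup bf).2|exists g]. Qed.

Lemma abs_functional_le f c : nnbdd f ->
  (forall g, (forall t, `|g t| <= f t) -> mu g <= c) -> I f <= c.
Proof.
move=> bf h; apply: ge_sup; first exact: (below_has_sup bf).1.
by move=> _ [g gf <-]; exact: h.
Qed.

Lemma abs_functional_mono f g : nnbdd f -> nnbdd g ->
  (forall t, f t <= g t) -> I f <= I g.
Proof.
move=> bf bg fg; apply: abs_functional_le => // h hf.
by apply: abs_functional_ge => // t; exact: le_trans (hf t) (fg t).
Qed.

Lemma abs_functional_bound f M : nnbdd f -> (forall t, f t <= M) -> I f <= C * M.
Proof.
move=> bf fM; apply: abs_functional_le => // g gf; apply: muC => t.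
exact: le_trans (gf t) (fM t).
Qed.

Lemma nnbddD f g : nnbdd f -> nnbdd g -> nnbdd (fun t => f t + g t).
Proof.
move=> [f0 [M fM]] [g0 [N gN]]; split=> [t|]; first by rewrite addr_ge0.
by exists (M + N) => t; rewrite (le_trans (ler_normD _ _))// lerD.
Qed.

Lemma nnbdd_max f g : nnbdd f -> nnbdd g -> nnbdd (fun t => Num.max (f t) (g t)).
Proof.
move=> bf bg; have [f0 _] := bf; have [g0 _] := bg.
split=> [t|]; first by rewrite le_max f0.
apply: bdd_le (nnbddD bf bg).2 => t.
rewrite ger0_norm ?le_max ?f0// ge_max lerDl g0 lerDr f0//.
Qed.

Lemma nnbdd_min f g : nnbdd f -> nnbdd g -> nnbdd (fun t => Num.min (f t) (g t)).
Proof.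
move=> bf bg; have [f0 _] := bf; have [g0 _] := bg.
split=> [t|]; first by rewrite le_min f0 g0.
apply: bdd_le bf.2 => t.
by rewrite ger0_norm ?le_min ?f0 ?g0// ge_min lexx.
Qed.

Lemma bdd_linearD f g : bdd f -> bdd g -> mu (fun t => f t + g t) = mu f + mu g.
Proof.
move=> bf bg; have := muP 1 bf bg; rewrite mul1r => <-.
by congr mu; apply/funext => t; rewrite mul1r.
Qed.

Lemma bdd_linearN f : bdd f -> mu (fun t => - f t) = - mu f.
Proof.
move=> bf; have b0 : bdd (fun=> 0) by exists 0 => t; rewrite normr0.
have mu0 : mu (fun=> 0) = 0.
  have e0 : (fun t : T => -1 * 0 + 0 : R) = (fun=> 0).
    by apply/funext => t; rewrite mulr0 addr0.
  by have := muP (-1) b0 b0; rewrite e0 mulN1r addNr.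
have := muP (-1) bf b0; rewrite mulN1r mu0 addr0 => <-.
by congr mu; apply/funext => t; rewrite mulN1r addr0.
Qed.

Lemma abs_functionalD f g : nnbdd f -> nnbdd g ->
  I (fun t => f t + g t) = I f + I g.
Proof.
move=> bf bg; have bfg := nnbddD bf bg; have [f0 _] := bf; have [g0 _] := bg.
apply/eqP; rewrite eq_le; apply/andP; split.
- apply: abs_functional_le => // h hfg.
  (* h1 truncates h to [-f, f]; as |h| <= f + g, the remainder lies in [-g, g]. *)
  pose h1 t := Num.max (- f t) (Num.min (f t) (h t)).
  have h1f t : `|h1 t| <= f t.
    rewrite ler_norml /h1 le_max lexx/= ge_max; apply/andP; split.
      by have := f0 t; lra.
    by rewrite ge_min lexx.
  have h2g t : `|h t - h1 t| <= g t.
    have := hfg t; have := f0 t; have := g0 t; rewrite /h1 !ler_norml => ? ?.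
    move=> /andP[? ?]; rewrite /Num.max /Num.min.
    by do 2!case: ifPn; rewrite -?leNgt => ? ?; apply/andP; split; lra.
  have -> : h = (fun t => h1 t + (h t - h1 t)).
    by apply/funext => t; rewrite addrC subrK.
  rewrite bdd_linearD; first by rewrite lerD// abs_functional_ge.
    exact: bdd_le h1f bf.2.
  exact: bdd_le h2g bg.2.
- rewrite -lerBrDr; apply: abs_functional_le => // h hf.
  rewrite lerBrDr -lerBrDl; apply: abs_functional_le => // k kg.
  rewrite lerBrDl -bdd_linearD; [|exact: bdd_le hf bf.2|exact: bdd_le kg bg.2].
  apply: abs_functional_ge => // t.
  by rewrite (le_trans (ler_normD _ _))// lerD.
Qed.

Lemma abs_functional_modular f g : nnbdd f -> nnbdd g ->
  I (fun t => Num.min (f t) (g t)) + I (fun t => Num.max (f t) (g t)) = I f + I g.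
Proof.
move=> bf bg; rewrite -!abs_functionalD//; last 2 first.
- exact: nnbdd_min.
- exact: nnbdd_max.
by congr I; apply/funext => t; rewrite addr_min_max.
Qed.

Lemma abs_functional_norm f : bdd f -> `|mu f| <= I (fun t => `|f t|).
Proof.
move=> bf; have b : nnbdd (fun t => `|f t|).
  by split => //; move: bf => [M fM]; exists M => t; rewrite normr_id.
rewrite ler_norml lerNl -bdd_linearN// !abs_functional_ge// => t.
by rewrite normrN.
Qed.

End AbsFunctional.

(** * Dominated convergence for finitely additive functionals *)

Lemma ultra_tail (J : set nat) : (forall k, exists2 m, (k <= m)%N & J m) ->
  exists V : set_system nat,
    [/\ UltraFilter V, V J & forall k, V [set m | (k <= m)%N]].
Proof.
move=> hJ; pose V0 := filter_from [set: nat] (fun k => [set m | (k <= m)%N /\ J m]).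
have FV0 : ProperFilter V0.
  apply: filter_from_proper.
    apply: filter_from_filter; first by exists 0%N.
    move=> i j _ _; exists (maxn i j) => // m [].
    by rewrite geq_max => /andP[im jm] Jm.
  by move=> k _; have [m km Jm] := hJ k; exists m.
have [V [UV V0V]] := ultraFilterLemma FV0; exists V; split=> // [|k].
  by apply: V0V; exists 0%N => // m [].
by apply: V0V; exists k => // m [].
Qed.

Section DominatedConvergence.
Context {R : realType} {T : Type}.
Variables (mu : (T -> R) -> R) (C : R).
Hypothesis C0 : 0 <= C.
Hypothesis muP : forall (a : R) f g, bdd f -> bdd g ->
  mu (fun t => a * f t + g t) = a * mu f + mu g.
Hypothesis muC : forall f (M : R), (forall t, `|f t| <= M) -> mu f <= C * M.
Variables (f : nat -> T -> R) (M : R).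
Hypothesis f0 : forall n t, 0 <= f n t.
Hypothesis fM : forall n t, f n t <= M.
Hypothesis f_cvg0 : forall t (e : R), 0 < e -> exists k, forall m, (k <= m)%N -> f m t < e.
Hypothesis T_compact : forall V : set_system T, UltraFilter V ->
  exists t0, forall n, f n t @[t --> V] --> f n t0.

Local Notation I := (abs_functional mu).

Fixpoint run_max n d (t : T) : R :=
  if d is d'.+1 then Num.max (run_max n d' t) (f (n + d) t) else f n t.

Lemma run_max_leP n d t c :
  run_max n d t <= c <-> forall m, (n <= m <= n + d)%N -> f m t <= c.
Proof.
elim: d => [|d IH]/=.
  split=> [fc m|h]; last by apply: h; rewrite addn0 leqnn.
  by rewrite addn0 -eqn_leq => /eqP <-.
rewrite ge_max; split=> [/andP[/IH h fc] m|h].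
  rewrite addnS (leq_eqVlt m) => /andP[nm /orP[/eqP ->|]].
    by rewrite -addnS.
  by rewrite ltnS => md; apply: h; rewrite nm.
apply/andP; split; last by apply: h; rewrite leq_addr leqnn.
by apply/IH => m /andP[nm md]; apply: h; rewrite nm addnS (leq_trans md).
Qed.

Lemma run_max_ge n d t m : (n <= m <= n + d)%N -> f m t <= run_max n d t.
Proof. by move=> nm; exact: ((run_max_leP n d t _).1 (lexx _)). Qed.

Lemma run_max_nnbdd n d : nnbdd (run_max n d).
Proof.
have r0 t : 0 <= run_max n d t.
  by rewrite (le_trans (f0 n t))// run_max_ge// leqnn leq_addr.
by split=> //; exists M => t; rewrite ger0_norm//; apply/run_max_leP.
Qed.

Lemma run_max_sup n : has_sup (range (fun d => I (run_max n d))).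
Proof.
split; first by exists (I (run_max n 0)), 0%N.
exists (C * M) => _ [d _ <-]; apply: abs_functional_bound => //.
  exact: run_max_nnbdd.
by move=> t; apply/run_max_leP.
Qed.

(** Otherwise points t_n with [run_max k (u k)] above e for all k <= n have an ultrafilter limit t0.
    From some k on all f m t0 are below e, yet among the finitely many m of the block at k the
    ultrafilter selects one with f m t0 >= e. *)
Lemma dini (u : nat -> nat) (e : R) : 0 < e ->
  exists n, forall t, exists2 k, (k <= n)%N & run_max k (u k) t <= e.
Proof.
move=> e0; apply: contrapT => nn.
have /choice[t tP] : forall n, exists t, forall k, (k <= n)%N -> e < run_max k (u k) t.
  move=> n; apply: contrapT => nt; apply: nn; exists n => t.
  apply: contrapT => nk; apply: nt; exists t => k kn; rewrite ltNge.
  by apply/negP => ke; apply: nk; exists k.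
have [V [UV _ Vk]] := @ultra_tail setT (fun k => ex_intro2 _ _ k (leqnn k) Logic.I).
have [t0 t0P] := T_compact (fmap_ultra t UV).
have [k kP] := f_cvg0 t0 e0.
have key d : (\forall n \near V, e < run_max k d (t n)) ->
    exists2 m, (k <= m)%N & e <= f m t0.
  have lim m : (\forall n \near V, e < f m (t n)) -> e <= f m t0.
    move=> em; have := t0P m => /(_ _)/= h.
    have h' : f m (t n) @[n --> V] --> f m t0 by exact: h.
    apply: (closed_cvg (fun x => e <= x)) h' => //.
    by apply: filterS em => n /ltW.
  elim: d => [|d IH]/=; first by move=> h; exists k => //; exact: lim.
  move=> h; have : V ([set n | e < run_max k d (t n)] `|` [set n | e < f (k + d.+1) (t n)]).
    by apply: filterS h => n /=; rewrite lt_max => /orP.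
  move=> /ultra_or[/IH//|h2]; exists (k + d.+1)%N; first by rewrite leq_addr.
  exact: lim.
have [|m km] := key (u k); first by apply: filterS (Vk k) => n /=; exact: tP.
by rewrite leNgt kP.
Qed.

(* Maxima of f over blocks of indices have minima h_n decreasing to 0 pointwise,
   hence uniformly by Dini's theorem, whereas the modularity of the total variation
   keeps its values at h_n away from 0 if its values at the f_n are. *)
Lemma dominated_ultra (e : R) : 0 < e -> exists n, I (f n) < e.
Proof.
move=> e0; apply: contrapT => nn.
have Ie n : e <= I (f n) by rewrite leNgt; apply/negP => h; apply: nn; exists n.
pose G n := sup (range (fun d => I (run_max n d))).
have Gge n d : I (run_max n d) <= G n.
  by apply: sup_ubound; [exact: (run_max_sup n).2|exists d].
(* The losses de 0, ..., de n add up to e / 2 * (1 - 2^-1 ^+ n.+1), so I (h n) stays within e / 2 of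
   G n, which is at least e. *)
pose de n := e / 2 * 2^-1 ^+ n.+1.
have de0 n : 0 < de n by rewrite mulr_gt0 ?divr_gt0// exprn_gt0// invr_gt0.
have /choice[u uP] : forall n, exists d, G n - de n < I (run_max n d).
  move=> n; have [_ [d _ <-] h] := sup_adherent (de0 n) (run_max_sup n).
  by exists d.
pose h := fix h n t := if n is n'.+1 then Num.min (h n' t) (run_max n (u n) t)
                       else run_max 0 (u 0) t.
have hb n : nnbdd (h n).
  elim: n => [|n IH]; first exact: run_max_nnbdd.
  exact: nnbdd_min IH (run_max_nnbdd _ _).
have hle n k t : (k <= n)%N -> h n t <= run_max k (u k) t.
  elim: n => [|n IH]; first by rewrite leqn0 => /eqP ->.
  rewrite leq_eqVlt => /predU1P[->|kn]; first by rewrite /= ge_min lexx orbT.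
  by rewrite /= ge_min IH.
have Ih n : G n - e / 2 * (1 - 2^-1 ^+ n.+1) <= I (h n).
  elim: n => [|n IH].
    rewrite (le_trans _ (ltW (uP 0%N)))// lerD2l lerN2 /de !expr1.
    by apply: ler_wpM2l; [rewrite divr_ge0// ltW|lra].
  have := abs_functional_modular muP muC (hb n) (run_max_nnbdd n.+1 (u n.+1)).
  rewrite -/(h n.+1) => mod.
  (* Both functions lie below one longer block of maxima starting at n, so modularity gives I (h
     n.+1) >= I (h n) + G n.+1 - G n - de n.+1. *)
  have mx : I (fun t => Num.max (h n t) (run_max n.+1 (u n.+1) t)) <= G n.
    rewrite (le_trans _ (Gge n (u n + (u n.+1).+1)%N))//.
    apply: (abs_functional_mono muC); [exact: nnbdd_max (hb n) (run_max_nnbdd _ _)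
      |exact: run_max_nnbdd|].
    move=> t; rewrite ge_max; apply/andP; split.
      apply: le_trans (hle n n t (leqnn _)) _.
      apply/run_max_leP => m /andP[nm mu1]; apply: run_max_ge.
      by rewrite nm addnA (leq_trans mu1)// leq_addr.
    apply/run_max_leP => m /andP[nm mu1]; apply: run_max_ge.
    by rewrite (ltnW nm)/= (leq_trans mu1)// addSn -addnS leq_add2l leq_addl.
  have up := uP n.+1; rewrite /de in up.
  have -> : I (h n.+1) =
    I (h n) + I (run_max n.+1 (u n.+1)) - I (fun t => Num.max (h n t) (run_max n.+1 (u n.+1) t)).
    by rewrite -mod addrK.
  move: IH mx up; rewrite [2^-1 ^+ n.+2]exprS; set x := 2^-1 ^+ n.+1.
  move: (I (h n)) (I _) (I _) (G n) (G n.+1) => a b c g g' *.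
  have : e / 2 * (2^-1 * x) = e / 2 * x / 2 by ring.
  have : e / 2 * (1 - x) = e / 2 - e / 2 * x by ring.
  have : e / 2 * (1 - 2^-1 * x) = e / 2 - e / 2 * x / 2 by field.
  lra.
pose c := e / 2 / (C + 1) / 2.
have C1 : 0 < C + 1 by rewrite ltr_wpDl.
have c0 : 0 < c by rewrite !divr_gt0.
have [n nP] := dini u c0.
have h1 : I (h n) <= C * c.
  apply: abs_functional_bound => // t; have [k kn kc] := nP t.
  exact: le_trans (hle n k t kn) kc.
have h2 : e / 2 <= I (h n).
  rewrite (le_trans _ (Ih n))//; have := le_trans (Ie n) (Gge n 0%N).
  have : 0 <= e / 2 * 2^-1 ^+ n.+1 by exact/ltW/de0.
  rewrite mulrBr mulr1; lra.
have : C * c < e / 2.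
  rewrite (@lt_le_trans _ _ ((C + 1) * c))//; first by rewrite ltr_pM2r// ltrDl.
  rewrite /c mulrA [_ * (_ / (C + 1))]mulrC divfK ?gt_eqF//.
  by rewrite ler_pdivrMr// ler_peMr ?ler1n// divr_ge0// ltW.
by rewrite ltNge (le_trans h2).
Qed.

End DominatedConvergence.

(** * Grothendieck's theorem on pointwise compact families of bounded functions *)

Section Grothendieck.
Context {R : realType} {P T : Type}.
Variables (mu : (T -> R) -> R) (C : R).
Hypothesis C0 : 0 <= C.
Hypothesis muP : forall (a : R) f g, bdd f -> bdd g ->
  mu (fun t => a * f t + g t) = a * mu f + mu g.
Hypothesis muC : forall f (M : R), (forall t, `|f t| <= M) -> mu f <= C * M.
Variables (F : P -> T -> R) (S : set P) (M : R).
Hypothesis FM : forall p t, S p -> `|F p t| <= M.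
Hypothesis S_compact : forall U : set_system P, UltraFilter U -> U S ->
  exists2 p0, S p0 & forall t, F p t @[p --> U] --> F p0 t.
Hypothesis T_compact : forall V : set_system T, UltraFilter V ->
  exists t0, forall p, S p -> F p t @[t --> V] --> F p t0.

(** An arbitrary [B] lets the induction choose its net points inside a slice where F p varies by
    less than e. [List.In] serves because [P] and [T] are bare types without decidable equality. *)
Lemma finite_net (s : seq P) (e : R) (B : set T) : 0 < e ->
  (forall p, List.In p s -> S p) ->
  exists l : seq T, (forall t, List.In t l -> B t) /\
    forall t, B t -> exists2 t', List.In t' l &
      forall p, List.In p s -> `|F p t - F p t'| < e.
Proof.
move=> e0; elim: s B => [|p s IH] B sS.
  have [[t Bt]|nB] := pselect (B !=set0); last first.
    by exists [::]; split=> // t Bt; exfalso; apply: nB; exists t.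
  by exists [:: t]; split=> [t' [<-//|//]|t' _]; exists t => //; left.
have Sp : S p by apply: sS; left.
have {}IH (B' : set T) := IH B' (fun q h => sS q (or_intror h)).
(* The range of F p is cut into steps of length e starting from - M, and l covers the points whose
   value lies in the first k steps. *)
have net k : exists l : seq T, (forall t, List.In t l -> B t) /\
    forall t, B t -> F p t < - M + k%:R * e -> exists2 t', List.In t' l &
      forall q, List.In q (p :: s) -> `|F q t - F q t'| < e.
  elim: k => [|k [l [lB lP]]].
    exists [::]; split=> // t Bt; rewrite mul0r addr0 => h.
    by have := FM t Sp; rewrite ler_norml leNgt h.
  pose B' := B `&` [set t | - M + k%:R * e <= F p t < - M + k.+1%:R * e].
  have [l' [l'B l'P]] := IH B'; exists (l ++ l'); split.
    by move=> t /(@List.in_app_or _ _ _ _)[/lB//|/l'B[]].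
  move=> t Bt tk; have [ltk|gek] := ltP (F p t) (- M + k%:R * e).
    have [t' t'l t'P] := lP t Bt ltk; exists t' => //.
    by apply: List.in_or_app; left.
  have [|t' t'l t'P] := l'P t; first by split=> //=; rewrite gek.
  exists t'; first by apply: List.in_or_app; right.
  move=> q [<-|]; last exact: t'P.
  have [_ /= /andP[h1 h2]] := l'B _ t'l.
  move: tk h2; rewrite -natr1 mulrDl mul1r ltr_norml => tk h2.
  by apply/andP; split; lra.
have [l [lB lP]] := net (Num.truncn ((M + M) / e)).+2; exists l; split=> // t Bt.
apply: lP => //; have := FM t Sp; rewrite ler_norml => /andP[_ h].
have := truncnS_gt ((M + M) / e); rewrite ltr_pdivrMr// -[in _.+2%:R]natr1 => h'.
by rewrite mulrDl mul1r; lra.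
Qed.

Lemma ptwise_bdd p : S p -> bdd (F p).
Proof. by move=> Sp; exists M => t; exact: FM. Qed.

(* As in the Eberlein-Smulian theorem, a failure along U yields a sequence q_n with
   F (q_n) tending to F p0 pointwise, against dominated convergence. *)
Lemma grothendieck (U : set_system P) (p0 : P) : UltraFilter U -> U S -> S p0 ->
  (forall t, F p t @[p --> U] --> F p0 t) -> mu (F p) @[p --> U] --> mu (F p0).
Proof.
move=> UU US Sp0 Fp0; apply/cvgrPdist_lt => d d0; rewrite near_simpl.
have [//|nA] := in_ultra_setVsetC [set p | `|mu (F p0) - mu (F p)| < d] UU.
exfalso; pose A := S `&` [set p | d <= `|mu (F p0) - mu (F p)|].
have UA : U A.
  by apply: filterI => //; apply: filterS nA => p /= /negP; rewrite -leNgt.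
have e0 n : 0 < n.+1%:R^-1 :> R by rewrite invr_gt0 ltr0n.
have /choice[net netP] : forall s : seq P, exists l : seq T,
    (forall p, List.In p s -> S p) ->
    forall t, exists2 t', List.In t' l &
      forall p, List.In p (p0 :: s) -> `|F p t - F p t'| < (size s).+1%:R^-1.
  move=> s; have [sS|nS] := pselect (forall p, List.In p s -> S p); last first.
    by exists [::].
  have [|l [_ lP]] := @finite_net (p0 :: s) _ setT (e0 (size s)).
    by move=> p [<-//|/sS].
  by exists l => _ t; have [//|t' t'l t'P] := lP t; exists t'.
(* Bad points close to p0 on a given finite set exist because U contains A and F p tends to F p0
   pointwise along U. *)
have /choice[pick pickP] : forall ls : seq T * nat, exists p, A p /\
    forall t, List.In t ls.1 -> `|F p t - F p0 t| < ls.2.+1%:R^-1.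
  move=> [l n]; have : U (A `&` [set p | forall t, List.In t l ->
      `|F p t - F p0 t| < n.+1%:R^-1]).
    apply: filterI => //; elim: l => [|t l IH]; first by apply: filterS filterT => p _ t [].
    have := Fp0 t => /cvgrPdist_lt/(_ _ (e0 n)); rewrite near_simpl => ht.
    apply: filterS (filterI ht IH) => p [/= h1 h2] t' [<-|]; last exact: h2.
    by rewrite distrC.
  by move=> /filter_ex[p [Ap pl]]; exists p.
(* a state is the list of points of A already chosen together with the finite
   subsets of T attached to its prefixes *)
pose step (st : seq P * seq T) :=
  let l := st.2 ++ net st.1 in (pick (l, size st.1) :: st.1, l).
pose st n := iter n step ([::], [::]).
pose q n := pick ((st n.+1).2, n).
have st_size n : size (st n).1 = n by elim: n => //= n ->.
have stq n : (st n.+1).1 = q n :: (st n).1 by rewrite /= st_size /q /= .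
have qA n : A (q n) by exact: (pickP _).1.
have q_in i n : (i < n)%N -> List.In (q i) (st n).1.
  elim: n => // n IH; rewrite ltnS leq_eqVlt stq => /predU1P[->|/IH]; by [left|right].
have stS n : forall p, List.In p (st n).1 -> S p.
  elim: n => // n IH p; rewrite stq => -[<-|/IH//].
  by have [] := qA n.
have net_in i n t : (i <= n)%N -> List.In t (net (st i).1) -> List.In t (st n.+1).2.
  have st2 k : (st k.+1).2 = (st k).2 ++ net (st k).1 by [].
  elim: n => [|n IH]; first by rewrite leqn0 => /eqP ->.
  rewrite leq_eqVlt st2 => /predU1P[->|lein] h; apply: List.in_or_app.
    by right.
  by left; exact: IH.
have qclose i n t : (i <= n)%N -> List.In t (net (st i).1) ->
    `|F (q n) t - F p0 t| < n.+1%:R^-1.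
  by move=> lein h; apply: (pickP (_, _)).2; exact: net_in lein h.
(* If F (q m) t stays away from F p0 t along V, let ps be a limit of q, and ts a limit of net points
   l n that imitate t on p0 and on the q i with i < n. Then F p0 and each F (q i) take equal values
   at ts and t, and F ps = F p0 at each l i, hence at ts. Following F (q i) at ts and at t gives F
   ps t = F p0 t. *)
have qcvg t (e : R) : 0 < e ->
    exists k, forall m, (k <= m)%N -> `|F (q m) t - F p0 t| < e.
  move=> ep; apply: contrapT => nk.
  have [|V [UV VJ Vk]] := @ultra_tail [set m | e <= `|F (q m) t - F p0 t|].
    move=> k; apply: contrapT => nm; apply: nk; exists k => m km.
    by rewrite ltNge; apply/negP => h; apply: nm; exists m.
  have qS n : S (q n) by have [] := qA n.
  have [|ps Sps psP] := S_compact (fmap_ultra q UV).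
    have : V (q @^-1` S) by apply: filterS (Vk 0%N) => n _; exact: qS.
    exact.
  have {}psP t' : F (q n) t' @[n --> V] --> F ps t' by exact: psP.
  have /choice[l lP] : forall n, exists t', List.In t' (net (st n).1) /\
      forall p, List.In p (p0 :: (st n).1) -> `|F p t - F p t'| < n.+1%:R^-1.
    move=> n; have [t' t'l t'P] := netP _ (stS n) t; exists t'; split => //.
    by rewrite st_size in t'P.
  have [ts tsP] := T_compact (fmap_ultra l UV).
  have {}tsP p : S p -> F p (l n) @[n --> V] --> F p ts by move=> Sp; exact: tsP.
  have unique (x : nat -> R) (a b : R) : x n @[n --> V] --> a ->
      x n @[n --> V] --> b -> a = b.
    by move=> xa xb; exact: (cvg_unique (@norm_hausdorff _ _) xa xb).
  have null (x : nat -> R) (a : R) k :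
      (forall n, (k <= n)%N -> `|a - x n| < n.+1%:R^-1) -> x n @[n --> V] --> a.
    move=> xa; apply/cvgrPdist_lt => r r0; rewrite near_simpl.
    have [k' k'P] := small_invn r0.
    apply: filterS (filterI (Vk k) (Vk k')) => n /= [kn k'n].
    exact: lt_trans (xa n kn) (k'P n k'n).
  have lim_ts p k : S p -> (forall n, (k <= n)%N -> List.In p (p0 :: (st n).1)) ->
      F p ts = F p t.
    move=> Sp h; apply: unique (tsP p Sp) _; apply: (null _ _ k) => n kn.
    by apply: (lP n).2; exact: h.
  have p0ts : F p0 ts = F p0 t by apply: (lim_ts _ 0%N) => // n _; left.
  have qts i : F (q i) ts = F (q i) t.
    apply: (lim_ts _ i.+1); first by have [] := qA i.
    by move=> n lein; right; exact: q_in.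
  have psl i : F ps (l i) = F p0 (l i).
    apply: unique (psP _) _; apply: (null _ _ i) => n lein.
    by rewrite distrC; apply: qclose lein _; exact: (lP i).1.
  have psts : F ps ts = F p0 ts.
    apply: unique (tsP _ Sps) _; under eq_cvg do rewrite psl.
    exact: tsP.
  have pst : F ps t = F p0 t.
    rewrite -p0ts -psts; apply: unique (psP t) _.
    by have := psP ts; under eq_cvg do rewrite qts.
  have := psP t; rewrite pst => /cvgrPdist_lt/(_ _ ep); rewrite near_simpl => h.
  have : V ([set m | e <= `|F (q m) t - F p0 t|] `&`
            [set n | `|F p0 t - F (q n) t| < e]) by exact: filterI.
  by move=> /filter_ex[n [/=]]; rewrite leNgt distrC => /negP.
have fb n : bdd (fun t => F (q n) t - F p0 t).
  exists (M + M) => t; rewrite (le_trans (ler_normB _ _))// lerD// FM//.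
  by have [] := qA n.
have [| | | |n] := @dominated_ultra _ _ mu C C0 muP muC
    (fun n t => `|F (q n) t - F p0 t|) (M + M) _ _ _ _ d d0.
- by [].
- move=> n t; rewrite (le_trans (ler_normB _ _))// lerD// FM//.
  by have [] := qA n.
- exact: qcvg.
- move=> V UV; have [t0 t0P] := T_compact UV; exists t0 => n.
  have Sq : S (q n) by have [] := qA n.
  by apply: cvg_norm; apply: cvgB; exact: t0P.
- apply/negP; rewrite -leNgt.
  rewrite (le_trans _ (abs_functional_norm muP muC (fb n)))//.
  have [Sq /= dq] := qA n; rewrite (le_trans dq)// distrC.
  rewrite (bdd_linearD muP); [|exact: ptwise_bdd|].
    by rewrite (bdd_linearN muP)//; exact: ptwise_bdd.
  by have [N hN] := ptwise_bdd Sp0; exists N => t; rewrite normrN.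
Qed.

End Grothendieck.

Section BoundedFunctions.
Context {R : realType} (T : Type).

Definition bfun_pred : {pred T -> R^o} :=
  [pred f | `[< bdd (f : T -> R) >]].

Lemma bfun_submod : submod_closed bfun_pred.
Proof.
split=> [|a f g]; first by rewrite inE; exists 0 => t; rewrite normr0.
rewrite !inE => -[M fM] [N gN]; exists (`|a| * M + N) => t.
rewrite /= (le_trans (ler_normD _ _))// lerD// normrM.
by rewrite ler_wpM2l.
Qed.

HB.instance Definition _ :=
  GRing.isSubmodClosed.Build R _ bfun_pred bfun_submod.

Record bfun := BFun {
  bfun_val :> T -> R^o;
  bfunP : bfun_val \in bfun_pred }.

HB.instance Definition _ := [isSub for bfun_val].
HB.instance Definition _ := [Choice of bfun by <:].
HB.instance Definition _ := [SubChoice_isSubLmodule of bfun by <:].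

Lemma bfunDE (f g : bfun) t : (f + g) t = f t + g t. Proof. by []. Qed.
Lemma bfunZE (a : R) (f : bfun) t : (a *: f) t = a * f t. Proof. by []. Qed.

(* 0 is added so that the supremum is meaningful when T is empty *)
Let vals (f : bfun) : set R := [set 0] `|` range (fun t => `|f t : R|).

Let vals_has_sup f : has_sup (vals f).
Proof.
split; first by exists 0; left.
have := bfunP f; rewrite inE => -[M fM]; exists (Num.max 0 M).
by move=> _ [->|[t _ <-]]; rewrite le_max ?lexx// fM orbT.
Qed.

Definition sup_norm (f : bfun) : R := sup (vals f).

Lemma sup_norm_ge (f : bfun) t : `|f t : R| <= sup_norm f.
Proof. by apply: sup_ubound; [exact: (vals_has_sup f).2|right; exists t]. Qed.

Lemma sup_norm_ge0 (f : bfun) : 0 <= sup_norm f.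
Proof. by apply: sup_ubound; [exact: (vals_has_sup f).2|left]. Qed.

Lemma sup_norm_le (f : bfun) M : 0 <= M -> (forall t, `|f t : R| <= M) -> sup_norm f <= M.
Proof.
move=> M0 fM; apply: ge_sup; first exact: (vals_has_sup f).1.
by move=> _ [->//|[t _ <-]].
Qed.

Lemma sup_normD f g : sup_norm (f + g) <= sup_norm f + sup_norm g.
Proof.
apply: sup_norm_le => [|t]; first by rewrite addr_ge0 ?sup_norm_ge0.
by rewrite bfunDE (le_trans (ler_normD _ _))// lerD// sup_norm_ge.
Qed.

Lemma sup_normZ (a : R) (f : bfun) : sup_norm (a *: f) = `|a| * sup_norm f.
Proof.
have le b g : sup_norm (b *: g) <= `|b| * sup_norm g.
  apply: sup_norm_le => [|t]; first by rewrite mulr_ge0 ?sup_norm_ge0.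
  by rewrite bfunZE normrM ler_wpM2l// sup_norm_ge.
apply/eqP; rewrite eq_le le/=.
have [->|a0] := eqVneq a 0; first by rewrite normr0 mul0r sup_norm_ge0.
rewrite -ler_pdivlMl ?normr_gt0// -normfV (le_trans _ (le _ _))//.
by rewrite scalerA mulVf// scale1r.
Qed.

Lemma sup_norm0_eq0 (f : bfun) : sup_norm f = 0 -> f = 0.
Proof.
move=> f0; apply/val_inj/funext => t; apply/eqP.
by rewrite -normr_le0 -f0 sup_norm_ge.
Qed.

HB.instance Definition _ :=
  Lmodule_isNormed.Build R bfun sup_normD sup_normZ sup_norm0_eq0.

(** Hahn-Banach in the space of all bounded functions produces the [mu] to which [grothendieck]
    applies; on unbounded functions it has the default value 0. *)
Lemma bdd_functional (V : lmodType R) (j : V -> T -> R) (h : V -> R^o) (C : R) :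
  0 <= C -> linear h -> (forall a x y t, j (a *: x + y) t = a * j x t + j y t) ->
  (forall v, bdd (j v)) -> (forall v M, (forall t, `|j v t| <= M) -> 0 <= M -> `|h v| <= C * M) ->
  exists mu : (T -> R) -> R,
    [/\ forall (a : R) f g, bdd f -> bdd g ->
          mu (fun t => a * f t + g t) = a * mu f + mu g,
        forall f (M : R), 0 <= M -> (forall t, `|f t| <= M) -> mu f <= C * M &
        forall v, mu (j v) = h v].
Proof.
move=> C0 lh jP jb hC.
have inP f : bdd f -> (f : T -> R^o) \in bfun_pred by rewrite inE.
pose p f := C * sup_norm f.
have sp : sublinear p.
  split=> [f g|a f a0]; first by rewrite -mulrDr ler_wpM2l ?sup_normD.
  by rewrite /p sup_normZ ger0_norm// mulrCA.
pose J v := BFun (inP _ (jb v)).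
have lJ : linear J by move=> a x y; apply/val_inj/funext => t; exact: jP.
have [|H [lH Hp HJ]] := hahn_banach sp lJ lh.
  move=> v; rewrite (le_trans (ler_norm _))// hC ?sup_norm_ge0// => t.
  exact: (sup_norm_ge (J v)).
pose mu f := if pselect (bdd f) is left b then H (BFun (inP f b)) : R else 0.
have muE f (b : bdd f) : mu f = H (BFun (inP f b)).
  rewrite /mu; case: pselect => // b'; congr H; exact/val_inj.
exists mu; split=> [a f g bf bg|f M M0 fM|v].
- have bfg : bdd (fun t => a * f t + g t).
    have := bfunP (a *: BFun (inP f bf) + BFun (inP g bg)).
    by rewrite inE.
  rewrite (muE _ bfg) (muE _ bf) (muE _ bg); have <- := lH a.
  by congr H; exact/val_inj.
- have bf : bdd f by exists M.
  rewrite (muE _ bf) (le_trans (Hp _))// ler_wpM2l// sup_norm_le//.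
- by rewrite (muE _ (jb v)) HJ.
Qed.

End BoundedFunctions.

(** * Krein's theorem *)

Section Krein.
Context {R : realType} (Y : completeNormedModType R).
Variables (G : set Y) (c : R).
Hypothesis G_compact : weakly_compact G.
Hypothesis G_bounded : forall g, G g -> `|g| <= c.
Hypothesis G0 : G 0.

Let c0 : 0 <= c.
Proof. by have := G_bounded G0; rewrite normr0. Qed.

Let vals (f : dual Y) : set R := [set `|f g : R| | g in G].

Let vals_has_sup f : has_sup (vals f).
Proof.
split; first by exists `|f 0 : R|, 0.
exists (`|f| * c) => _ [g Gg <-]; rewrite (le_trans (dual_le _ _))//.
by rewrite ler_wpM2l// G_bounded.
Qed.

Definition polar_norm (f : dual Y) : R := sup (vals f).

Local Notation q := polar_norm.

Lemma polar_norm_ge (f : dual Y) g : G g -> `|f g : R| <= q f.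
Proof. by move=> Gg; apply: sup_ubound; [exact: (vals_has_sup f).2|exists g]. Qed.

Lemma polar_norm_le (f : dual Y) M : (forall g, G g -> `|f g : R| <= M) -> q f <= M.
Proof.
move=> fM; apply: ge_sup; first exact: (vals_has_sup f).1.
by move=> _ [g Gg <-]; exact: fM.
Qed.

Lemma polar_norm_adherent (f : dual Y) e : 0 < e -> exists2 g, G g & q f - e < `|f g : R|.
Proof.
by move=> e0; have [_ [g Gg <-] h] := sup_adherent e0 (vals_has_sup f); exists g.
Qed.

Lemma polar_norm_ge0 f : 0 <= q f.
Proof. by rewrite (le_trans _ (polar_norm_ge f G0)). Qed.

Lemma polar_norm_bound f : q f <= c * `|f|.
Proof.
apply: polar_norm_le => g Gg; rewrite (le_trans (dual_le _ _))// mulrC.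
by rewrite ler_wpM2r// G_bounded.
Qed.

Lemma polar_normD f g : q (f + g) <= q f + q g.
Proof.
apply: polar_norm_le => x Gx; rewrite /= (le_trans (ler_normD _ _))//.
by rewrite lerD// polar_norm_ge.
Qed.

Lemma polar_normZ (a : R) f : q (a *: f) = `|a| * q f.
Proof.
have le b g : q (b *: g) <= `|b| * q g.
  by apply: polar_norm_le => x Gx; rewrite /= normrM ler_wpM2l// polar_norm_ge.
apply/eqP; rewrite eq_le le/=.
have [->|a0] := eqVneq a 0; first by rewrite normr0 mul0r polar_norm_ge0.
rewrite -ler_pdivlMl ?normr_gt0// -normfV (le_trans _ (le _ _))//.
by rewrite scalerA mulVf// scale1r.
Qed.

Lemma polar_normN f : q (- f) = q f.
Proof. by rewrite -scaleN1r polar_normZ normrN1 mul1r. Qed.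

Lemma polar_sublinear : sublinear q.
Proof.
by split=> [|a f a0]; [exact: polar_normD|rewrite polar_normZ ger0_norm].
Qed.

(** Grothendieck's theorem with functionals and points exchanged: the dual unit ball, compact by
    Alaoglu, indexes the family, and the weakly compact set [G] is the base over which psi becomes a
    functional on bounded functions. *)
Lemma krein_weakstar_cvg (psi : dual Y -> R^o) (C : R) : 0 <= C -> linear psi ->
  (forall f, `|psi f| <= C * q f) ->
  forall (U : set_system (dual Y)) (f0 : dual Y), UltraFilter U ->
    (\forall f \near U, `|f : dual Y| <= 1) -> `|f0| <= 1 ->
    (forall y, ((f : dual Y) y : R) @[f --> U] --> (f0 y : R)) ->
    (psi f : R) @[f --> U] --> (psi f0 : R).
Proof.
move=> C0 lpsi psiC U f0 UU U1 f01 Uf0.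
pose T := {g : Y | G g}.
have [|||mu [muP muC muE]] := @bdd_functional _ T _ (fun (f : dual Y) (t : T) => f (sval t) : R)
    psi C C0 lpsi.
- by [].
- move=> f; exists (q f) => t; exact/polar_norm_ge/svalP.
- move=> f M fM M0; rewrite (le_trans (psiC f))// ler_wpM2l//.
  by apply: polar_norm_le => g Gg; exact: (fM (exist _ g Gg)).
have := @grothendieck _ _ T mu C C0 muP _ (fun (f : dual Y) (t : T) => f (sval t) : R)
  [set f : dual Y | `|f| <= 1] c _ _ _ U f0 UU U1 f01.
under eq_cvg do rewrite muE; rewrite muE; apply.
- move=> f M fM; apply: muC => //.
  by rewrite (le_trans _ (fM (exist _ 0 G0))).
- move=> f t f1; rewrite (le_trans (dual_le _ _))//.
  rewrite (@le_trans _ _ (1 * `|sval t|)) ?ler_wpM2r// mul1r G_bounded//.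
  exact: svalP.
- move=> V UV V1; have [f [f1 fP]] := alaoglu UV ler01 V1.
  by exists f => // t; exact: fP.
- move=> V UV.
  have [|g Gg gP] := (weakly_compactP G).1 G_compact _ (fmap_ultra sval UV).
    have : V (sval @^-1` G) by apply: filterS filterT => t _; exact: svalP.
    exact.
  by exists (exist _ g Gg) => f _; exact: gP.
- by move=> t; exact: Uf0.
Qed.

(** By induction on ys, [sublinear_split] detaches a part of psi dominated by K |f y|. That part
    vanishes wherever f y does, so it is a multiple of the evaluation at y. *)
Lemma weakstar_approx (ys : seq Y) (psi : dual Y -> R^o) (e K : R) :
  0 <= e -> 0 <= K -> linear psi ->
  (forall f, psi f <= e * `|f| + K * \sum_(y <- ys) `|f y : R|) ->
  exists v, forall f : dual Y, `|psi f - f v| <= e * `|f|.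
Proof.
move=> e0 K0; elim: ys psi => [|y ys IH] psi lpsi psiK.
  exists 0 => f; rewrite linear0 subr0; apply: linear_le_norm => // g.
  by rewrite (le_trans (psiK g))// big_nil mulr0 addr0.
pose p1 (f : dual Y) := e * `|f| + K * \sum_(y <- ys) `|f y : R|.
pose p2 (f : dual Y) := K * `|f y : R|.
have sp1 : sublinear p1.
  split=> [f g|a f a0].
    rewrite /p1 addrACA -!mulrDr -big_split/= lerD// ler_wpM2l// ?ler_normD//.
    by apply: ler_sum => z _; rewrite ler_normD.
  rewrite /p1 normrZ mulrDr mulrCA (ger0_norm a0); congr (_ + _).
  rewrite mulrCA; congr (_ * _); rewrite mulr_sumr; apply: eq_bigr => z _.
  by rewrite /= normrM ger0_norm.
have sp2 : sublinear p2.
  split=> [f g|a f a0]; first by rewrite /p2 -mulrDr ler_wpM2l// ler_normD.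
  by rewrite /p2 /= normrM ger0_norm// mulrCA.
have [|h1 [h2 [lh1 lh2 h1p h2p psiE]]] := sublinear_split sp1 sp2 lpsi.
  by move=> f; rewrite (le_trans (psiK f))// big_cons mulrDr addrCA addrC.
have [v vP] := IH h1 lh1 h1p.
have h20 (f : dual Y) : f y = 0 -> h2 f = 0.
  move=> fy; apply/eqP; rewrite eq_le; apply/andP; split.
    by rewrite (le_trans (h2p f))// /p2 fy normr0 mulr0.
  rewrite -oppr_le0 -(linear_funN lh2) (le_trans (h2p _))// /p2.
  by rewrite (_ : (- f : dual Y) y = - f y)// fy oppr0 normr0 mulr0.
have [k kP] : exists k : R, forall f : dual Y, h2 f = k * f y.
  have [[f0 f0y]|nf] := pselect (exists f : dual Y, f y != 0); last first.
    exists 0 => f; rewrite mul0r h20//; apply/eqP; apply/negPn/negP => h.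
    by apply: nf; exists f.
  exists (h2 f0 / f0 y) => f.
  have d0 : (f - (f y / f0 y) *: f0) y = 0.
    by rewrite (_ : _ y = f y - f y / f0 y * f0 y)// divfK// subrr.
  have := lh2 (f y / f0 y) f0 (f - (f y / f0 y) *: f0).
  rewrite (h20 _ d0) addr0 addrC subrK => ->.
  by rewrite [LHS]mulrAC [RHS]mulrAC [f y * _]mulrC.
exists (v + k *: y) => f; rewrite psiE kP linearD linearZ/=.
by rewrite opprD addrACA [X in _ + X]subrr addr0 vP.
Qed.

(* By Grothendieck's theorem psi is weak-star continuous on the unit ball, so it is a
   norm limit of evaluations. *)
Theorem krein (psi : dual Y -> R^o) (C : R) : 0 <= C -> linear psi ->
  (forall f, `|psi f| <= C * q f) -> exists y, forall f : dual Y, psi f = f y.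
Proof.
move=> C0 lpsi psiC.
have psi0 : psi 0 = 0 := linear_fun0 lpsi.
have psiZ a f : psi (a *: f) = a * psi f := linear_funZ lpsi a f.
have approx (e : R) : 0 < e -> exists v, forall f : dual Y, `|psi f - f v| <= e * `|f|.
  move=> e0.
  have [ys [r [r0 ysP]]] : exists (ys : seq Y) (r : R), 0 < r /\ forall f : dual Y, `|f| <= 1 ->
      (forall y, y \in ys -> `|f y : R| <= r) -> `|psi f| <= e.
    apply: contrapT => nys.
    pose A (yr : seq Y * nat) := [set f : dual Y | [/\ `|f| <= 1,
      forall y, y \in yr.1 -> `|f y : R| <= yr.2.+1%:R^-1 & e < `|psi f|]].
    have FF : ProperFilter (filter_from setT A).
      apply: filter_from_proper.
        apply: filter_from_filter; first by exists ([::], 0%N).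
        move=> [l m] [l' m'] _ _; exists (l ++ l', maxn m m') => // f [f1 fl fe].
        split; split=> // y yl.
          rewrite (le_trans (fl y _))//= ?mem_cat ?yl//.
          by rewrite lef_pV2 ?posrE ?ltr0n// ler_nat ltnS leq_maxl.
        rewrite (le_trans (fl y _))//= ?mem_cat ?yl ?orbT//.
        by rewrite lef_pV2 ?posrE ?ltr0n// ler_nat ltnS leq_maxr.
      move=> [l m] _; apply: contrapT => nf; apply: nys.
      exists l, m.+1%:R^-1; split; first by rewrite invr_gt0 ltr0n.
      move=> f f1 fl; rewrite leNgt; apply/negP => fe; apply: nf.
      by exists f.
    have [U [UU UA]] := ultraFilterLemma FF.
    have U1 : \forall f \near U, `|f : dual Y| <= 1.
      by apply: UA; exists ([::], 0%N) => // f [].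
    have U0 y : ((f : dual Y) y : R) @[f --> U] --> ((0 : dual Y) y : R).
      rewrite [X in _ --> X]/=; apply/cvgrPdist_lt => s s0; rewrite near_simpl.
      apply: UA; exists ([:: y], Num.truncn s^-1) => // f [_ /(_ y)/= fy _].
      rewrite sub0r normrN; apply: le_lt_trans (fy _) _; first by rewrite mem_head.
      by rewrite invf_plt ?posrE ?ltr0n//; exact: truncnS_gt.
    have n0 : `|0 : dual Y| <= 1 by rewrite normr0.
    have := krein_weakstar_cvg C0 lpsi psiC UU U1 n0 U0.
    rewrite psi0 => /cvgrPdist_lt/(_ _ e0); rewrite near_simpl => h.
    have : U ([set f | e < `|psi f|] `&` [set f | `|0 - psi f| < e]).
      by apply: filterI h; apply: UA; exists ([::], 0%N) => // f [].
    move=> /filter_ex[f [/= h1]]; rewrite sub0r normrN => h2.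
    by have := lt_trans h1 h2; rewrite ltxx.
  have K0 : 0 <= e / r by rewrite divr_ge0 ?ltW.
  apply: (@weakstar_approx ys psi e (e / r) (ltW e0) K0 lpsi) => f.
  rewrite (le_trans (ler_norm _))//.
  (* Dividing f by s puts it in the weak-star neighbourhood where |psi| <= e; scaling back gives
     |psi f| <= e s, which is the bound with K = e / r. *)
  pose s := `|f| + r^-1 * \sum_(y <- ys) `|f y : R|.
  have sum0 : 0 <= \sum_(y <- ys) `|f y : R| by apply: sumr_ge0.
  have -> : e * `|f| + e / r * \sum_(y <- ys) `|f y : R| = e * s.
    by rewrite /s mulrDr mulrA.
  have s0 : 0 <= s by rewrite addr_ge0// mulr_ge0// invr_ge0 ltW.
  move: s0; rewrite le_eqVlt => /predU1P[s0|s0].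
    have : `|f| <= 0 by rewrite s0 /s lerDl mulr_ge0// invr_ge0 ltW.
    by rewrite normr_le0 => /eqP ->; rewrite psi0 normr0 -s0 mulr0.
  have : `|psi (s^-1 *: f)| <= e.
    apply: ysP.
      by rewrite normrZ gtr0_norm ?invr_gt0// ler_pdivrMl// mulr1 lerDl mulr_ge0// invr_ge0 ltW.
    move=> y yys; rewrite /= normrM gtr0_norm ?invr_gt0// ler_pdivrMl//.
    rewrite /s mulrDl -[leLHS]add0r lerD ?mulr_ge0 ?(ltW r0)//.
    rewrite mulrAC mulVf ?gt_eqF// mul1r (big_rem y)//= lerDl sumr_ge0//.
  by rewrite psiZ normrM gtr0_norm ?invr_gt0// ler_pdivrMl// mulrC.
have e0 n : 0 < n.+1%:R^-1 :> R by rewrite invr_gt0 ltr0n.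
have /choice[v vP] n := approx _ (e0 n).
have vd m n : `|v m - v n| <= m.+1%:R^-1 + n.+1%:R^-1.
  apply: norm_le_dual => f f1; rewrite linearB/=.
  have -> : f (v m) - f (v n) = (psi f - f (v n)) - (psi f - f (v m)).
    by rewrite opprB [RHS]addrC addrA subrK.
  rewrite (le_trans (ler_normB _ _))// addrC lerD//.
    by rewrite (le_trans (vP _ _))// ler_piMr// ltW.
  by rewrite (le_trans (vP _ _))// ler_piMr// ltW.
have /cvg_ex[y vy] : cvgn v.
  apply: cauchy_cvg; apply: cauchy_exP => e ep.
  have [k kP] := small_invn (divr_gt0 ep (ltr0n _ 2)).
  exists (v k); exists k => // m /= km; rewrite -ball_normE/=.
  by rewrite (le_lt_trans (vd _ _))// [ltRHS]splitr ltrD// kP.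
exists y => f; apply/eqP; rewrite -subr_eq0 -normr_le0; apply/ler_addgt0Pl => e ep.
rewrite addr0.
have fv : `|psi f - f (v n)| @[n --> \oo] --> `|psi f - f y|.
  apply: cvg_norm; apply: cvgB; first exact: cvg_cst.
  by apply: (cvg_comp _ _ vy); exact: dual_continuous.
have ep' : 0 < e / (`|f| + 1) by rewrite divr_gt0// ltr_wpDl.
have [k kP] := small_invn ep'.
apply: (closed_cvg (fun x => x <= e)) fv => //.
exists k => // n /= kn; rewrite (le_trans (vP _ _))//.
rewrite (le_trans (ler_wpM2r (normr_ge0 _) (ltW (kP n kn))))//.
by rewrite mulrAC ler_pdivrMr ?ltr_wpDl// ler_wpM2l ?(ltW ep)// lerDl.
Qed.

(** If N stays away from f, a q-continuous functional separates them. By Krein's theorem it is the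
    evaluation at some y, which N annihilates and f does not. So weak-star density becomes uniform
    approximation on [G]. *)
Lemma polar_norm_approx (N : set (dual Y)) (f : dual Y) (e : R) : 0 < e -> N 0 ->
  (forall g h, N g -> N h -> N (g + h)) -> (forall a g, N g -> N (a *: g)) ->
  (forall y, (forall g : dual Y, N g -> g y = 0) -> f y = 0) ->
  exists2 g, N g & q (f - g) < e.
Proof.
move=> e0 N0 ND NZ fN; apply: contrapT => nN.
have {}nN g : N g -> e <= q (f - g).
  by move=> Ng; rewrite leNgt; apply/negP => h; apply: nN; exists g.
have [|h [lh hq hS]] := @hahn_banach_cone _ _ q (fun d r =>
    exists t g, [/\ 0 <= t, N g, d = t *: f + g & r = t * e]) polar_sublinear.
  split.
  - by exists 0, 0; rewrite scale0r addr0 mul0r.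
  - move=> d d' r r' [t [g [t0 Ng -> ->]]] [t' [g' [t'0 Ng' -> ->]]].
    exists (t + t'), (g + g'); split; [exact: addr_ge0|exact: ND| |].
      by rewrite addrACA scalerDl.
    by rewrite mulrDl.
  - move=> a d r a0 [t [g [t0 Ng -> ->]]]; exists (a * t), (a *: g).
    by split; [exact: mulr_ge0|exact: NZ|rewrite scalerDr scalerA|rewrite mulrA].
  - move=> d r [t [g [t0 Ng -> ->]]].
    move: t0; rewrite le_eqVlt => /predU1P[<-|t0].
      by rewrite mul0r polar_norm_ge0.
    have -> : t *: f + g = t *: (f - (- t^-1) *: g).
      by rewrite scaleNr opprK scalerDr scalerA mulfV ?gt_eqF// scale1r.
    by rewrite polar_normZ gtr0_norm// ler_wpM2l ?(ltW t0)// nN//; exact: NZ.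
have hN g : h (- g) = - h g := linear_funN lh g.
have [|y yP] := krein ler01 lh.
  move=> g; rewrite mul1r ler_norml hq andbT lerNl -hN.
  by rewrite -polar_normN hq.
have hg0 g : N g -> 0 <= h g.
  by move=> Ng; apply: hS; exists 0, g; rewrite scale0r add0r mul0r.
have := fN y; rewrite -yP => hf.
have : e <= h f by apply: hS; exists 1, 0; rewrite scale1r addr0 mul1r.
rewrite hf ?leNgt ?e0// => g Ng; rewrite -yP.
apply/eqP; rewrite eq_le hg0// andbT -oppr_ge0 -hN; apply: hg0.
by rewrite -scaleN1r; exact: NZ.
Qed.

End Krein.

(** * Closed spans and weakly compact generation *)

Section Span.
Context {R : realType} (X : normedModType R).
Implicit Types (S G : set X) (x y : X).

Definition cspan S : set X := closure (lspan S).

Lemma lspan_sub S x : S x -> lspan S x.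
Proof.
by move=> Sx; exists [:: (1, x)]; [move=> z /[!inE] /eqP ->|rewrite big_seq1 scale1r].
Qed.

Lemma lspan0 S : lspan S 0.
Proof. by exists [::] => //; rewrite big_nil. Qed.

Lemma lspanD S x y : lspan S x -> lspan S y -> lspan S (x + y).
Proof.
move=> [s sS <-] [t tS <-]; exists (s ++ t); last by rewrite big_cat.
by move=> z; rewrite mem_cat => /orP[/sS|/tS].
Qed.

Lemma lspanZ S (a : R) x : lspan S x -> lspan S (a *: x).
Proof.
move=> [s sS <-]; exists [seq (a * z.1, z.2) | z <- s].
  by move=> _ /mapP[z /sS Sz ->].
by rewrite big_map scaler_sumr; apply: eq_bigr => z _; rewrite scalerA.
Qed.

Lemma lspan_min S G : G 0 -> (forall x y, G x -> G y -> G (x + y)) ->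
  (forall a x, G x -> G (a *: x)) -> S `<=` G -> lspan S `<=` G.
Proof.
move=> G0 GD GZ SG _ [s sS <-]; elim: s sS => [|z s IH] sS; first by rewrite big_nil.
rewrite big_cons; apply: GD; first by apply/GZ/SG/sS; rewrite mem_head.
by apply: IH => w ws; apply: sS; rewrite inE ws orbT.
Qed.

Lemma closureP S x :
  closure S x <-> forall e : R, 0 < e -> exists2 y, S y & `|x - y| < e.
Proof.
split=> [Sx e e0|h B /nbhs_ballP[e /= e0 eB]].
  have [y [Sy]] := Sx _ (nbhsx_ballx x e e0).
  by rewrite -ball_normE; exists y.
by have [y Sy xy] := h e e0; exists y; split=> //; apply: eB; rewrite -ball_normE.
Qed.

Lemma cspan_lspan S x : lspan S x -> cspan S x.
Proof. exact: subset_closure. Qed.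

Lemma cspan_sub S x : S x -> cspan S x.
Proof. by move=> /lspan_sub/cspan_lspan. Qed.

Lemma cspan0 S : cspan S 0.
Proof. exact/cspan_lspan/lspan0. Qed.

Lemma cspanD S x y : cspan S x -> cspan S y -> cspan S (x + y).
Proof.
move=> /closureP Sx /closureP Sy; apply/closureP => e e0.
have [x' Sx' xx'] := Sx _ (divr_gt0 e0 (ltr0n _ 2)).
have [y' Sy' yy'] := Sy _ (divr_gt0 e0 (ltr0n _ 2)).
exists (x' + y'); first exact: lspanD.
by rewrite opprD addrACA (le_lt_trans (ler_normD _ _))// [ltRHS]splitr ltrD.
Qed.

Lemma cspanZ S (a : R) x : cspan S x -> cspan S (a *: x).
Proof.
move=> /closureP Sx; apply/closureP => e e0.
have a1 : 0 < `|a| + 1 by rewrite ltr_wpDl.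
have [x' Sx' xx'] := Sx _ (divr_gt0 e0 a1).
exists (a *: x'); first exact: lspanZ.
rewrite -scalerBr normrZ; move: xx'; rewrite ltr_pdivlMr// mulrC.
by apply: le_lt_trans; rewrite ler_wpM2r// lerDl.
Qed.

Lemma cspanB S x y : cspan S x -> cspan S y -> cspan S (x - y).
Proof. by move=> Sx Sy; rewrite -scaleN1r; apply: cspanD => //; exact: cspanZ. Qed.

Lemma cspan_closed S x : closure (cspan S) x -> cspan S x.
Proof. exact: closed_closure. Qed.

Lemma cspan_min S G : S `<=` cspan G -> cspan S `<=` cspan G.
Proof.
move=> SG x /closureP Sx; apply: cspan_closed; apply/closureP => e /Sx[y Sy xy].
exists y => //; apply: lspan_min Sy => //; [exact: cspan0|exact: cspanD|exact: cspanZ].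
Qed.

Lemma cspan_mono S G : S `<=` G -> cspan S `<=` cspan G.
Proof. by move=> SG; apply: cspan_min => x /SG; exact: cspan_sub. Qed.

Lemma rat_approx (a e : R) : 0 < e -> exists r : rat, `|a - ratr r| < e.
Proof.
move=> e0; have : a - e < a + e by rewrite ltrD2l gtrN.
move=> /rat_in_itvoo[r]; rewrite in_itv/= => /andP[h1 h2]; exists r.
by rewrite ltr_norml; apply/andP; split; lra.
Qed.

(** Rational coefficients make the combinations of countably many points countable, which
    [good_countable] relies on. *)
Lemma lspan_rat S x (e : R) : lspan S x -> 0 < e ->
  exists2 l : seq (rat * X), (forall z, z \in l -> S z.2) &
    `|x - \sum_(z <- l) (ratr z.1 : R) *: z.2| < e.
Proof.
move=> [s sS <-]; elim: s sS e => [|z s IH] sS e e0.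
  by exists [::] => //; rewrite !big_nil subrr normr0.
have [|l lS le] := IH _ _ (divr_gt0 e0 (ltr0n _ 2)).
  by move=> w ws; apply: sS; rewrite inE ws orbT.
have z1 : 0 < `|z.2| + 1 by rewrite ltr_wpDl.
have [r rz] := rat_approx z.1 (divr_gt0 (divr_gt0 e0 (ltr0n _ 2)) z1).
exists ((r, z.2) :: l).
  by move=> w /[!inE] /predU1P[->|/lS//]; apply: sS; rewrite mem_head.
rewrite !big_cons opprD addrACA (le_lt_trans (ler_normD _ _))//.
rewrite [ltRHS]splitr ler_ltD// -scalerBl normrZ.
rewrite (le_trans _ (_ : `|z.1 - ratr r| * (`|z.2| + 1) <= _))//.
  by rewrite ler_wpM2l// lerDl.
by rewrite -ler_pdivlMr// ltW.
Qed.

End Span.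

Lemma cspan_image (R : realType) (X V : normedModType R) (Q : X -> V) (C : R)
    (S : set X) (y : X) : linear Q -> (forall x, `|Q x| <= C * `|x|) ->
  cspan S y -> cspan (Q @` S) (Q y).
Proof.
move=> lQ QC.
have C1 : 0 < `|C| + 1 by rewrite ltr_wpDl.
move=> /closureP Sy; apply: cspan_closed; apply/closureP => e e0.
have [x Sx xy] := Sy _ (divr_gt0 e0 C1).
exists (Q x).
  move: x Sx {xy}; apply: (@lspan_min _ _ S [set x | cspan (Q @` S) (Q x)]).
  - by rewrite /= (linear_fun0 lQ); exact: cspan0.
  - by move=> x z /= hx hz; rewrite (linear_funD lQ); exact: cspanD.
  - by move=> r x /= hx; rewrite (linear_funZ lQ); exact: cspanZ.
  - by move=> x Sx; apply: cspan_sub; exists x.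
have -> : Q y - Q x = Q (y - x) by rewrite (linear_funD lQ) (linear_funN lQ).
move: xy; rewrite ltr_pdivlMr// mulrC; apply: le_lt_trans.
rewrite (le_trans (QC _))// ler_wpM2r// (le_trans (ler_norm C))// lerDl//.
Qed.

Section WCGUnion.
Context {R : realType} (X : normedModType R).

Lemma weakly_compact_image_ultra (P : Type) (S : set P) (t : P -> X) :
  (forall U : set_system P, UltraFilter U -> U S -> exists2 p0, S p0 &
     forall f : dual X, (f (t p) : R) @[p --> U] --> (f (t p0) : R)) ->
  weakly_compact (t @` S).
Proof.
move=> h; apply/weakly_compactP => F UF FS.
have [V [UV VS <-]] := ultra_lift UF FS.
by have [p0 Sp0 p0P] := h V UV VS; exists (t p0); [exists p0|exact: p0P].
Qed.

(** Once the n-th set is scaled into the ball of radius 1 / (n + 1), the union with 0 is weakly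
    compact: an ultrafilter on it either contains one of the scaled sets or tends to 0 in norm. *)
Lemma WCG_union (F : nat -> set X) (r : nat -> R) :
  (forall n, weakly_compact (F n)) ->
  (forall n x, F n x -> `|x| <= r n) ->
  @cspan R X (\bigcup_n F n) = setT ->
  exists G : set X, [/\ weakly_compact G, (forall g, G g -> `|g| <= 1), G 0 & cspan G = setT].
Proof.
move=> Fc Fr Fd.
pose k n := (n.+1%:R * (`|r n| + 1))^-1.
have k0 n : 0 < k n by rewrite invr_gt0 mulr_gt0// ltr_wpDl.
have kr n x : F n x -> `|k n *: x| <= n.+1%:R^-1.
  move=> Fx; have r1 : 0 < `|r n| + 1 by rewrite ltr_wpDl.
  rewrite normrZ gtr0_norm// /k invfM -mulrA ler_piMr ?invr_ge0//.
  rewrite ler_pdivrMl// mulr1 (le_trans (Fr _ _ Fx))//.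
  by rewrite (le_trans (ler_norm _))// lerDl.
pose A n := [set k n *: x | x in F n].
exists ([set 0] `|` \bigcup_n A n); split.
- apply/weakly_compactP => U UU UG.
  have [[n UA]|nA] := pselect (exists n, U (A n)).
    have [|x Fx xP] := (weakly_compactP (F n)).1 (Fc n) _
        (fmap_ultra (fun y => (k n)^-1 *: y) UU).
      have : U ((fun y => (k n)^-1 *: y) @^-1` F n).
        by apply: filterS UA => _ [x Fx <-] /=; rewrite scalerA mulVf ?scale1r ?gt_eqF.
      exact.
    exists (k n *: x); first by right; exists n => //; exists x.
    move=> f; have h : (f ((k n)^-1 *: y) : R) @[y --> U] --> (f x : R) by exact: xP.
    have -> : (fun y => f y : R) = (fun y => k n * f ((k n)^-1 *: y)).
      by apply/funext => y; rewrite linearZ/= mulrA mulfV ?gt_eqF// mul1r.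
    by rewrite linearZ/=; apply: cvgMl_tmp; exact: h.
  exists 0; first by left.
  have small n : U [set y | `|y| <= n.+1%:R^-1].
    have : U (~` (\bigcup_(m in [set m | (m < n)%N]) A m)).
      elim: n => [|n IH]; first by apply: filterS filterT => y _ [].
      have [h|h] := in_ultra_setVsetC (A n) UU; first by exfalso; apply: nA; exists n.
      apply: filterS (filterI IH h) => y [h1 h2] [m /=]; rewrite ltnS leq_eqVlt.
      by move=> /predU1P[->//|mn] Ay; apply: h1; exists m.
    move=> /(filterI UG); apply: filterS => y [[->|[m _ Ay]] hy] /=.
      by rewrite normr0 invr_ge0.
    have nm : (n <= m)%N by rewrite leqNgt; apply/negP => mn; apply: hy; exists m.
    move: Ay => [x Fx <-]; rewrite (le_trans (kr _ _ Fx))//.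
    by rewrite lef_pV2 ?posrE ?ltr0n// ler_nat ltnS.
  move=> f; rewrite linear0; apply/cvgrPdist_lt => e e0; rewrite near_simpl.
  have f1 : 0 < `|f| + 1 by rewrite ltr_wpDl.
  have e1 := divr_gt0 e0 f1.
  apply: filterS (small (Num.truncn (e / (`|f| + 1))^-1)) => y /= hy.
  rewrite sub0r normrN (le_lt_trans (dual_le _ _))//.
  rewrite (le_lt_trans (ler_wpM2l (normr_ge0 _) hy))//.
  rewrite (@le_lt_trans _ _ ((`|f| + 1) * (Num.truncn (e / (`|f| + 1))^-1).+1%:R^-1))//.
    by rewrite ler_wpM2r ?invr_ge0// lerDl.
  rewrite mulrC -ltr_pdivlMr// invf_plt ?posrE ?ltr0n//.
  exact: truncnS_gt.
- move=> _ [->|[n _ [x Fx <-]]]; first by rewrite normr0.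
  by rewrite (le_trans (kr _ _ Fx))// invf_le1 ?ler1n.
- by left.
- apply/seteqP; split=> // x _; have : @cspan R X (\bigcup_n F n) x by rewrite Fd.
  apply: cspan_min => {}x [n _ Fx].
  have -> : x = (k n)^-1 *: (k n *: x) by rewrite scalerA mulVf ?scale1r ?gt_eqF.
  by apply/cspanZ/cspan_sub; right; exists n => //; exists x.
Qed.

(** The parts of G in the balls of radius n are weakly compact, since balls are weakly closed, and
    [WCG_union] glues them. *)
Lemma WCG_bounded (G : set X) : weakly_compact G -> cspan G = setT ->
  exists G' : set X, [/\ weakly_compact G', (forall g, G' g -> `|g| <= 1), G' 0 & cspan G' = setT].
Proof.
move=> Gc Gd; apply: (@WCG_union (fun n => G `&` [set x | `|x| <= n%:R]) (fun n => n%:R)).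
- move=> n; apply/weakly_compactP => U UU UG.
  have [|g Gg gP] := (weakly_compactP G).1 Gc U UU.
    by apply: filterS UG => x [].
  exists g => //; split=> //=; apply: norm_le_dual => f f1.
  apply: cvg_norm_le (gP f) _; apply: filterS UG => x [_ /= xn].
  rewrite (le_trans (dual_le _ _))// (le_trans _ xn)//.
  by rewrite ler_piMl.
- by move=> n x [].
- apply/seteqP; split=> // x _; have : cspan G x by rewrite Gd.
  apply: cspan_min => {}x Gx; apply: cspan_sub.
  exists (Num.truncn `|x|).+1 => //; split=> //=.
  by have /ltW := truncnS_gt `|x|.
Qed.

End WCGUnion.

(** * Projections and the Amir-Lindenstrauss theorem *)

Section Projections.
Context {R : realType} (Y : completeNormedModType R).
Variables (G : set Y) (c : R).
Hypothesis G_compact : weakly_compact G.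
Hypothesis G_bounded : forall g, G g -> `|g| <= c.
Hypothesis G0 : G 0.
Hypothesis G_dense : cspan G = setT.

Local Notation q := (polar_norm G).
Let q_ge := polar_norm_ge G_bounded G0.
Let q_ge0 := polar_norm_ge0 G_bounded G0.
Let q_bound := polar_norm_bound G_bounded G0.
Let qD := polar_normD G_bounded G0.
Let qN := polar_normN G_bounded G0.
Let qZ := polar_normZ G_bounded G0.

Let c0 : 0 <= c.
Proof. by have := G_bounded G0; rewrite normr0. Qed.

Lemma dual_eq0_on (S : set Y) (f : dual Y) : (forall y, S y -> f y = 0) ->
  forall y, cspan S y -> f y = 0.
Proof.
move=> fS y /closureP Sy; apply/eqP; rewrite -normr_le0; apply/ler_addgt0Pl => e e0.
rewrite addr0; have f1 : 0 < `|f| + 1 by rewrite ltr_wpDl.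
have [x Sx xy] := Sy _ (divr_gt0 e0 f1).
have fx : f x = 0.
  move: x Sx {xy}; apply: (@lspan_min _ _ S [set x | f x = 0]) => //=.
  - by rewrite linear0.
  - by move=> x z fx fz; rewrite linearD/= fx fz addr0.
  - by move=> a x fx; rewrite linearZ/= fx scaler0.
rewrite -(subr0 (f y)) -fx -linearB/= (le_trans (dual_le _ _))//.
rewrite (le_trans (_ : _ <= (`|f| + 1) * `|y - x|))//.
  by rewrite ler_wpM2r// lerDl.
by rewrite mulrC -ler_pdivlMr// ltW.
Qed.

Lemma polar_norm_eq0 (f : dual Y) : q f <= 0 -> f = 0.
Proof.
move=> qf; apply/val_inj/funext => y /=.
apply: (@dual_eq0_on G); last by rewrite G_dense.
by move=> g Gg; apply/eqP; rewrite -normr_le0 (le_trans (q_ge _ Gg)).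
Qed.

(** The shift by 2 keeps 1 - rad m positive from m = 0 on; this factor tends to 1 as m grows. *)
Definition rad (m : nat) : R := m.+2%:R^-1.

Lemma rad_gt0 m : 0 < rad m. Proof. by rewrite invr_gt0. Qed.

Lemma rad_lt1 m : rad m < 1. Proof. by rewrite invf_lt1 ?ltr1n. Qed.

(* the unit ball of the dual of the norm whose unit ball is the closure of
   (absolutely convex hull of G) + (rad m) B *)
Definition rball (m : nat) (f : dual Y) := q f + rad m * `|f| <= 1.

Lemma rball_norm m f : rball m f -> `|f| <= (rad m)^-1.
Proof.
move=> fm; rewrite -[leRHS]mulr1 ler_pdivlMl ?rad_gt0//.
by rewrite (le_trans _ fm)// lerDr.
Qed.

Lemma near_attained (f : dual Y) : exists2 g, G g & q f <= 2 * `|f g : R|.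
Proof.
have := q_ge0 f; rewrite le_eqVlt => /predU1P[<-|qf].
  by exists 0 => //; rewrite mulr_ge0.
have [g Gg h] := polar_norm_adherent G_bounded G0 f (divr_gt0 qf (ltr0n _ 2)).
by exists g => //; lra.
Qed.

Lemma near_norming (m : nat) (y : Y) : exists f : dual Y, rball m f /\
  forall h, rball m h -> (1 - rad m) * `|h y : R| <= f y.
Proof.
pose E := [set `|h y : R| | h in [set h | rball m h]].
have q0 : q 0 = 0 by rewrite -(scale0r 0) qZ normr0 mul0r.
have r0 : rball m 0 by rewrite /rball q0 normr0 mulr0 addr0.
have Es : has_sup E.
  split; first by exists `|(0 : dual Y) y : R|, 0.
  exists ((rad m)^-1 * `|y|) => _ [h hm <-]; rewrite (le_trans (dual_le _ _))//.
  by rewrite ler_wpM2r// rball_norm.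
have Ele h : rball m h -> `|h y : R| <= sup E.
  by move=> hm; apply: sup_ubound; [exact: Es.2|exists h].
have s0 : 0 <= sup E by rewrite (le_trans _ (Ele _ r0)).
move: s0; rewrite le_eqVlt => /predU1P[s0|s0].
  exists 0; split => // h /Ele; rewrite -s0 normr_le0 => /eqP ->.
  by rewrite normr0 mulr0.
have [_ [h hm <-] hs] := sup_adherent (mulr_gt0 (rad_gt0 m) s0) Es.
have key k : rball m k -> (1 - rad m) * `|k y : R| <= `|h y : R|.
  move=> /Ele ks; rewrite (le_trans _ (ltW hs))//.
  have -> : sup E - rad m * sup E = (1 - rad m) * sup E by rewrite mulrBl mul1r.
  by apply: ler_wpM2l => //; rewrite subr_ge0 ltW// rad_lt1.
have [hy|hy] := leP 0 (h y).
  by exists h; split=> // k /key; rewrite (ger0_norm hy).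
exists (- h); split; first by rewrite /rball qN normrN.
by move=> k /key; rewrite (ltr0_norm hy).
Qed.

Definition attain (f : dual Y) : Y := sval (cid2 (near_attained f)).

Lemma attainG f : G (attain f).
Proof. by rewrite /attain; case: cid2. Qed.

Lemma attainP f : q f <= 2 * `|f (attain f) : R|.
Proof. by rewrite /attain; case: cid2. Qed.

Definition norming m y : dual Y := sval (cid (near_norming m y)).

Lemma norming_rball m y : rball m (norming m y).
Proof. by rewrite /norming; case: cid => f []. Qed.

Lemma normingP m y h : rball m h -> (1 - rad m) * `|h y : R| <= norming m y y.
Proof. by rewrite /norming; case: cid => f [] /= _; exact. Qed.

Definition rcomb (l : seq (rat * Y)) : Y := \sum_(z <- l) (ratr z.1 : R) *: z.2.

(** Functionals are named by finite data over the points, so stability is closure under a finitary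
    operation and passes to unions of chains. *)
Definition rcomb_dual (l : seq (rat * (nat * seq (rat * Y)))) : dual Y :=
  \sum_(z <- l) (ratr z.1 : R) *: norming z.2.1 (rcomb z.2.2).

Definition rcomb_in (D : set Y) (l : seq (rat * Y)) := forall z, z \in l -> D z.2.

Definition rcomb_dual_in (D : set Y) (l : seq (rat * (nat * seq (rat * Y)))) :=
  forall z, z \in l -> rcomb_in D z.2.2.

(* Stable sets replace elementary submodels: Y is the direct sum of cspan D and
   perp D, and the projection onto cspan D maps hull_pt to itself. *)
Definition stable (D : set Y) := forall l, rcomb_dual_in D l -> D (attain (rcomb_dual l)).

Definition normings (D : set Y) : set (dual Y) :=
  [set norming z.1 (rcomb z.2) | z in [set z : nat * seq (rat * Y) | rcomb_in D z.2]].

Definition perp (D : set Y) (y : Y) := forall f, normings D f -> f y = 0.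

Lemma normings_mono (D D' : set Y) : D `<=` D' -> normings D `<=` normings D'.
Proof. by move=> DD' _ [[m l] h <-]; exists (m, l) => // z /h; exact: DD'. Qed.

Lemma perp_lspan D y f : perp D y -> lspan (normings D) f -> f y = 0.
Proof.
move=> Dy; move: f; apply: (@lspan_min _ _ _ [set f : dual Y | f y = 0]) => //=.
- by move=> f g fy gy; rewrite -[LHS]/(f y + g y) fy gy addr0.
- by move=> a f fy; rewrite -[LHS]/(a * f y) fy mulr0.
Qed.

Lemma perp0 D : perp D 0.
Proof. by move=> f _; rewrite linear0. Qed.

Lemma perpD D x y : perp D x -> perp D y -> perp D (x + y).
Proof. by move=> Dx Dy f Df; rewrite linearD/= Dx// Dy// addr0. Qed.

Lemma perpZ D (a : R) x : perp D x -> perp D (a *: x).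
Proof. by move=> Dx f Df; rewrite linearZ/= Dx// scaler0. Qed.

Lemma perpB D x y : perp D x -> perp D y -> perp D (x - y).
Proof. by move=> Dx Dy; rewrite -scaleN1r; apply: perpD => //; exact: perpZ. Qed.

Lemma cspan_rcomb D v (e : R) : cspan D v -> 0 < e ->
  exists2 l, rcomb_in D l & `|v - rcomb l| < e.
Proof.
move=> /closureP Dv e0; have [v' Dv' vv'] := Dv _ (divr_gt0 e0 (ltr0n _ 2)).
have [l lD lv'] := lspan_rat Dv' (divr_gt0 e0 (ltr0n _ 2)).
exists l => //; rewrite -(subrKA v') (le_lt_trans (ler_normD _ _))//.
by rewrite [ltRHS]splitr ltrD.
Qed.

Lemma lspan_rcomb_dual D f (e : R) : lspan (normings D) f -> 0 < e ->
  exists2 l, rcomb_dual_in D l & `|f - rcomb_dual l| < e.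
Proof.
move=> /lspan_rat/[apply] -[l lD lf].
suff [l' l'D l'E] : exists2 l', rcomb_dual_in D l' &
    \sum_(z <- l) (ratr z.1 : R) *: z.2 = rcomb_dual l'.
  by exists l'; rewrite // -l'E.
elim: l lD {lf} => [|z l IH] lD; first by exists [::]; rewrite // /rcomb_dual !big_nil.
have [|l' l'D l'E] := IH; first by move=> w wl; apply: lD; rewrite inE wl orbT.
have [[m s] /= sD sE] : normings D z.2 by apply: lD; rewrite mem_head.
exists ((z.1, (m, s)) :: l'); first by move=> w /[!inE] /predU1P[->//|/l'D].
by rewrite /rcomb_dual !big_cons l'E/= sE.
Qed.

(** The functional norming a rational combination close to v kills z, so it cannot tell v from v +
    z. Hence adding z lowers the size of v, measured by [rball m], at most by the factor 1 - rad
    m. *)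
Lemma contractive D v z m h (C : R) : cspan D v -> perp D z -> rball m h ->
  (forall h', rball m h' -> `|h' (v + z) : R| <= C) -> (1 - rad m) * `|h v : R| <= C.
Proof.
move=> Dv Dz hm hC; apply/ler_addgt0Pl => e e0.
have r0 := rad_gt0 m; have r1 := rad_lt1 m.
have [l lD lv] := cspan_rcomb Dv (mulr_gt0 r0 (divr_gt0 e0 (ltr0n _ 2))).
set v' := rcomb l in lv.
have bnd f : rball m f -> `|f (v - v') : R| <= e / 2.
  move=> /rball_norm fm; rewrite (le_trans (dual_le _ _))//.
  rewrite (le_trans (ler_wpM2r _ fm))//.
  by rewrite ler_pdivrMl// ltW.
have h1 : (1 - rad m) * `|h v' : R| <= C + e / 2.
  rewrite (le_trans (normingP _ hm))//.
  have nD : normings D (norming m v') by exists (m, l).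
  have -> : norming m v' v' = norming m v' (v + z) - norming m v' (v - v').
    by rewrite linearB linearD/= (Dz _ nD) addr0 opprB addrC subrK.
  rewrite (le_trans (ler_norm _))// (le_trans (ler_normB _ _))//.
  by rewrite lerD// ?hC ?bnd//; exact: norming_rball.
have h2 : `|h v : R| <= `|h v' : R| + e / 2.
  by rewrite -[v](subrK v') addrC linearD/= (le_trans (ler_normD _ _))// lerD2l bnd.
rewrite (le_trans (ler_wpM2l _ h2))// ?subr_ge0 ?(ltW r1)//.
have : (1 - rad m) * (e / 2) <= e / 2.
  by rewrite ler_piMl ?divr_ge0 ?(ltW e0)// gerBl ltW.
rewrite mulrDr; lra.
Qed.

(** The case m = 0: [rball 0] contains the ball of radius 1 / (c + 1) and lies in the ball of radius
    2. The constant 4 (c + 1) collects these factors and 1 / (1 - rad 0) = 2. *)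
Lemma contractive_norm D v z : cspan D v -> perp D z ->
  `|v| <= 4 * (c + 1) * `|v + z|.
Proof.
move=> Dv Dz; apply: norm_le_dual => h h1.
have c1 : 0 < c + 1 by rewrite ltr_wpDl.
have km : rball 0 ((c + 1)^-1 *: h).
  rewrite /rball qZ normrZ mulrCA -mulrDr ger0_norm ?invr_ge0 ?(ltW c1)//.
  rewrite ler_pdivrMl// mulr1 lerD//.
    by rewrite (le_trans (q_bound _))// ler_piMr.
  by rewrite mulr_ile1// ?(ltW (rad_gt0 _)) ?(ltW (rad_lt1 _)).
have r2 : (rad 0)^-1 = 2 by rewrite /rad invrK.
have hC h' : rball 0 h' -> `|h' (v + z) : R| <= 2 * `|v + z|.
  move=> /rball_norm; rewrite r2 => h'2; rewrite (le_trans (dual_le _ _))//.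
  by rewrite ler_wpM2r.
have := contractive Dv Dz km hC.
have -> : 1 - rad 0 = 2^-1 by rewrite /rad; lra.
have -> : `|((c + 1)^-1 *: h) v : R| = (c + 1)^-1 * `|h v : R|.
  by rewrite -[X in `|X|]/((c + 1)^-1 * h v) normrM gtr0_norm ?invr_gt0.
rewrite ler_pdivrMl// ler_pdivrMl// => /le_trans; apply.
by rewrite !mulrA; apply: ler_wpM2r => //; lra.
Qed.

(* the closed absolutely convex hull of G *)
Definition hull_pt (y : Y) := forall f : dual Y, `|f y : R| <= q f.

Lemma hull_ptG g : G g -> hull_pt g.
Proof. by move=> Gg f; exact: q_ge. Qed.

Lemma hull_ptZ (a : R) y : `|a| <= 1 -> hull_pt y -> hull_pt (a *: y).
Proof.
move=> a1 yG f; rewrite linearZ/= normrM (le_trans (ler_wpM2l _ (yG f)))//.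
by rewrite ler_piMl.
Qed.

Lemma hull_pt_mid x y : hull_pt x -> hull_pt y -> hull_pt (2^-1 *: (x - y)).
Proof.
move=> xG yG f; rewrite linearZ linearB/= normrM gtr0_norm// ler_pdivrMl//.
by rewrite (le_trans (ler_normB _ _))// mulr_natl mulr2n lerD.
Qed.

Lemma hull_pt_norm y : hull_pt y -> `|y| <= c.
Proof.
move=> yG; apply: norm_le_dual => f f1; rewrite (le_trans (yG f))//.
by rewrite (le_trans (q_bound f))// ler_piMr.
Qed.

(** As m tends to infinity, the factor 1 - rad m and the term rad m * |f| disappear, so no constant
    is lost; this is the purpose of a whole sequence of norms. It lets the transfinite construction
    stay inside one hull. *)
Lemma contractive_hull D v z : cspan D v -> perp D z -> hull_pt (v + z) -> hull_pt v.
Proof.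
move=> Dv Dz vzG f; have [->|f0] := eqVneq f 0; first by rewrite /= normr0.
have key m : (1 - rad m) * `|f v : R| <= q f + rad m * `|f|.
  have t0 : 0 < q f + rad m * `|f|.
    by rewrite ltr_wpDl// mulr_gt0 ?rad_gt0 ?normr_gt0.
  have hm : rball m ((q f + rad m * `|f|)^-1 *: f).
    rewrite /rball qZ normrZ mulrCA -mulrDr ger0_norm ?invr_ge0 ?(ltW t0)//.
    by rewrite mulVf ?gt_eqF.
  have hC h' : rball m h' -> `|h' (v + z) : R| <= 1.
    move=> h'm; rewrite (le_trans (vzG h'))// (le_trans _ h'm)//.
    by rewrite lerDl mulr_ge0// ltW ?rad_gt0.
  have := contractive Dv Dz hm hC.
  have -> : `|((q f + rad m * `|f|)^-1 *: f) v : R| = (q f + rad m * `|f|)^-1 * `|f v : R|.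
    by rewrite -[X in `|X|]/((q f + rad m * `|f|)^-1 * f v) normrM gtr0_norm ?invr_gt0.
  by rewrite mulrCA ler_pdivrMl// mulr1.
apply/ler_addgt0Pl => e e0.
have s0 : 0 < `|f v : R| + `|f| + 1 by rewrite ltr_wpDl// addr_ge0.
pose m := Num.truncn (e / (`|f v : R| + `|f| + 1))^-1.
have rm : rad m * (`|f v : R| + `|f| + 1) <= e.
  rewrite -ler_pdivlMr// invf_ple ?posrE ?divr_gt0//.
  rewrite (le_trans (ltW (truncnS_gt _)))// ler_nat//.
have := key m; have := rad_gt0 m; rewrite !mulrDr mulr1 in rm.
rewrite mulrBl mul1r; lra.
Qed.

Section StableProjection.
Variables (D : set Y).
Hypothesis D_stable : stable D.

(** Vanishing on perp D, f is polar-norm close to some [rcomb_dual] nu over D. Stability puts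
    [attain nu] in D, where f is 0, so q nu <= 2 |nu (attain nu)| <= 2 q (f - nu) and q f <= 3 q (f
    - nu). *)
Lemma stable_separating (f : dual Y) :
  (forall y, D y -> f y = 0) -> (forall y, perp D y -> f y = 0) -> f = 0.
Proof.
move=> fD fp; apply: polar_norm_eq0; apply/ler_addgt0Pl => e e0; rewrite addr0.
have e6 : 0 < e / 6 by rewrite divr_gt0.
have [|||g Ng fg] := polar_norm_approx G_compact G_bounded G0 (N := lspan (normings D))
    (f := f) e6 (lspan0 _).
- exact: lspanD.
- exact: lspanZ.
- by move=> y yD; apply: fp => h Dh; apply: yD; exact: lspan_sub.
have c1 : 0 < c + 1 by rewrite ltr_wpDl.
have [l lD lg] := lspan_rcomb_dual Ng (divr_gt0 e6 c1).
set nu := rcomb_dual l in lg.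
have gn : q (g - nu) <= e / 6.
  rewrite (le_trans (q_bound _))//.
  rewrite (le_trans (_ : _ <= (c + 1) * `|g - nu|))//.
    by rewrite ler_wpM2r// lerDl.
  by rewrite mulrC -ler_pdivlMr// ltW.
have fn : q (f - nu) <= e / 3.
  rewrite -(subrKA g) (le_trans (qD _ _))//.
  by have := ltW fg; lra.
have := attainP nu; have -> : nu (attain nu) = - (f - nu) (attain nu).
  rewrite -[RHS]/(- (f (attain nu) - nu (attain nu))) fD ?sub0r ?opprK//.
  exact: D_stable.
rewrite normrN => h1; have h2 := q_ge (f - nu) (attainG nu).
have := qD (f - nu) nu; rewrite subrK => h3.
lra.
Qed.

(** The sum of cspan D and perp D is dense by [stable_separating], and closed because
    [contractive_norm] controls the component in cspan D. *)
Lemma stable_decomp y : exists v, cspan D v /\ perp D (y - v).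
Proof.
pose S := [set s | exists2 v, cspan D v & perp D (s - v)].
have c1 : 0 < c + 1 by rewrite ltr_wpDl.
have near d : 0 < d -> exists2 s, S s & `|y - s| <= d.
  move=> d0; apply: (@dual_dist _ _ S y 0) => //.
  - by exists 0; [exact: cspan0|rewrite subr0; exact: perp0].
  - move=> s t [v Dv sv] [w Dw tw]; exists (v + w); first exact: cspanD.
    by rewrite opprD addrACA; exact: perpD.
  - move=> a s [v Dv sv]; exists (a *: v); first exact: cspanZ.
    by rewrite -scalerBr; exact: perpZ.
  - move=> f fS; rewrite (_ : f = 0) ?normr0 ?mulr0//; apply: stable_separating.
      move=> x Dx; apply: fS; exists x; first exact: cspan_sub.
      by rewrite subrr; exact: perp0.
    by move=> x Dx; apply: fS; exists 0; [exact: cspan0|rewrite subr0].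
have e0 n : 0 < n.+1%:R^-1 :> R by rewrite invr_gt0 ltr0n.
have /choice[v vP] : forall n, exists v, exists s,
    [/\ cspan D v, perp D (s - v) & `|y - s| <= n.+1%:R^-1].
  by move=> n; have [s [v Dv sv] ys] := near _ (e0 n); exists v, s.
have /choice[s sP] := vP.
have vd m n : `|v m - v n| <= 4 * (c + 1) * (m.+1%:R^-1 + n.+1%:R^-1).
  have [Dm pm ym] := sP m; have [Dn pn yn] := sP n.
  rewrite (le_trans (contractive_norm (cspanB Dm Dn) (perpB pm pn)))//.
  apply: ler_wpM2l; first by rewrite mulr_ge0// ltW.
  have -> : v m - v n + (s m - v m - (s n - v n)) = (y - s n) - (y - s m).
    by rewrite addrACA -opprD !(addrCA (v _)) !subrr !addr0 opprB [RHS]addrC addrA subrK.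
  by rewrite (le_trans (ler_normB _ _))// addrC lerD.
have /cvg_ex[w vw] : cvgn v.
  apply: cauchy_cvg; apply: cauchy_exP => e ep.
  have [k kP] := small_invn (divr_gt0 (divr_gt0 ep (ltr0n _ 2))
    (mulr_gt0 (ltr0n _ 4) c1)).
  exists (v k); exists k => // m /= km; rewrite -ball_normE/=.
  rewrite (le_lt_trans (vd _ _))// mulrC -ltr_pdivlMr ?mulr_gt0//.
  by rewrite [e]splitr [ltRHS]mulrDl ltrD// kP.
have vw' e : 0 < e -> exists k, forall n, (k <= n)%N -> `|w - v n| < e.
  move=> ep; have := vw; move=> /cvgrPdist_lt/(_ _ ep)[k _ kP].
  by exists k => n kn; exact: kP.
exists w; split.
  apply: cspan_closed; apply/closureP => e /vw'[k kP].
  by exists (v k); [have [] := sP k|exact: kP].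
move=> f Df; apply/eqP; rewrite -normr_le0; apply/ler_addgt0Pl => e ep; rewrite addr0.
have f1 : 0 < `|f| + 1 by rewrite ltr_wpDl.
have ep' := divr_gt0 (divr_gt0 ep (ltr0n _ 2)) f1.
have [k kP] := vw' _ ep'; have [k' k'P] := small_invn ep'.
pose n := maxn k k'; have [Dn pn yn] := sP n.
have fd x (d : R) : `|x| <= d -> d <= e / 2 / (`|f| + 1) -> `|f x : R| <= e / 2.
  move=> xd de; rewrite (le_trans (dual_le _ _))//.
  rewrite (le_trans (_ : _ <= (`|f| + 1) * `|x|))//.
    by rewrite ler_wpM2r// lerDl.
  by rewrite mulrC -ler_pdivlMr// (le_trans xd).
have -> : f (y - w) = f (y - s n) - f (w - v n).
  have -> : y - w = (y - s n) + (s n - v n) - (w - v n).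
    by rewrite subrKA opprB addrA subrK.
  by rewrite linearB linearD/= (pn _ Df) addr0.
rewrite (le_trans (ler_normB _ _))// [leRHS]splitr lerD//.
  by apply: fd yn _; apply/ltW/k'P; exact: leq_maxr.
by apply: fd (lexx _) _; apply/ltW/kP; exact: leq_maxl.
Qed.

End StableProjection.

Definition proj (D : set Y) (y : Y) : Y := xget 0 [set v | cspan D v /\ perp D (y - v)].

Section ProjTheory.
Variable D : set Y.
Hypothesis D_stable : stable D.

Lemma proj_cspan y : cspan D (proj D y).
Proof. by rewrite /proj; case: xgetP => [v _ []|h] //; exact: cspan0. Qed.

Lemma proj_perp y : perp D (y - proj D y).
Proof.
rewrite /proj; case: xgetP => [v _ []|h] //.
by have [v] := stable_decomp D_stable y; move=> /h.
Qed.

Lemma proj_unique y v : cspan D v -> perp D (y - v) -> proj D y = v.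
Proof.
move=> Dv yv; apply/eqP; rewrite -subr_eq0 -normr_le0.
have Dd := cspanB (@proj_cspan y) Dv; have pd := perpB (@proj_perp y) yv.
rewrite (le_trans (contractive_norm Dd pd))//.
rewrite (_ : proj D y - v + _ = 0) ?normr0 ?mulr0//.
by rewrite opprB [_ + (v - y)]addrC !subrKA subrr.
Qed.

Lemma proj_id y : cspan D y -> proj D y = y.
Proof. by move=> Dy; apply: proj_unique => //; rewrite subrr; exact: perp0. Qed.

Lemma proj_perp0 y : perp D y -> proj D y = 0.
Proof. by move=> Dy; apply: proj_unique; [exact: cspan0|rewrite subr0]. Qed.

Lemma proj_linear : linear (proj D).
Proof.
move=> a x y; apply: proj_unique.
  by apply: cspanD; [apply: cspanZ|]; exact: proj_cspan.
rewrite opprD addrACA -scalerBr; apply: perpD; last exact: proj_perp.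
by apply: perpZ; exact: proj_perp.
Qed.

Lemma proj_bound y : `|proj D y| <= 4 * (c + 1) * `|y|.
Proof.
have := contractive_norm (@proj_cspan y) (@proj_perp y).
by rewrite [proj D y + _]addrC subrK.
Qed.

Lemma proj_hull y : hull_pt y -> hull_pt (proj D y).
Proof.
move=> yG; apply: contractive_hull (@proj_cspan y) (@proj_perp y) _.
by rewrite [proj D y + _]addrC subrK.
Qed.

Lemma proj_lspan f y : lspan (normings D) f -> f (proj D y) = f y.
Proof.
move=> Nf; apply/eqP; rewrite eq_sym -subr_eq0 -linearB/=.
by rewrite (perp_lspan (@proj_perp y) Nf).
Qed.

Lemma dual_proj (f : dual Y) : exists g : dual Y, forall y, g y = f (proj D y).
Proof.
apply: (@dual_mk _ _ (fun y => f (proj D y)) (`|f| * (4 * (c + 1)))).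
  by move=> a x y; rewrite proj_linear linearP.
move=> y; rewrite (le_trans (dual_le _ _))// -mulrA ler_wpM2l//.
exact: proj_bound.
Qed.

End ProjTheory.

Lemma proj_absorb D D' y : stable D -> stable D' -> D `<=` D' ->
  proj D' (proj D y) = proj D y.
Proof.
move=> sD sD' DD'; apply: proj_id => //; apply: cspan_mono DD' _ _.
exact: proj_cspan.
Qed.

Definition totally_ordered_sets I (B : set I) (E : I -> set Y) :=
  forall i j, B i -> B j -> E i `<=` E j \/ E j `<=` E i.

Lemma chain_finite I (B : set I) (E : I -> set Y) (i0 : I) (s : seq Y) :
  B i0 -> totally_ordered_sets B E ->
  (forall x, x \in s -> exists2 i, B i & E i x) ->
  exists2 i, B i & forall x, x \in s -> E i x.
Proof.
move=> Bi0 tot; elim: s => [|x s IH] sE; first by exists i0.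
have [|i Bi iP] := IH; first by move=> y ys; apply: sE; rewrite inE ys orbT.
have [j Bj Ej] := sE x (mem_head _ _).
have [ij|ji] := tot _ _ Bi Bj.
  by exists j => // y /[!inE] /predU1P[->//|/iP]; exact: ij.
by exists i => // y /[!inE] /predU1P[->|/iP//]; exact: ji.
Qed.

Definition rcomb_dual_pts (l : seq (rat * (nat * seq (rat * Y)))) : seq Y :=
  flatten [seq [seq w.2 | w <- z.2.2] | z <- l].

Lemma rcomb_dual_ptsP D l :
  rcomb_dual_in D l <-> (forall x, x \in rcomb_dual_pts l -> D x).
Proof.
split=> [h x /flattenP[_ /mapP[z zl ->] /mapP[w wz ->]]|h z zl w wz].
  exact: h zl _ wz.
apply: h; apply/flattenP; exists [seq w.2 | w <- z.2.2]; first by apply/mapP; exists z.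
by apply/mapP; exists w.
Qed.

Lemma stable_chain I (B : set I) (E : I -> set Y) (i0 : I) :
  B i0 -> totally_ordered_sets B E -> (forall i, B i -> stable (E i)) ->
  stable (\bigcup_(i in B) E i).
Proof.
move=> Bi0 tot sE l /rcomb_dual_ptsP lE.
have [|i Bi iP] := chain_finite Bi0 tot (s := rcomb_dual_pts l).
  by move=> x /lE[i Bi Ei]; exists i.
by exists i => //; apply: sE => //; apply/rcomb_dual_ptsP.
Qed.

Lemma lspan_normings_chain I (B : set I) (E : I -> set Y) (i0 : I) f :
  B i0 -> totally_ordered_sets B E -> lspan (normings (\bigcup_(i in B) E i)) f ->
  exists2 i, B i & lspan (normings (E i)) f.
Proof.
move=> Bi0 tot [s sE <-]; elim: s sE => [|z s IH] sE.
  by exists i0 => //; rewrite big_nil; exact: lspan0.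
have [|i Bi iP] := IH; first by move=> w ws; apply: sE; rewrite inE ws orbT.
have [[m l] /= lE zE] : normings (\bigcup_(i in B) E i) z.2.
  by apply: sE; rewrite mem_head.
have [|j Bj jP] := chain_finite Bi0 tot (s := [seq w.2 | w <- l]).
  by move=> _ /mapP[w /lE[j Bj Ej] ->]; exists j.
have Nz : normings (E j) z.2.
  by exists (m, l) => // w wl; apply: jP; apply/mapP; exists w.
have [ij|ji] := tot _ _ Bi Bj.
  exists j => //; rewrite big_cons; apply: lspanD.
    by apply/lspanZ/lspan_sub.
  apply: lspan_min iP; [exact: lspan0|exact: lspanD|exact: lspanZ|].
  by move=> g /(normings_mono ij) Ng; exact: lspan_sub.
exists i => //; rewrite big_cons; apply: lspanD => //.
by apply/lspanZ/lspan_sub; exact: normings_mono ji _ Nz.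
Qed.

(** f composed with the projection onto the union vanishes on its perp, so it is polar-norm close to
    a combination h of normings. As h involves finitely many points, it comes from some E i, and
    projections onto larger stable D preserve its values; closeness in the polar norm is uniform
    over the hull. *)
Lemma proj_chain I (B : set I) (E : I -> set Y) (i0 : I) (f : dual Y) (e : R) :
  B i0 -> totally_ordered_sets B E -> (forall i, B i -> stable (E i)) -> 0 < e ->
  exists2 i, B i & forall D y, stable D -> E i `<=` D ->
    D `<=` \bigcup_(i in B) E i -> hull_pt y ->
    `|f (proj (\bigcup_(i in B) E i) y) - f (proj D y) : R| <= e.
Proof.
move=> Bi0 tot sE e0; set U := \bigcup_(i in B) E i.
have sU : stable U by exact: stable_chain Bi0 tot sE.
have [g gE] := dual_proj sU f.
have [|||h Nh gh] := polar_norm_approx G_compact G_bounded G0 (N := lspan (normings U))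
    (f := g) (divr_gt0 e0 (ltr0n _ 2)) (lspan0 _).
- exact: lspanD.
- exact: lspanZ.
- move=> y yU; rewrite gE proj_perp0 ?linear0// => k Uk.
  by apply: yU; exact: lspan_sub.
have [i Bi Nih] := lspan_normings_chain Bi0 tot Nh.
exists i => // D y sD iD DU yG.
have NDh : lspan (normings D) h.
  apply: lspan_min Nih; [exact: lspan0|exact: lspanD|exact: lspanZ|].
  by move=> k /(normings_mono iD) Nk; exact: lspan_sub.
have bnd x : hull_pt x -> `|(g - h) x : R| <= e / 2.
  by move=> xG; rewrite (le_trans (xG _))// ltW.
have -> : f (proj U y) - f (proj D y) = (g - h) y - (g - h) (proj D y).
  rewrite -[RHS]/(g y - h y - (g (proj D y) - h (proj D y))).
  rewrite (@proj_lspan D sD h y NDh) !gE (proj_absorb _ sD sU DU).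
  by rewrite opprB addrA subrK.
rewrite (le_trans (ler_normB _ _))// [leRHS]splitr lerD// bnd//.
exact: proj_hull.
Qed.

End Projections.

Lemma well_order_lt (T : eqType) : exists lt : T -> T -> Prop,
  [/\ forall x y z, lt x y -> lt y z -> lt x z,
      forall x y, [\/ lt x y, x = y | lt y x] &
      forall A : set T, A !=set0 -> exists2 z, A z & forall x, A x -> ~ lt x z].
Proof.
have [le wo] := wochoice.well_ordering_principle T.
have minP (A : set T) : A !=set0 -> exists2 z, A z & forall x, A x -> le z x.
  move=> [a Aa]; have [|z [[zA zle] _]] := wo [pred x | `[< A x >]].
    by exists a; rewrite inE.
  exists z; first by move: zA; rewrite inE.
  by move=> x Ax; apply: zle; rewrite inE.
have refl x : le x x.
  by have [|z -> h] := minP [set x]; [exists x|exact: h].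
have total x y : le x y \/ le y x.
  have [|z [] -> h] := minP [set z | z = x \/ z = y]; first by exists x; left.
    by left; apply: h; right.
  by right; apply: h; left.
have anti x y : le x y -> le y x -> x = y.
  move=> xy yx; have [|z [_ zu]] := wo [pred z | (z == x) || (z == y)].
    by exists x; rewrite inE eqxx.
  transitivity z; [symmetry|]; apply: zu; split; rewrite ?inE ?eqxx ?orbT// => t;
    by rewrite inE => /orP[/eqP ->|/eqP ->].
exists (fun x y => ~ le y x); split.
- move=> x y z yx zy zx.
  have [|m [->|->|->] h] := minP [set m | [\/ m = x, m = y | m = z]].
  + by exists x; constructor 1.
  + have xz : x = z by apply: anti => //; apply: h; constructor 3.
    by apply: zy; rewrite -xz; apply: h; constructor 2.
  + by apply: yx; apply: h; constructor 1.
  + by apply: zy; apply: h; constructor 2.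
- move=> x y; have [xy|xy] := pselect (le x y); have [yx|yx] := pselect (le y x).
  + by constructor 2; exact: anti.
  + by constructor 1.
  + by constructor 3.
  + by have [] := total x y.
- by move=> A /minP[z Az zle]; exists z => // x Ax /(_ (zle x Ax)).
Qed.

Section AmirLindenstrauss.
Context {R : realType} (Y : completeNormedModType R).
Variables (G : set Y) (c : R).
Hypothesis G_compact : weakly_compact G.
Hypothesis G_bounded : forall g, G g -> `|g| <= c.
Hypothesis G0 : G 0.
Hypothesis G_dense : cspan G = setT.

Local Notation stable := (stable G_bounded G0).
Local Notation proj := (proj G_bounded G0).
Local Notation attain := (attain G_bounded G0).
Local Notation rcomb_dual := (rcomb_dual G_bounded G0).
Local Notation hull_pt := (hull_pt G).

Let c0 : 0 <= c.
Proof. by have := G_bounded G0; rewrite normr0. Qed.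

Definition stable_hull (A : set Y) : set Y :=
  [set y | forall D, stable D -> A `<=` D -> D y].

Lemma stable_hull_stable A : stable (stable_hull A).
Proof.
by move=> l lA D sD AD; apply: (sD) => z zl w wz; exact: (lA z zl w wz) D sD AD.
Qed.

Lemma stable_hull_sub A : A `<=` stable_hull A.
Proof. by move=> y Ay D _; apply. Qed.

Lemma stable_hull_min A D : stable D -> A `<=` D -> stable_hull A `<=` D.
Proof. by move=> sD AD y; apply. Qed.

Lemma stable_hull_mono A B : A `<=` B -> stable_hull A `<=` stable_hull B.
Proof.
move=> AB; apply: stable_hull_min; first exact: stable_hull_stable.
by move=> y /AB; exact: stable_hull_sub.
Qed.

Lemma stable_G : stable G.
Proof. by move=> l _; exact: attainG. Qed.

Definition point_finite (S : set Y) := forall (f : dual Y) (d : R), 0 < d ->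
  finite_set (S `&` [set y | d <= `|f y : R|]).

Definition point_finitely_spanned (D : set Y) := exists S : set Y,
  [/\ S `<=` hull_pt, S `<=` cspan D, D `<=` cspan S & point_finite S].

(** The stable hull lies in a countable set, got from e by repeatedly adjoining [attain] of
    countably many codes. Dividing the k-th point by k + 1 makes every functional small off a finite
    set. *)
Lemma good_countable (A : set Y) (e : nat -> Y) : (forall n, G (e n)) ->
  A `<=` range e -> point_finitely_spanned (stable_hull A).
Proof.
move=> eG Ae.
pose code := seq (rat * (nat * seq (rat * nat))).
pose decode (u : nat -> Y) (l : code) : seq (rat * (nat * seq (rat * Y))) :=
  [seq (z.1, (z.2.1, [seq (w.1, u w.2) | w <- z.2.2])) | z <- l].
pose next (u : nat -> Y) k : Y := match unpickle k : option (nat + code) with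
  | Some (inl j) => u j
  | Some (inr l) => attain (rcomb_dual (decode u l))
  | None => u 0%N
  end.
pose E n := iter n next e.
have EG n k : G (E n k).
  elim: n k => //= n IH k; rewrite /next.
  by case: unpickle => [[j|l]|//]; [exact: IH|exact: attainG].
have Emono n : range (E n) `<=` range (E n.+1).
  move=> _ [k _ <-]; exists (pickle (inl k : nat + code)) => //=.
  by rewrite /next pickleK.
have Emono' n m : (n <= m)%N -> range (E n) `<=` range (E m).
  elim: m => [|m IH]; first by rewrite leqn0 => /eqP ->.
  rewrite leq_eqVlt => /predU1P[->//|/IH h]; exact: subset_trans h (Emono m).
pose D := \bigcup_n range (E n).
have tot : totally_ordered_sets setT (fun n => range (E n)).
  by move=> n m _ _; case/orP: (leq_total n m) => /Emono'; [left|right].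
have sD : stable D.
  move=> l /rcomb_dual_ptsP lD.
  have [|n _ nP] := chain_finite (s := rcomb_dual_pts l) (I : setT 0%N) tot.
    by move=> x /lD[n _ h]; exists n.
  have /choice[g gP] : forall y, exists k, range (E n) y -> E n k = y.
    move=> y; have [[k _ ky]|ny] := pselect (range (E n) y); first by exists k.
    by exists 0%N => /ny.
  exists n.+1 => //.
  pose l' : code := [seq (z.1, (z.2.1, [seq (w.1, g w.2) | w <- z.2.2])) | z <- l].
  exists (pickle (inr l' : nat + code)) => //=; rewrite /next pickleK.
  congr (attain (rcomb_dual _)); rewrite /decode /l' -map_comp.
  rewrite -[RHS]map_id; apply/eq_in_map => -[r [m s]] zl /=.
  congr (_, (_, _)); rewrite -map_comp -[RHS]map_id; apply/eq_in_map => -[t y] wz /=.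
  congr pair; apply: gP; apply: nP; apply/flattenP; exists [seq w.2 | w <- s].
    by apply/mapP; exists (r, (m, s)).
  by apply/mapP; exists (t, y).
have AD : stable_hull A `<=` D.
  by apply: stable_hull_min => // y /Ae h; exists 0%N.
pose u k := if unpickle k : option (nat * nat) is Some nj then E nj.1 nj.2 else 0.
have uG k : G (u k) by rewrite /u; case: unpickle.
have uD y : stable_hull A y -> exists k, u k = y.
  by move=> /AD[n _ [j _ <-]]; exists (pickle (n, j)); rewrite /u pickleK.
exists [set (k.+1%:R^-1 : R) *: u k | k in [set k | stable_hull A (u k)]]; split.
- move=> _ [k _ <-]; apply: (hull_ptZ G_bounded G0); last exact: (hull_ptG G_bounded G0 (uG k)).
  by rewrite gtr0_norm ?invr_gt0 ?ltr0n// invf_le1 ?ltr0n ?ler1n.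
- by move=> _ [k Ak <-]; apply: cspanZ; exact: cspan_sub.
- move=> y Ay; have [k uk] := uD y Ay; rewrite -uk.
  have -> : u k = k.+1%:R *: ((k.+1%:R^-1 : R) *: u k).
    by rewrite scalerA mulfV ?scale1r// pnatr_eq0.
  by apply/cspanZ/cspan_sub; exists k => //=; rewrite uk.
- move=> f d d0; pose N := (Num.truncn (`|f| * c / d)).+1.
  apply: (@sub_finite_set _ _ [set (k.+1%:R^-1 : R) *: u k | k in `I_N]).
    move=> _ [[k _ <-] /= dk]; exists k => //=; rewrite ltnNge; apply/negP => Nk.
    move: dk; rewrite leNgt => /negP; apply.
    rewrite linearZ/= normrM gtr0_norm ?invr_gt0// ltr_pdivrMl//.
    rewrite (le_lt_trans (dual_le _ _))//.
    rewrite (le_lt_trans (ler_wpM2l _ (G_bounded (uG k))))//.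
    rewrite -ltr_pdivrMr// (lt_le_trans (truncnS_gt _))//.
    by rewrite ler_nat -/N (leq_trans Nk).
  by apply: finite_image; exact: finite_II.
Qed.

Variable lt : Y -> Y -> Prop.
Hypothesis lt_trans' : forall x y z, lt x y -> lt y z -> lt x z.
Hypothesis lt_total : forall x y, [\/ lt x y, x = y | lt y x].
Hypothesis lt_min : forall A : set Y, A !=set0 ->
  exists2 z, A z & forall x, A x -> ~ lt x z.

Lemma lt_wf_ind (Q : Y -> Prop) :
  (forall x, (forall y, lt y x -> Q y) -> Q x) -> forall x, Q x.
Proof.
move=> Qlt x; apply: contrapT => nQ.
have [|z nz zmin] := @lt_min (fun x => ~ Q x); first by exists x.
by apply: nz; apply: Qlt => y yz; apply: contrapT => nQy; exact: zmin y nQy yz.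
Qed.

Definition below (j : Y) : set Y := [set k | lt k j].

Definition downward (J : set Y) := forall j k, J j -> lt k j -> J k.

(* Each index carries a sequence of points, so that an additional index can be
   absorbed into a smaller one and no cardinal arithmetic is needed. *)
Definition blocks (a : Y -> nat -> Y) (J : set Y) : set Y := \bigcup_(k in J) range (a k).

Lemma blocks_mono a J J' : J `<=` J' -> blocks a J `<=` blocks a J'.
Proof. by move=> JJ' y [k Jk ky]; exists k => //; exact: JJ'. Qed.

Section Step.
Variables (a : Y -> nat -> Y) (J : set Y).
Hypothesis aG : forall k n, G (a k n).
Hypothesis J_down : downward J.
Hypothesis below_good : forall j, J j ->
  forall b, (forall k n, G (b k n)) -> point_finitely_spanned (stable_hull (blocks b (below j))).

Let D j := stable_hull (blocks a (below j)).
Let D' j := stable_hull (blocks a [set k | lt k j \/ k = j]).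

Let sD j : stable (D j). Proof. exact: stable_hull_stable. Qed.
Let sD' j : stable (D' j). Proof. exact: stable_hull_stable. Qed.

Let DD' j : D j `<=` D' j.
Proof. by apply: stable_hull_mono; apply: blocks_mono => k kj; left. Qed.

Let D'D i j : lt i j -> D' i `<=` D j.
Proof.
move=> ij; apply: stable_hull_mono; apply: blocks_mono => k [ki|->//].
exact: lt_trans' ki ij.
Qed.

Let chain (B : set Y) : totally_ordered_sets B D'.
Proof.
move=> i j _ _; have [ij|->|ji] := lt_total i j.
- by left; exact: subset_trans (D'D ij) (@DD' _).
- by left.
- by right; exact: subset_trans (D'D ji) (@DD' _).
Qed.

Let hull_blocks (B : set Y) i0 : B i0 -> downward B ->
  stable_hull (blocks a B) = \bigcup_(j in B) D' j.
Proof.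
move=> Bi0 Bd; apply/seteqP; split.
  apply: stable_hull_min; first by apply: stable_chain Bi0 (@chain B) _ => i _; exact: sD'.
  move=> y [k Bk ky]; exists k => //; apply: stable_hull_sub.
  by exists k => //; right.
move=> y [j Bj]; apply: stable_hull_mono; apply: blocks_mono => k [kj|->//].
exact: Bd kj.
Qed.

(** If some k0 lies below j, interleaving the rows a j and a k0 in odd and even places rewrites D' j
    as a hull of rows strictly below j, where [below_good] applies. At the least j there is a single
    countable row. *)
Let good_D' j : J j -> point_finitely_spanned (D' j).
Proof.
move=> Jj; have [[k0 k0j]|nk] := pselect (exists k, lt k j).
  pose b k n := if pselect (k = k0) is left _ then
    (if odd n then a j n./2 else a k0 n./2) else a k n.
  have bG k n : G (b k n) by rewrite /b; case: pselect => // _; case: ifP.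
  have := below_good Jj bG; rewrite /D'; congr (point_finitely_spanned (stable_hull _)).
  apply/seteqP; split=> y [k].
    rewrite /below/= => kj [n _]; rewrite /b; case: pselect => [kk0|_] <-.
      by case: ifP => _; [exists j; [right|exists n./2]|exists k0; [left|exists n./2]].
    by exists k; [left|exists n].
  move=> [kj|->] [n _ <-].
    have [->|kk0] := pselect (k = k0).
      exists k0 => //; exists n.*2 => //; rewrite /b; case: pselect => // _.
      by rewrite odd_double doubleK.
    by exists k => //; exists n => //; rewrite /b; case: pselect.
  exists k0 => //; exists n.*2.+1 => //; rewrite /b; case: pselect => // _.
  by rewrite /= odd_double /= uphalf_double.
apply: (@good_countable _ (a j)) => // y [k [kj|-> //]].
by exfalso; apply: nk; exists k.
Qed.

(** The factor 1/2 makes Q j map the hull into itself. *)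
Let Q j (y : Y) := (2^-1 : R) *: (proj (D' j) y - proj (D j) y).

Let Q_linear j : linear (Q j).
Proof.
move=> r x y; rewrite /Q (proj_linear G_compact G_dense (@sD j)).
rewrite (proj_linear G_compact G_dense (@sD' j)).
by rewrite opprD addrACA -scalerBr scalerDr !scalerA mulrC.
Qed.

Let Q_bound j y : `|Q j y| <= 4 * (c + 1) * `|y|.
Proof.
rewrite normrZ gtr0_norm ?invr_gt0// ler_pdivrMl//.
rewrite (le_trans (ler_normB _ _))//.
have := proj_bound G_compact G_dense (@sD j) y.
have := proj_bound G_compact G_dense (@sD' j) y.
lra.
Qed.

Let dual_Q j (f : dual Y) : exists g : dual Y, forall y, g y = f (Q j y).
Proof.
apply: (@dual_mk _ _ (fun y => f (Q j y)) (`|f| * (4 * (c + 1)))).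
  by move=> r x y; rewrite Q_linear linearP.
by move=> y; rewrite (le_trans (dual_le _ _))// -mulrA ler_wpM2l.
Qed.

Let Q_cspan j (S : set Y) y : cspan S y -> cspan (Q j @` S) (Q j y).
Proof.
exact: cspan_image (@Q_linear j) (@Q_bound j).
Qed.

(** If B meets a set J' of indices, [proj_chain] gives i in both such that for later k in both |f (Q
    k y)| is at most d / 2 on the hull, which contradicts k in B. So finiteness spreads from initial
    segments by well-founded induction, and finally to J. *)
Let finite_below (f : dual Y) (d : R) : 0 < d -> finite_set
  (J `&` [set j | exists2 y, hull_pt y & d <= `|f (Q j y) : R|]).
Proof.
move=> d0; set B := [set j | _].
have step (J' : set Y) : (forall j, J' j -> finite_set (B `&` below j)) ->
    finite_set (B `&` J').
  move=> fin; have [[i0 Bi0]|nB] := pselect (B `&` J' !=set0); last first.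
    by rewrite (_ : B `&` J' = set0)//; apply/seteqP; split=> // x Bx; apply: nB; exists x.
  have [i [Bi Ji] iP] := proj_chain G_compact G_dense f Bi0 (@chain (B `&` J'))
    (fun i _ => @sD' i) (divr_gt0 d0 (ltr0n _ 2)).
  apply: (@sub_finite_set _ _ ((B `&` below i) `|` [set i])).
    move=> k [Bk Jk]; have [ki|->|ik] := lt_total k i; [by left|by right|].
    exfalso; have [y yG] := Bk; rewrite leNgt => /negP; apply.
    have iDk : D' i `<=` D k by exact: D'D.
    have DU : D' k `<=` \bigcup_(j in B `&` J') D' j by move=> x kx; exists k.
    have h1 := iP (D k) y (@sD k) iDk (subset_trans (@DD' k) DU) yG.
    have h2 := iP (D' k) y (@sD' k) (subset_trans iDk (@DD' k)) DU yG.
    rewrite /Q linearZ linearB/= normrM gtr0_norm ?invr_gt0// ltr_pdivrMl//.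
    set P := f (proj (\bigcup_(_ in _) _) y) in h1 h2.
    have -> : f (proj (D' k) y) - f (proj (D k) y) =
      (P - f (proj (D k) y)) - (P - f (proj (D' k) y)).
      by rewrite opprB [RHS]addrC addrA subrK.
    rewrite (le_lt_trans (ler_normB _ _))//; lra.
  by rewrite finite_setU; split; [exact: fin|exact: finite_set1].
rewrite setIC; apply: (step) => j _; move: j; apply: lt_wf_ind => j IH.
exact: step.
Qed.

(** Each layer D' j contributes Q j (S j). These span because y in D' j equals proj (D j) y + 2 Q j
    y and D j is reached by induction, with S0 as the start. They are point-finite because f is
    large on finitely many layers only, and f composed with Q j is again a functional. *)
Lemma good_step : point_finitely_spanned (stable_hull (blocks a J)).
Proof.
have a0G n : G (a 0 n) by [].
have hull0 : point_finitely_spanned (stable_hull set0) by apply: (good_countable a0G) => y [].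
have [[i0 Ji0]|nJ] := pselect (J !=set0); last first.
  rewrite (_ : blocks a J = set0)//; apply/seteqP; split=> // y [k Jk _].
  by apply: nJ; exists k.
have /choice[S SP] : forall j, exists S : set Y, J j ->
    [/\ S `<=` hull_pt, S `<=` cspan (D' j), D' j `<=` cspan S & point_finite S].
  move=> j; have [Jj|nJj] := pselect (J j); last by exists set0.
  by have [S SP] := good_D' Jj; exists S.
have [S0 [S0G S0D DS0 S0f]] := hull0.
pose S1 := S0 `|` \bigcup_(j in J) (Q j @` S j).
have hullE := hull_blocks Ji0 J_down.
have DJ j : J j -> D j `<=` stable_hull (blocks a J).
  by move=> Jj; apply: stable_hull_mono; apply: blocks_mono => k; exact: J_down.
have D'J j : J j -> D' j `<=` stable_hull (blocks a J).
  by move=> Jj; rewrite hullE => y jy; exists j.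
exists S1; split.
- move=> y [/S0G//|[j Jj [x Sx <-]]]; have [SG _ _ _] := SP j Jj.
  apply: hull_pt_mid; apply: proj_hull => //; exact: SG.
- move=> y [/S0D h|[j Jj [x Sx <-]]].
    by apply: cspan_mono h; apply: stable_hull_mono.
  apply: cspanZ; apply: cspanB.
    by apply: cspan_mono (D'J j Jj) _ _; exact: proj_cspan.
  by apply: cspan_mono (DJ j Jj) _ _; exact: proj_cspan.
- rewrite hullE => y [j Jj jy]; move: j Jj y jy.
  apply: (@lt_wf_ind (fun j => J j -> forall y, D' j y -> cspan S1 y)) => j IH Jj y jy.
  have DjS : D j `<=` cspan S1.
    have [[k kj]|nk] := pselect (exists k, lt k j).
      rewrite /D (@hull_blocks _ k)//; last first.
        by move=> i l ij li; exact: lt_trans' li ij.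
      by move=> x [i ij ix]; apply: IH ix => //; exact: J_down Jj ij.
    rewrite /D (_ : blocks a (below j) = set0); last first.
      by apply/seteqP; split=> // x [k kj _]; apply: nk; exists k.
    move=> x /DS0; apply: cspan_mono => z Sz; by left.
  have -> : y = proj (D j) y + (2 : R) *: Q j y.
    rewrite /Q scalerA mulfV// scale1r addrC subrK.
    by rewrite (proj_id G_compact G_dense (@sD' j))//; exact: cspan_sub.
  have [_ _ DS _] := SP j Jj.
  apply: cspanD; first by apply: cspan_min DjS _ _; exact: proj_cspan.
  have h := @Q_cspan j (S j) y (DS y jy).
  apply: cspanZ; apply: (@cspan_mono _ _ (Q j @` S j)) h => x Qx.
  by right; exists j.
- move=> f d d0; pose B := J `&` [set j | exists2 y, hull_pt y & d <= `|f (Q j y) : R|].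
  have finB : finite_set B by exact: finite_below.
  apply: (@sub_finite_set _ _ ((S0 `&` [set y | d <= `|f y : R|]) `|`
      \bigcup_(j in B) (Q j @` (S j `&` [set y | d <= `|f (Q j y) : R|])))).
    move=> y [[S0y|[j Jj [x Sx <-]]] /= dy]; first by left.
    have [SG _ _ _] := SP j Jj.
    by right; exists j; [split=> //; exists x => //; exact: SG|exists x].
  rewrite finite_setU; split; first exact: S0f.
  apply: bigcup_finite => // j [Jj _]; apply: finite_image.
  have [_ _ _ Sf] := SP j Jj; have [g gE] := dual_Q j f.
  by have := Sf g d d0; under eq_set do rewrite gE.
Qed.

End Step.

(** With constant rows, and 0 for indices outside [G], the blocks over all of Y form [G], which is
    stable because [attain] takes its values there. *)
Lemma good_G : point_finitely_spanned G.
Proof.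
pose a (k : Y) (n : nat) : Y := if pselect (G k) is left _ then k else 0.
have aG k n : G (a k n) by rewrite /a; case: pselect.
have main j : forall b, (forall k n, G (b k n)) -> point_finitely_spanned (stable_hull (blocks b (below j))).
  move: j; apply: lt_wf_ind => j IH b bG; apply: good_step => //.
  by move=> i k ij ki; exact: lt_trans' ki ij.
have := @good_step a setT aG (fun _ _ _ _ => I) (fun j _ => main j).
congr point_finitely_spanned; apply/seteqP; split.
  by apply: stable_hull_min; [exact: stable_G|move=> _ [k _ [n _ <-]]].
move=> g Gg; apply: stable_hull_sub; exists g => //; exists 0%N => //.
by rewrite /a; case: pselect.
Qed.

End AmirLindenstrauss.

Theorem amir_lindenstrauss (R : realType) (Y : completeNormedModType R) : WCG Y ->
  exists S : set Y, [/\ (forall y, S y -> `|y| <= 1), cspan S = setT &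
    forall (f : dual Y) (d : R), 0 < d -> finite_set (S `&` [set y | d <= `|f y : R|])].
Proof.
move=> [G' G'c G'd].
have [G [Gc Gb G0 Gd]] := WCG_bounded G'c G'd.
have [lt [ltt lttot ltmin]] := well_order_lt Y.
have [S [SG _ GS Sf]] := good_G Gc Gb G0 Gd ltt lttot ltmin.
exists S; split=> //; first by move=> y /SG; exact: hull_pt_norm.
apply/seteqP; split=> // y _; have : cspan G y by rewrite Gd.
exact: cspan_min.
Qed.

(** * Dunford-Pettis estimates in the tensor product *)

Section ElementaryTensors.
Context {R : realType} (X Y : normedModType R).

Definition tens (x : X) (y : Y) : X \ptensor Y := to_completion _ (elem_tensor x y).

Lemma tens_linearl y : linear (tens^~ y).
Proof.
move=> a u v; rewrite /tens -linearP; congr to_completion.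
by apply/val_inj/funext => B; exact: linearPl.
Qed.

Lemma tens_linearr x : linear (tens x).
Proof.
move=> a u v; rewrite /tens -linearP; congr to_completion.
by apply/val_inj/funext => B; exact: linearPr.
Qed.

Lemma tens_norm x y : `|tens x y| <= `|x| * `|y|.
Proof.
rewrite norm_to_completion /=.
by have := @Defs.proj_norm_le _ X Y (elem_tensor x y) [:: (x, y)]; rewrite !big_seq1; apply.
Qed.

Lemma tens_dense (S : set Y) : cspan S = setT ->
  cspan [set tens z.1 z.2 | z in [set z : X * Y | S z.2]] = setT.
Proof.
move=> Sd; apply/seteqP; split=> // z _; set E := [set _ | _ in _].
have tE x y : cspan E (tens x y).
  have : cspan S y by rewrite Sd.
  move=> /(cspan_image (@tens_linearr x) (@tens_norm x)); apply: cspan_mono.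
  by move=> _ [s Ss <-]; exists (x, s).
apply: cspan_closed; apply/closureP => e e0.
have : closure (range (to_completion (proj_seminorm X Y))) z by rewrite to_completion_dense.
move=> /closureP/(_ e e0)[_ [u _ <-] zu]; exists (to_completion _ u) => //.
have [s ->] := tensor_rep u; rewrite linear_sum/=.
elim: s => [|w s IH]; first by rewrite big_nil; exact: cspan0.
by rewrite big_cons; apply: cspanD; [exact: tE|exact: IH].
Qed.

End ElementaryTensors.

Lemma limn_esup_ge (R : realType) (u : nat -> \bar R) (d M : R) :
  (forall n, (d%:E <= u n)%E) -> (limn_esup u <= M%:E)%E -> d <= M.
Proof.
move=> du; rewrite -lee_fin; apply: le_trans; rewrite limn_esup_lim.
apply: lime_ge; first exact: is_cvg_esups.
apply: nearW => n; apply: (le_trans (du n)).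
by apply: ereal_sup_ubound; exists n => /=.
Qed.

Lemma infinite_seq (T : pointedType) (A : set T) : infinite_set A ->
  exists u : nat -> T, injective u /\ forall n, A (u n).
Proof.
move=> /infiniteP/pcard_leP[u]; exists u; split; last by move=> n; exact: funS.
by move=> m n; apply: (@inj _ _ setT u); rewrite inE.
Qed.

Lemma point_finite_weakly_null (R : realType) (Y : normedModType R) (S : set Y)
    (u : nat -> Y) :
  (forall (f : dual Y) (d : R), 0 < d -> finite_set (S `&` [set y | d <= `|f y : R|])) ->
  injective u -> (forall n, S (u n)) -> weakly_null u.
Proof.
move=> Sf ui uS; apply/weakly_nullP => f; apply/cvgrPdist_lt => e e0.
have : finite_set (u @^-1` (S `&` [set y | e <= `|f y : R|])).
  by apply: finite_preimage (Sf f e e0) => m n _ _; exact: ui.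
move=> /finite_seqP[s sE]; exists (\max_(i <- s) i).+1 => // n /= Nn.
rewrite sub0r normrN ltNge; apply/negP => en.
have : [set` s] n by rewrite -sE; split.
by move=> /= ns; move: Nn; rewrite ltnNge leq_bigmax_seq.
Qed.

Section DunfordPettis.
Context {R : realType} (X W : normedModType R) (T : X -> W) (a : R).
Hypothesis T_linear : linear T.
Hypothesis a0 : 0 < a.
Hypothesis Ta : forall x, a * `|x| <= `|T x|.

(** By duality, distance at most e from the range of T, in a form that visibly passes to weak
    limits. *)
Definition near_range (e : R) (w : W) :=
  forall f : dual W, (forall x, f (T x) = 0) -> `|f w : R| <= e * `|f|.

Lemma near_rangeP e w : 0 < e -> near_range e w -> exists x, `|w - T x| <= 2 * e.
Proof.
move=> e0 ew.
have [|||||_ [x _ <-] h] := @dual_dist _ _ (range T) w e _ _ _ (ltW e0) _ (2 * e).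
- by exists 0 => //; exact: linear_fun0.
- move=> _ _ [x _ <-] [y _ <-]; exists (x + y) => //.
  by rewrite (linear_funD T_linear).
- move=> r _ [x _ <-]; exists (r *: x) => //.
  by rewrite (linear_funZ T_linear).
- by move=> f fT; apply: ew => x; apply: fT; exists x.
- by rewrite ltr_pMl// ltr1n.
- by exists x.
Qed.

Lemma near_range_dist e w x : `|w - T x| <= e -> near_range e w.
Proof.
move=> wx f fT; have -> : f w = f (w - T x) by rewrite linearB/= fT subr0.
by rewrite (le_trans (dual_le _ _))// mulrC ler_wpM2r.
Qed.

(** A weak-star limit z2 of S (x n) is compared with a weak limit w0 of w n. Tested by h, with h
    composed with S extended to W at the cost 1 / a, the passage from z2 to w0 costs r and that from
    w0 to some T x0 costs 2 r. S is the identity in one Dunford-Pettis case and x |-> b (x, -) in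
    the other. *)
Lemma wk_image_le (V : normedModType R) (S : X -> V) (K : set W) (x : nat -> X)
    (w : nat -> W) (r : R) :
  linear S -> (forall z, `|S z| <= `|z|) -> weakly_compact K -> (forall n, K (w n)) ->
  0 < r -> (forall n, `|w n - T (x n)| <= r) ->
  (wk (range (S \o x)) <= (3 * r / a)%:E)%E.
Proof.
move=> lS S1 Kc wK r0 wx; apply: wk_le => F UF FS z2 Fz2.
have [U [UU _ UF']] := ultra_lift UF FS.
have {}Fz2 (h : dual V) : (h (S (x n)) : R) @[n --> U] --> (z2 h : R).
  by have := Fz2 h; rewrite -UF'.
have [|w0 Kw0 w0P] := (weakly_compactP K).1 Kc _ (fmap_ultra w UU).
  have : U (w @^-1` K) by apply: filterS filterT => n _; exact: wK.
  exact.
have {}w0P (f : dual W) : (f (w n) : R) @[n --> U] --> (f w0 : R) by exact: w0P.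
have dist (f : dual W) n : `|f (T (x n)) - f (w n) : R| <= `|f| * r.
  rewrite -linearB/= (le_trans (dual_le _ _))// distrC ler_wpM2l//.
have w0r : near_range r w0.
  move=> f fT; apply: cvg_norm_le (w0P f) _.
  apply: filterS filterT => n _; have := dist f n.
  by rewrite fT sub0r normrN mulrC.
have [x0 x0P] := near_rangeP r0 w0r.
exists (S x0); apply: dual_norm_bound; first by rewrite divr_ge0 ?mulr_ge0 ?(ltW r0) ?(ltW a0).
move=> h; rewrite mulrC.
have [hS hSE] : exists g : dual X, forall z, g z = h (S z).
  apply: (@dual_mk _ _ (fun z => h (S z)) `|h|).
    by move=> b u v; rewrite lS linearP.
  by move=> z; rewrite (le_trans (dual_le _ _))// ler_wpM2l.
have hS1 : `|hS| <= `|h|.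
  apply: dual_norm_bound => // z; rewrite hSE (le_trans (dual_le _ _))//.
  by rewrite ler_wpM2l.
have [f [f1 fE]] := dual_extend hS T_linear a0 Ta.
have fb : `|f| <= `|h| / a by rewrite (le_trans f1)// ler_wpM2r// invr_ge0 ltW.
have lim : (f (T (x n)) - f (w n) : R) @[n --> U] --> (z2 h - f w0 : R).
  apply: cvgB (w0P f); under eq_cvg do rewrite fE hSE; exact: Fz2.
have l1 : `|z2 h - f w0 : R| <= `|f| * r.
  by apply: cvg_norm_le lim _; apply: filterS filterT => n _; exact: dist.
have -> : (z2 - ev (S x0)) h = (z2 h - f w0) + (f w0 - f (T x0)).
  by rewrite fE hSE addrA subrK.
rewrite (le_trans (ler_normD _ _))//.
have l2 : `|f w0 - f (T x0) : R| <= `|f| * (2 * r).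
  by rewrite -linearB/= (le_trans (dual_le _ _))// ler_wpM2l.
rewrite (le_trans (lerD l1 l2))// -mulrDr.
rewrite (le_trans (ler_wpM2r _ fb))//; first by rewrite addr_ge0 ?mulr_ge0 ?(ltW r0).
by rewrite le_eqVlt; apply/orP; left; apply/eqP; field; rewrite gt_eqF.
Qed.

End DunfordPettis.

Section PointFiniteTensor.
Context {R : realType} (X Y W : completeNormedModType R) (T : X -> W) (a : R).
Hypothesis T_linear : linear T.
Hypothesis a0 : 0 < a.
Hypothesis Ta : forall x, a * `|x| <= `|T x|.
Variable S : set Y.
Hypothesis S1 : forall y, S y -> `|y| <= 1.
Hypothesis S_point_finite : forall (f : dual Y) (d : R), 0 < d ->
  finite_set (S `&` [set y | d <= `|f y : R|]).

(* lam y extends x |-> b (x (x) y) along T, with no linearity in y *)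
Definition extension_pair (b : dual (X \ptensor Y)) (lam : Y -> dual W) :=
  [/\ `|b| <= 1, forall y, `|lam y| <= `|y| / a &
      forall x y, lam y (T x) = b (tens x y)].

Lemma dual_tensl (b : dual (X \ptensor Y)) (y : Y) : exists g : dual X,
  `|g| <= `|b| * `|y| /\ forall x, g x = b (tens x y).
Proof.
have bnd x : `|b (tens x y) : R| <= `|b| * `|y| * `|x|.
  by rewrite (le_trans (dual_le _ _))// -mulrA ler_wpM2l// mulrC tens_norm.
have [g gE] : exists g : dual X, forall x, g x = b (tens x y).
  apply: dual_mk bnd => r u v.
  by rewrite (@tens_linearl _ _ _ y r u v) linearP.
exists g; split=> //; apply: dual_norm_bound; first by rewrite mulr_ge0.
by move=> x; rewrite gE.
Qed.

Lemma dual_tensr (b : dual (X \ptensor Y)) (x : X) : exists g : dual Y,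
  `|g| <= `|b| * `|x| /\ forall y, g y = b (tens x y).
Proof.
have bnd y : `|b (tens x y) : R| <= `|b| * `|x| * `|y|.
  by rewrite (le_trans (dual_le _ _))// -mulrA ler_wpM2l// tens_norm.
have [g gE] : exists g : dual Y, forall y, g y = b (tens x y).
  apply: dual_mk bnd => r u v.
  by rewrite (@tens_linearr _ _ _ x r u v) linearP.
exists g; split=> //; apply: dual_norm_bound; first by rewrite mulr_ge0.
by move=> y; rewrite gE.
Qed.

Lemma bounded_range (V : normedModType R) (u : nat -> V) (M : R) :
  (forall n, `|u n| <= M) -> bounded_set (range u).
Proof.
move=> uM; exists M; split; first exact: num_real.
by move=> M' MM' _ [n _ <-]; rewrite /= (le_trans (uM n))// ltW.
Qed.

(** In the first case the functionals b (-, y n) are weakly null, as images of y n under a bounded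
    operator; in the second y n is paired with the functionals b (x n, -). In both, [wk_image_le]
    bounds the right-hand side. *)
Lemma quantitative_DP_tens : dual_quantitative_DP X \/ direct_quantitative_DP Y ->
  exists2 C : R, 0 < C & forall (b : dual (X \ptensor Y)) (x : nat -> X) (y : nat -> Y)
    (K : set W) (w : nat -> W) (r M d : R),
    `|b| <= 1 -> weakly_null y -> (forall n, `|y n| <= 1) -> (forall n, `|x n| <= M) ->
    weakly_compact K -> (forall n, K (w n)) -> 0 < r ->
    (forall n, `|w n - T (x n)| <= r) ->
    (forall n, d <= `|b (tens (x n) (y n)) : R|) -> d <= C * (3 * r / a).
Proof.
case=> -[C C0 CP]; exists C => // b x y K w r M d b1 y0 y1 xM Kc Kw r0 wx bd.
- have /choice[g gP] := dual_tensl b.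
  have := CP x (fun n => g (y n)) (bounded_range xM).
  have g1 n : `|g (y n)| <= 1.
    by rewrite (le_trans (gP (y n)).1)// mulr_ile1.
  have gnull : weakly_null (fun n => g (y n)).
    apply/weakly_nullP => xi.
    have [h hE] : exists h : dual Y, forall z, h z = xi (g z).
      apply: (@dual_mk _ _ (fun z => xi (g z)) `|xi|).
        move=> t u v; rewrite -linearP; congr (xi _); apply/val_inj/funext => z.
        rewrite [LHS](gP _).2 (@tens_linearr _ _ _ z t u v) linearP.
        by rewrite -[RHS]/(t * g u z + g v z) !(gP _).2.
      move=> z; rewrite (le_trans (dual_le _ _))// ler_wpM2l//.
      by rewrite (le_trans (gP z).1)// ler_piMl.
    by have := (weakly_nullP y).1 y0 h; under eq_cvg do rewrite hE.
  move=> /(_ g1 gnull) lim.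
  have wkx : (wk (range x) <= (3 * r / a)%:E)%E.
    by apply: (@wk_image_le _ X W T a T_linear a0 Ta X id K x w r).
  have C0' : (0 <= C%:E)%E by rewrite lee_fin ltW.
  have := le_trans lim (lee_wpmul2l C0' wkx); rewrite -EFinM.
  apply: limn_esup_ge => n; rewrite lee_fin (gP _).2.
  exact: bd.
- have /choice[g gP] := dual_tensr b.
  have := CP y (fun n => g (x n)) y1 y0.
  have M0 : 0 <= M by rewrite (le_trans (normr_ge0 _) (xM 0%N)).
  have gM n : `|g (x n)| <= M.
    rewrite (le_trans (gP (x n)).1)//.
    by rewrite -[leRHS]mul1r ler_pM.
  move=> /(_ (bounded_range gM)) lim.
  have gl : linear g.
    move=> t u v; apply/val_inj/funext => z.
    rewrite [LHS](gP _).2 (@tens_linearl _ _ _ z t u v) linearP.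
    by rewrite -[RHS]/(t * g u z + g v z) !(gP _).2.
  have wkx : (wk (range (g \o x)) <= (3 * r / a)%:E)%E.
    apply: (@wk_image_le _ X W T a T_linear a0 Ta (dual Y) g K x w r) => //.
    by move=> z; rewrite (le_trans (gP z).1)// ler_piMl.
  have C0' : (0 <= C%:E)%E by rewrite lee_fin ltW.
  have := le_trans lim (lee_wpmul2l C0' wkx); rewrite -EFinM.
  apply: limn_esup_ge => n; rewrite lee_fin (gP _).2.
  exact: bd.
Qed.

Lemma finite_large_extension : dual_quantitative_DP X \/ direct_quantitative_DP Y ->
  exists2 C : R, 0 < C & forall b lam (K : set W) (M e : R), extension_pair b lam ->
    weakly_compact K -> (forall w, K w -> `|w| <= M) -> 0 < e ->
    finite_set (S `&` [set y | exists w, [/\ K w, near_range T e w &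
                                         C * e < `|lam y w : R|]]).
Proof.
(* Here 6 C / a is the Dunford-Pettis bound at r = 2 e, 2 / a pays for replacing w by T x, and the
   final 1 produces the contradiction. *)
move=> /quantitative_DP_tens[C C0 CP]; exists ((6 * C + 2) / a + 1).
  by rewrite addr_gt0// divr_gt0// addr_gt0// mulr_gt0.
move=> b lam K M e [b1 lama lamT] Kc KM e0; apply: contrapT => /infinite_seq[u [ui uS]].
have /choice[w wP] : forall n, exists w, [/\ K w, near_range T e w &
    ((6 * C + 2) / a + 1) * e < `|lam (u n) w : R|].
  by move=> n; have [_ [w]] := uS n; exists w.
have /choice[x xP] : forall n, exists x, `|w n - T x| <= 2 * e.
  by move=> n; have [_ ew _] := wP n; exact: near_rangeP.
have Su n : S (u n) by have [] := uS n.
have Kw n : K (w n) by have [] := wP n.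
have xM n : `|x n| <= (M + 2 * e) / a.
  rewrite ler_pdivlMr// mulrC (le_trans (Ta _))//.
  have -> : T (x n) = w n - (w n - T (x n)) by rewrite opprB addrC subrK.
  by rewrite (le_trans (ler_normB _ _))// lerD// KM.
have bd n : ((6 * C) / a + 1) * e <= `|b (tens (x n) (u n)) : R|.
  have [_ _ h] := wP n; rewrite -lamT.
  have l2 : `|lam (u n) (w n - T (x n)) : R| <= 2 * e / a.
    rewrite (le_trans (dual_le _ _))// (le_trans (ler_pM _ _ (lama _) (xP n)))//.
    rewrite mulrAC ler_pdivrMr// divfK ?gt_eqF// ler_piMl ?S1//.
    by rewrite mulr_ge0// ltW.
  have : `|lam (u n) (w n) : R| <= `|lam (u n) (T (x n)) : R| + 2 * e / a.
    rewrite -[w n in leLHS](subrK (T (x n))) addrC linearD/=.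
    by rewrite (le_trans (ler_normD _ _))// lerD2l.
  have -> : (6 * C / a + 1) * e = ((6 * C + 2) / a + 1) * e - 2 * e / a.
    by field; rewrite gt_eqF.
  move: h; lra.
have := CP b x u K w (2 * e) _ _ b1 (point_finite_weakly_null S_point_finite ui Su)
  (fun n => S1 (Su n)) xM Kc Kw (mulr_gt0 (ltr0n _ 2) e0) xP bd.
have -> : C * (3 * (2 * e) / a) = (6 * C / a + 1) * e - e.
  by field; rewrite gt_eqF.
by rewrite lerDl oppr_ge0 leNgt e0.
Qed.

End PointFiniteTensor.

(** * The weakly compactly generated superspace *)

Section ClosedSpan.
Context {R : realType} (B : normedModType R) (A : set B).

Definition cspan_pred : {pred B} := [pred x | `[< cspan A x >]].

Lemma cspan_submod : submod_closed cspan_pred.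
Proof.
split=> [|a x y]; first by rewrite inE; exact: cspan0.
by rewrite !inE => Ax Ay; apply: cspanD => //; exact: cspanZ.
Qed.

HB.instance Definition _ := GRing.isSubmodClosed.Build R _ cspan_pred cspan_submod.

Record cspan_type := CSpan { cspan_val :> B; cspan_valP : cspan_val \in cspan_pred }.

HB.instance Definition _ := [isSub for cspan_val].
HB.instance Definition _ := [Choice of cspan_type by <:].
HB.instance Definition _ := [SubChoice_isSubLmodule of cspan_type by <:].

Lemma cspan_seminormD (x y : cspan_type) :
  `|cspan_val (x + y)| <= `|cspan_val x| + `|cspan_val y|.
Proof. exact: ler_normD. Qed.

Lemma cspan_seminormZ (a : R) (x : cspan_type) :
  `|cspan_val (a *: x)| = `|a| * `|cspan_val x|.
Proof. exact: normrZ. Qed.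

(** The Banach superspace will be the completion for this seminorm, into which the closed span
    embeds isometrically. *)
Definition cspan_seminorm : seminorm cspan_type := Seminorm cspan_seminormD cspan_seminormZ.

Lemma cspan_val_linear (r : R) (x y : cspan_type) :
  cspan_val (r *: x + y) = r *: cspan_val x + cspan_val y.
Proof. by []. Qed.

Lemma norm_completion_cspan (x y : cspan_type) :
  `|to_completion cspan_seminorm x - to_completion cspan_seminorm y| =
  `|cspan_val x - cspan_val y|.
Proof. by rewrite -linearB norm_to_completion. Qed.

Lemma mem_cspan x : cspan A x -> x \in cspan_pred.
Proof. by rewrite inE. Qed.

End ClosedSpan.

Section Embedding.
Context {R : realType} (Z : completeNormedModType R) (L P : Type).
Variables (e : L -> dual Z) (F : nat -> P -> L -> R) (S : nat -> set P) (M : nat -> R).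
Hypothesis e_le1 : forall l, `|e l| <= 1.
Hypothesis e_norming : forall z, exists l, `|z| <= `|e l z : R|.
Hypothesis F_bounded : forall n p l, S n p -> `|F n p l| <= M n.
Hypothesis S_compact : forall n (U : set_system P), UltraFilter U -> U (S n) ->
  exists2 p0, S n p0 & forall l, F n p l @[p --> U] --> F n p0 l.
Hypothesis L_compact : forall V : set_system L, UltraFilter V ->
  exists l0, forall n p, S n p -> F n p l @[l --> V] --> F n p l0.

Definition atoms : set (bfun L) :=
  [set f | exists n p, S n p /\ forall l, f l = F n p l].

Hypothesis e_approx : forall z (f : bfun L), (forall l, f l = e l z) -> cspan atoms f.

Local Notation V := (cspan_type atoms).
Local Notation val_at v l := ((cspan_val (v : V) : bfun L) l).
Local Notation superspace := (completion (cspan_seminorm atoms)).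

Let bddP (f : L -> R) : bdd f -> (f : L -> R^o) \in @bfun_pred R L.
Proof. by rewrite inE. Qed.

Let atom_ex n p : exists v : V, S n p -> forall l, val_at v l = F n p l.
Proof.
have [Sp|nS] := pselect (S n p); last by exists 0.
have b : bdd (F n p) by exists (M n) => l; exact: F_bounded.
have af : cspan atoms (BFun (bddP b)) by apply: cspan_sub; exists n, p.
by exists (CSpan (mem_cspan af)).
Qed.

Let atom n p : V := sval (cid (atom_ex n p)).

Let atomE n p l : S n p -> val_at (atom n p) l = F n p l.
Proof. by move=> Sp; rewrite /atom; case: cid => v /= ->. Qed.

(** A functional on the superspace, pulled back to functions on [L], extends to all bounded
    functions, so Grothendieck's theorem makes pointwise limits of atoms weak limits. *)
Let atoms_weakly_compact n :
  weakly_compact ((fun p => to_completion (cspan_seminorm atoms) (atom n p)) @` S n).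
Proof.
apply: weakly_compact_image_ultra => U UU US.
have [p0 Sp0 p0P] := S_compact UU US; exists p0 => // mu.
pose h (v : V) : R^o := mu (to_completion (cspan_seminorm atoms) v).
have lh : linear h by move=> r u v; rewrite /h !linearP.
have hb (v : V) N : (forall l, `|val_at v l : R| <= N) -> 0 <= N -> `|h v| <= `|mu| * N.
  move=> vN N0; rewrite (le_trans (dual_le _ _))// ler_wpM2l//.
  by rewrite norm_to_completion; exact: sup_norm_le.
have vb (v : V) : bdd (fun l => val_at v l : R).
  by exists (sup_norm (cspan_val v)) => l; exact: sup_norm_ge.
have jP r (x y : V) l : val_at (r *: x + y) l = r * val_at x l + val_at y l.
  by rewrite cspan_val_linear bfunDE bfunZE.
have [nu [nuP nuC nuE]] := @bdd_functional _ L V (fun (v : V) l => val_at v l : R) h `|mu|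
  (normr_ge0 _) lh jP vb hb.
have muE p : S n p -> mu (to_completion _ (atom n p)) = nu (F n p).
  move=> Sp; rewrite -[LHS]/(h (atom n p)) -nuE.
  by congr nu; apply/funext => l; rewrite atomE.
rewrite muE//.
(* This supplies a point of [L], so that every bound N below is nonnegative. *)
have [l0 _] := e_norming 0.
have nuC' f (N : R) : (forall l, `|f l| <= N) -> nu f <= `|mu| * N.
  by move=> fN; apply: nuC => //; exact: le_trans (fN l0).
have FM p l : S n p -> `|F n p l| <= M n by exact: F_bounded.
have Lc W : UltraFilter W -> exists l0, forall p, S n p -> F n p l @[l --> W] --> F n p l0.
  by move=> /L_compact[l1 l1P]; exists l1 => p; exact: l1P.
have := grothendieck (normr_ge0 mu) nuP nuC' FM (@S_compact n) Lc UU US Sp0 p0P.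
apply: cvg_trans; apply: near_eq_cvg.
by apply: filterS US => p Sp /=; rewrite muE.
Qed.

Let superspace_dense :
  @cspan R superspace (\bigcup_n ((fun p => to_completion (cspan_seminorm atoms) (atom n p)) @` S n)) = setT.
Proof.
set E := \bigcup_n _; apply/seteqP; split=> // z _.
apply: cspan_closed; apply/closureP => d d0.
have : closure (range (to_completion (cspan_seminorm atoms))) z by rewrite to_completion_dense.
move=> /closureP/(_ _ (divr_gt0 d0 (ltr0n _ 2)))[_ [v _ <-] zv].
have := cspan_valP v; rewrite inE => /closureP/(_ _ (divr_gt0 d0 (ltr0n _ 2)))[y Ay vy].
have [w [wy Ew]] : exists w : V, cspan_val w = y /\ cspan E (to_completion _ w).
  move: y Ay {vy}; apply: (@lspan_min _ _ _
    [set y | exists w : V, cspan_val w = y /\ cspan E (to_completion _ w)]).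
  - by exists 0; split=> //; rewrite linear0; exact: cspan0.
  - move=> _ _ [u [<- Eu]] [w [<- Ew]]; exists (u + w); split=> //.
    by rewrite linearD; exact: cspanD.
  - move=> r _ [u [<- Eu]]; exists (r *: u); split=> //.
    by rewrite linearZ; exact: cspanZ.
  - move=> f [n [p [Sp fE]]]; exists (atom n p); split.
      by apply/val_inj/funext => l; rewrite /= fE atomE.
    by apply: cspan_sub; exists n => //; exists p.
exists (to_completion _ w); first exact: Ew.
have vw : `|to_completion (cspan_seminorm atoms) v - to_completion _ w| < d / 2.
  by rewrite norm_completion_cspan wy.
rewrite -(subrKA (to_completion _ v)); apply: le_lt_trans (ler_normD _ _) _.
by rewrite [ltRHS]splitr; exact: ltrD zv vw.
Qed.

Let embed_ex z : exists v : V, forall l, val_at v l = e l z.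
Proof.
have b : bdd (fun l => e l z : R).
  exists `|z| => l; rewrite (le_trans (dual_le _ _))//.
  by rewrite ler_piMl.
have af := @e_approx z (BFun (bddP b)) (fun l => erefl).
by exists (CSpan (mem_cspan af)).
Qed.

Let embed z : superspace := to_completion _ (sval (cid (embed_ex z))).

Let embed_linear : linear embed.
Proof.
move=> r x y; rewrite /embed -linearP; congr to_completion.
apply/val_inj/val_inj/funext => l.
case: cid => u /= uE; case: cid => v /= vE; case: cid => w /= wE.
by rewrite uE linearP -[RHS]/(r * val_at v l + val_at w l) vE wE.
Qed.

Let embed_norm z : `|embed z| = `|z|.
Proof.
rewrite /embed norm_to_completion /=; case: cid => v /= vE.
apply/eqP; rewrite eq_le; apply/andP; split.
  apply: sup_norm_le => // l; rewrite vE (le_trans (dual_le _ _))//.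
  by rewrite ler_piMl.
have [l zl] := e_norming z; rewrite (le_trans zl)// -vE.
exact: sup_norm_ge.
Qed.

Theorem embedding_subspace_of_WCG : subspace_of_WCG Z.
Proof.
exists (completion (cspan_seminorm atoms)); split.
  have [] := WCG_union atoms_weakly_compact (r := M) _ superspace_dense.
    move=> n _ [p Sp <-]; rewrite norm_to_completion /=.
    have [l0 _] := e_norming 0.
    apply: sup_norm_le => [|l]; first by rewrite (le_trans _ (F_bounded l0 Sp)).
    by rewrite atomE// F_bounded.
  by move=> G [Gc _ _ Gd]; exists G.
pose J : {linear Z -> superspace} := HB.pack embed
  (GRing.isLinear.Build R Z superspace *:%R embed embed_linear).
exists J; split; last by exists 1, 1; split=> // x; rewrite !mul1r /= embed_norm.
apply/closure_id/seteqP; split; first exact: subset_closure.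
move=> w /closureP Jw.
have e0 n : 0 < n.+1%:R^-1 :> R by rewrite invr_gt0 ltr0n.
have /choice[z zP] : forall n, exists z, `|w - embed z| < n.+1%:R^-1.
  by move=> n; have [_ [z _ <-] h] := Jw _ (e0 n); exists z.
have embedB x y : embed x - embed y = embed (x - y) by rewrite -[embed]/(J : _ -> _) linearB.
have /cvg_ex[x zx] : cvgn z.
  apply: cauchy_cvg; apply: cauchy_exP => d d0.
  have [k kP] := small_invn (divr_gt0 d0 (ltr0n _ 2)).
  exists (z k); exists k => // m /= km; rewrite -ball_normE/=.
  rewrite -embed_norm -embedB -(subrKA w) (le_lt_trans (ler_normD _ _))//.
  rewrite [ltRHS]splitr ltrD//; last exact: lt_trans (zP m) (kP m km).
  by rewrite distrC; exact: lt_trans (zP k) (kP k (leqnn k)).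
exists x => //=; apply/eqP; rewrite -subr_eq0 -normr_le0; apply/ler_addgt0Pl => d d0.
rewrite addr0; have d2 := divr_gt0 d0 (ltr0n R 2).
have [k kP] := small_invn d2.
have := zx => /cvgrPdist_lt/(_ _ d2)[k' _ k'P].
pose n := maxn k k'; rewrite -(subrKA (embed (z n))) (le_trans (ler_normD _ _))//.
rewrite [leRHS]splitr lerD//; last first.
  rewrite distrC; apply/ltW/(lt_trans (zP n))/kP; exact: leq_maxl.
by rewrite embedB embed_norm; apply/ltW/k'P => /=; exact: leq_maxr.
Qed.

End Embedding.

Section SoftThreshold.
Context {R : realType}.

(** Subtracting the truncation to [-t, t], instead of cutting off, keeps the function continuous, so
    thresholding commutes with pointwise limits. *)
Definition soft (t s : R) : R := s - Num.max (- t) (Num.min s t).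

Lemma soft_lip t s s' : `|soft t s - soft t s'| <= `|s - s'|.
Proof.
wlog ss' : s s' / s <= s' => [h|].
  by have [/h//|/ltW/h] := leP s s'; rewrite distrC [leRHS]distrC.
rewrite [leRHS]distrC (ger0_norm (_ : 0 <= s' - s)) ?subr_ge0//.
rewrite /soft /Num.max /Num.min ler_norml.
by repeat case: ifPn; rewrite -?leNgt => *; apply/andP; split; lra.
Qed.

Lemma soft_small t s : `|s| <= t -> soft t s = 0.
Proof.
rewrite ler_norml /soft /Num.max /Num.min => /andP[h1 h2].
by repeat case: ifPn; rewrite -?leNgt => *; lra.
Qed.

Lemma soft_dist t s : 0 <= t -> `|s - soft t s| <= t.
Proof.
rewrite /soft /Num.max /Num.min ler_norml => t0.
by repeat case: ifPn; rewrite -?leNgt => *; apply/andP; split; lra.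
Qed.

Lemma soft_le t s : 0 <= t -> `|soft t s| <= `|s|.
Proof.
move=> t0; have := soft_lip t s 0; rewrite (@soft_small t 0) ?normr0//.
by rewrite !subr0.
Qed.

Lemma soft_cvg (I : Type) (U : set_system I) {FU : Filter U} (g : I -> R) (t s : R) :
  g i @[i --> U] --> s -> soft t (g i) @[i --> U] --> soft t s.
Proof.
move=> /cvgrPdist_lt gs; apply/cvgrPdist_lt => d d0.
have := gs d d0; rewrite !near_simpl; apply: filterS => i.
by apply: le_lt_trans; exact: soft_lip.
Qed.

End SoftThreshold.

Section Combinations.
Context {R : realType} (W : normedModType R) (K : set W).
Hypothesis K_compact : weakly_compact K.
Hypothesis K_le1 : forall w, K w -> `|w| <= 1.

(** Integer bounds on the coefficients and a fixed number of terms split the span of [K] into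
    countably many weakly compact sets, the form [WCG_union] accepts. *)
Fixpoint comb (B m : nat) : set W :=
  if m is m'.+1 then
    [set z.1.1 *: z.1.2 + z.2 | z in
      [set z : R * W * W | [/\ `|z.1.1| <= B%:R, K z.1.2 & comb B m' z.2]]]
  else [set 0].

Lemma comb_weakly_compact B m : weakly_compact (comb B m).
Proof.
elim: m => [|m IH]; first exact: compact_set1.
apply: weakly_compact_image_ultra => U UU US.
have B1 : \forall z \near U, `|z.1.1| <= B%:R by apply: filterS US => z [].
have [r rP] := ultra_bounded_cvg UU B1.
have [|k Kk kP] := (weakly_compactP K).1 K_compact _ (fmap_ultra (fun z => z.1.2) UU).
  have : U ((fun z => z.1.2) @^-1` K) by apply: filterS US => z [].
  exact.
have [|y my yP] := (weakly_compactP _).1 IH _ (fmap_ultra (fun z => z.2) UU).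
  have : U ((fun z => z.2) @^-1` comb B m) by apply: filterS US => z [].
  exact.
exists (r, k, y); first by split=> //; exact: cvg_norm_le rP B1.
move=> f; rewrite linearD linearZ/=.
under eq_fun do rewrite linearD linearZ/=.
apply: cvgD; last exact: yP.
by apply: cvgM => //; exact: kP.
Qed.

Lemma comb_norm B m w : comb B m w -> `|w| <= (B * m)%:R.
Proof.
elim: m w => [|m IH] w; first by move=> ->; rewrite normr0.
move=> [[[r k] y] /= [rB Kk /IH yb] <-].
rewrite (le_trans (ler_normD _ _))// mulnS natrD lerD//.
by rewrite normrZ -[leRHS]mulr1; apply: ler_pM => //; exact: K_le1.
Qed.

Lemma lspan_comb w : lspan K w -> exists B m, comb B m w.
Proof.
move=> [s sK <-]; exists (Num.truncn (\sum_(z <- s) `|z.1|)).+1, (size s).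
set B := (Num.truncn _).+1.
have : \sum_(z <- s) `|z.1| <= B%:R by rewrite /B ltW// truncnS_gt.
move: B => B; elim: s sK => [|z s IH] sK; first by rewrite !big_nil.
rewrite !big_cons => sB; exists (z.1, z.2, \sum_(x <- s) x.1 *: x.2) => //.
have s0 : 0 <= \sum_(x <- s) `|x.1| by apply: sumr_ge0.
split=> /=; first by rewrite (le_trans _ sB)// lerDl.
  by apply: sK; rewrite mem_head.
apply: IH; first by move=> x xs; apply: sK; rewrite inE xs orbT.
by rewrite (le_trans _ sB)// lerDr.
Qed.

End Combinations.

Section Superspace.
Context {R : realType} (X Y W : completeNormedModType R) (T : {linear X -> W}) (a : R).
Hypothesis a0 : 0 < a.
Hypothesis Ta : forall x, a * `|x| <= `|T x|.
Variable K : set W.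
Hypothesis K_compact : weakly_compact K.
Hypothesis K_le1 : forall w, K w -> `|w| <= 1.
Hypothesis K_dense : cspan K = setT.
Variable S : set Y.
Hypothesis S_le1 : forall y, S y -> `|y| <= 1.
Hypothesis S_dense : cspan S = setT.
Variable C : R.
Hypothesis C0 : 0 < C.
Hypothesis S_finite : forall b lam (K' : set W) (M e : R),
  extension_pair T a b lam -> weakly_compact K' -> (forall w, K' w -> `|w| <= M) -> 0 < e ->
  finite_set (S `&` [set y | exists w, [/\ K' w, near_range T e w &
                                       C * e < `|lam y w : R|]]).

Local Notation Z := (X \ptensor Y).

Let T_linear : linear T. Proof. exact: linearP. Qed.

Definition pairs := {l : dual Z * (Y -> dual W) | extension_pair T a l.1 l.2}.

Definition pair_form (l : pairs) : dual Z := (sval l).1.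

Definition pair_ext (l : pairs) : Y -> dual W := (sval l).2.

Lemma pairP l : extension_pair T a (pair_form l) (pair_ext l).
Proof. exact: svalP l. Qed.

Lemma extension_pair_ex (b : dual Z) : `|b| <= 1 -> exists lam, extension_pair T a b lam.
Proof.
move=> b1; have /choice[lam lamP] : forall y, exists f : dual W, `|f| <= `|y| / a /\
    forall x, f (T x) = b (tens x y).
  move=> y; have [g [gy gE]] := dual_tensl b y.
  have [f [fg fE]] := dual_extend g T_linear a0 Ta.
  exists f; split; last by move=> x; rewrite fE gE.
  rewrite (le_trans fg)// ler_wpM2r ?invr_ge0 ?(ltW a0)//.
  by rewrite (le_trans gy)// ler_piMl.
exists lam; split=> // [y|x y]; first exact: (lamP y).1.
exact: (lamP y).2.
Qed.

Definition eps (k : nat) : R := k.+1%:R^-1.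

Lemma eps_gt0 k : 0 < eps k. Proof. by rewrite invr_gt0. Qed.

Definition params (n : nat) : nat * nat * nat := odflt (0, 0, 0)%N (unpickle n).

Lemma params_pickle p : params (pickle p) = p.
Proof. by rewrite /params pickleK. Qed.

(** [None] is a point at infinity with atom 0, the limit of (y, w) when y leaves every finite
    set. *)
Definition index_set (n : nat) : set (option (Y * W)) :=
  let: (k, B, m) := params n in
  [set p | if p is Some (y, w) then [/\ S y, comb K B m w & near_range T (eps k) w]
           else True].

Definition atom_fun (n : nat) (p : option (Y * W)) (l : pairs) : R :=
  if p is Some (y, w) then soft (C * eps (params n).1.1) (pair_ext l y w) else 0.

Let pair_bound (l : pairs) y w : S y -> `|pair_ext l y w : R| <= a^-1 * `|w|.
Proof.
move=> Sy; have [_ h _] := pairP l; rewrite (le_trans (dual_le _ _))//.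
by rewrite ler_wpM2r// (le_trans (h y))// ler_piMl ?invr_ge0 ?(ltW a0)// S_le1.
Qed.

Let thr_ge0 k : 0 <= C * eps k.
Proof. by rewrite mulr_ge0 ?(ltW C0)// ltW// eps_gt0. Qed.

Lemma atom_fun_bounded n p l : index_set n p ->
  `|atom_fun n p l| <= a^-1 * ((params n).1.2 * (params n).2)%:R.
Proof.
rewrite /index_set /atom_fun; case: (params n) => -[k B] m /=.
case: p => [[y w]|] /=; last by rewrite normr0 mulr_ge0 ?invr_ge0 ?(ltW a0).
move=> [Sy mw _]; rewrite (le_trans (soft_le _ _))// (le_trans (pair_bound _ _ Sy))//.
by rewrite ler_wpM2l ?invr_ge0 ?(ltW a0)// (comb_norm K_le1).
Qed.

(** If the ultrafilter fixes y, only w moves, and it converges weakly. Otherwise y leaves every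
    finite set; for each pair l only finitely many y give a value above C * eps k, and the threshold
    sends the others to 0, the atom of [None]. *)
Lemma index_set_compact n (U : set_system (option (Y * W))) : UltraFilter U ->
  U (index_set n) -> exists2 p0, index_set n p0 &
    forall l, atom_fun n p l @[p --> U] --> atom_fun n p0 l.
Proof.
move=> UU; rewrite /index_set /atom_fun; case: (params n) => -[k B] m /= US.
have [[y0 Uy0]|nU] := pselect (exists y, U [set p | exists w, p = Some (y, w)]).
  pose snd0 (p : option (Y * W)) : W := if p is Some q then q.2 else 0.
  have UK : U (snd0 @^-1` comb K B m `&` [set p | S y0 /\ near_range T (eps k) (snd0 p)]).
    by apply: filterS (filterI US Uy0) => p [+ [w pE]]; rewrite pE /snd0 /= => -[? ? ?].
  have [|w0 mw0 w0P] := (weakly_compactP _).1 (@comb_weakly_compact _ _ _ K_compact B m)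
    _ (fmap_ultra snd0 UU).
    have : U (snd0 @^-1` comb K B m) by apply: filterS UK => p [].
    exact.
  have {}w0P (f : dual W) : (f (snd0 p) : R) @[p --> U] --> (f w0 : R) by exact: w0P.
  exists (Some (y0, w0)).
    have /filter_ex[p [_ [Sy0 _]]] := UK.
    split=> // f fT; apply: cvg_norm_le (w0P f) _.
    by apply: filterS UK => q [_ [_ /(_ f fT)]].
  move=> l; have h : soft (C * eps k) (pair_ext l y0 (snd0 p)) @[p --> U] -->
      soft (C * eps k) (pair_ext l y0 w0) by apply: soft_cvg; exact: w0P.
  apply: cvg_trans h; apply: near_eq_cvg.
  by apply: filterS Uy0 => p [w ->].
exists None => // l; apply/cvgrPdist_lt => d d0; rewrite near_simpl.
have finS := S_finite (pairP l) (@comb_weakly_compact _ _ _ K_compact B m)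
  (@comb_norm _ _ _ K_le1 B m) (eps_gt0 k).
move: finS; set E := S `&` _ => /finite_seqP[s sE].
have Us : U (~` [set p | exists y w, y \in s /\ p = Some (y, w)]).
  elim: (s) => [|y s' IH].
    by apply: filterS filterT => p _ [y [w []]].
  have [h|h] := in_ultra_setVsetC [set p | exists w, p = Some (y, w)] UU.
    by exfalso; apply: nU; exists y.
  apply: filterS (filterI IH h) => p [h1 h2] [z [w []]]; rewrite inE.
  move=> /predU1P[->|zs'] pE; first by apply: h2; exists w.
  by apply: h1; exists z, w.
apply: filterS (filterI US Us) => -[[y w]|] [] /=; last by rewrite subrr normr0.
move=> [Sy mw kw] nE; rewrite soft_small ?subrr ?normr0//.
rewrite leNgt; apply/negP => big; apply: nE; exists y, w; split=> //.
have : E y by split=> //; exists w.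
by rewrite sE.
Qed.

(** Alaoglu's theorem for b and for each [lam y] separately; the identity linking them is pointwise
    and passes to the limit. *)
Lemma pairs_compact (V : set_system pairs) : UltraFilter V ->
  exists l0, forall n p, index_set n p -> atom_fun n p l @[l --> V] --> atom_fun n p l0.
Proof.
move=> UV.
have [b0 [b01 b0P]] : exists b0 : dual Z, `|b0| <= 1 /\
    forall z, (pair_form l z : R) @[l --> V] --> (b0 z : R).
  apply: (alaoglu UV ler01); apply: filterS filterT => l _.
  by have [] := pairP l.
have /choice[lam lamP] : forall y, exists f : dual W, `|f| <= `|y| / a /\
    forall w, (pair_ext l y w : R) @[l --> V] --> (f w : R).
  move=> y; apply: (alaoglu UV (divr_ge0 (normr_ge0 y) (ltW a0))).
  by apply: filterS filterT => l _; have [_ h _] := pairP l.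
have P0 : extension_pair T a b0 lam.
  split=> // [y|x y]; first exact: (lamP y).1.
  have h1 := (lamP y).2 (T x); have h2 := b0P (tens x y).
  apply: (cvg_unique (@norm_hausdorff _ _) h1).
  apply: cvg_trans h2; apply: near_eq_cvg; apply: filterS filterT => l _.
  by have [_ _ ->] := pairP l.
exists (exist _ (b0, lam) P0) => n [[y w] _|_]; last exact: cvg_cst.
by apply: soft_cvg; exact: (lamP y).2.
Qed.

(** Take w in the span of [K] within eps k of T x. Replacing [lam y (T x)] by [lam y w] costs eps k
    / a and thresholding costs C * eps k; both tend to 0. *)
Lemma tens_cspan_atoms x y (f : bfun pairs) : S y ->
  (forall l, f l = pair_form l (tens x y)) -> cspan (atoms atom_fun index_set) f.
Proof.
move=> Sy fE; apply: cspan_closed; apply/closureP => d d0.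
have aC : 0 < a^-1 + C + 1 by rewrite !addr_gt0// invr_gt0.
have [k kd] : exists k, eps k < d / (a^-1 + C + 1).
  exists (Num.truncn (d / (a^-1 + C + 1))^-1).
  by rewrite invf_plt ?posrE ?ltr0n ?divr_gt0//; exact: truncnS_gt.
have : cspan K (T x) by rewrite K_dense.
move=> /closureP/(_ _ (eps_gt0 k))[w /lspan_comb[B [m mw]] xw].
pose n : nat := pickle (k, B, m); pose p := Some (y, w).
have np : index_set n p.
  rewrite /index_set /n params_pickle; split=> //; apply: (@near_range_dist _ _ _ _ _ _ x).
  by rewrite distrC ltW.
have b : (atom_fun n p : pairs -> R^o) \in @bfun_pred R pairs.
  rewrite inE; exists (a^-1 * ((params n).1.2 * (params n).2)%:R) => l.
  exact: atom_fun_bounded.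
exists (BFun b); first by apply: cspan_sub; exists n, p.
have : `|f - BFun b| <= (a^-1 + C) * eps k.
  apply: sup_norm_le => [|l].
    by rewrite mulr_ge0 ?addr_ge0 ?invr_ge0 ?(ltW a0) ?(ltW C0)// ltW// eps_gt0.
  have -> : (f - BFun b) l = f l - atom_fun n p l by [].
  rewrite fE /atom_fun /n params_pickle /=; have [_ _ <-] := pairP l.
  rewrite -(subrKA (pair_ext l y w)) (le_trans (ler_normD _ _))// mulrDl lerD//.
    by rewrite -linearB/= (le_trans (pair_bound _ _ Sy))// ler_wpM2l ?invr_ge0 ?(ltW a0)// ltW.
  exact: soft_dist.
move=> /le_lt_trans; apply; move: kd; rewrite ltr_pdivlMr// mulrC.
apply: le_lt_trans; rewrite ler_wpM2r ?(ltW (eps_gt0 k))// lerDl//.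
Qed.

Lemma eval_cspan_atoms z (f : bfun pairs) : (forall l, f l = pair_form l z) ->
  cspan (atoms atom_fun index_set) f.
Proof.
move=> fE.
have le z' l : `|pair_form l z' : R| <= 1 * `|z'|.
  by have [h _ _] := pairP l; rewrite (le_trans (dual_le _ _))// ler_wpM2r.
have bP z' : (fun l : pairs => pair_form l z' : R^o) \in @bfun_pred R pairs.
  by rewrite inE; exists (1 * `|z'|) => l; exact: le.
pose Q z' := BFun (bP z').
have lQ : linear Q.
  by move=> r u v; apply/val_inj/funext => l; rewrite /= linearP.
have QC z' : `|Q z'| <= 1 * `|z'|.
  by apply: sup_norm_le => [|l]; [rewrite mulr_ge0|exact: le].
have -> : f = Q z by apply/val_inj/funext => l; rewrite /= fE.
have : cspan [set tens u.1 u.2 | u in [set u : X * Y | S u.2]] z by rewrite tens_dense.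
move=> /(cspan_image lQ QC); apply: cspan_min => _ [_ [[x y] /= Sy <-] <-].
exact: tens_cspan_atoms Sy _.
Qed.

Lemma projective_tensor_subspace_of_WCG : subspace_of_WCG Z.
Proof.
apply: (@embedding_subspace_of_WCG _ Z pairs _ pair_form atom_fun index_set
  (fun n => a^-1 * ((params n).1.2 * (params n).2)%:R)).
- by move=> l; have [] := pairP l.
- move=> z; have [b [b1 bz]] := dual_norming z.
  have [lam bl] := extension_pair_ex b1.
  by exists (exist _ (b, lam) bl); rewrite /= bz ler_norm.
- exact: atom_fun_bounded.
- exact: index_set_compact.
- exact: pairs_compact.
- exact: eval_cspan_atoms.
Qed.

End Superspace.

Theorem theorem5p14 (R : realType) (X Y : completeNormedModType R)
    (hDP : dual_quantitative_DP X \/ direct_quantitative_DP Y)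
    (hX : subspace_of_WCG X) (hY : WCG Y) :
  subspace_of_WCG (X \ptensor Y).
Proof.
have [W [[K0 K0c K0d] [T [_ [a [b [a0 _ Tab]]]]]]] := hX.
have [K [Kc K1 _ Kd]] := WCG_bounded K0c K0d.
have [S [S1 Sd Sf]] := amir_lindenstrauss hY.
have Ta x : a * `|x| <= `|T x| by have [] := Tab x.
have [C C0 Cf] := finite_large_extension (@linearP _ _ _ _ T) a0 Ta S1 Sf hDP.
exact: (@projective_tensor_subspace_of_WCG _ X Y W T a a0 Ta K Kc K1 Kd S S1 Sd C C0 Cf).
Qed.
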